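(* Let $G=\mathrm{PSL}_2(q)$, where $q$ is a power of an odd prime $p$. For a positive integer $m$, let $\varphi(m)$ denote the number of integers in $[1,m]$ coprime to $m$, and let $\tau(m)$ denote the number of positive divisors of $m$. Define $$A=\left\{\,2<d\le\tfrac{q+1}{2} : d\mid\tfrac{q+1}{2}\,\right\},\qquad B=\left\{\,2<d\le\tfrac{q-1}{2} : d\mid\tfrac{q-1}{2}\,\right\}.$$ Then the following statements hold. (1) There is a unique trivial $\mathbb{Q}G$-module of dimension $1$. (2) There is a unique (up to isomorphism) Steinberg $\mathbb{Q}G$-module of dimension $q$. (3) For each $d\in A$, there exists a unique (up to isomorphism) simple $\mathbb{Q}G$-module of dimension $\frac{q-1}{2}\varphi(d)$, and these modules are pairwise non-isomorphic for distinct $d$. (4) For each $d\in B$, there exists a unique (up to isomorphism) simple $\mathbb{Q}G$-module of dimension $\frac{q+1}{2}\varphi(d)$, and these modules are pairwise non-isomorphic for distinct $d$. (5) The remaining simple $\mathbb{Q}G$-modules are as follows, and they are non-isomorphic to any modules arising from parts (3) and (4): - if $q\equiv3\pmod4$, there exists a unique (up to isomorphism) simple $\mathbb{Q}G$-module of dimension $q-1$; - if $q\equiv1\pmod4$ and $q$ is not a square, there exists a unique (up to isomorphism) simple $\mathbb{Q}G$-module of dimension $q+1$; - if $q\equiv1\pmod4$ and $q$ is a square, there exist two (up to isomorphism) simple $\mathbb{Q}G$-modules of dimension $\frac{q+1}{2}$. (6) $$|\mathrm{Irr}_{\mathbb{Q}}(G)|=\begin{cases}\tau\!\left(\frac{q-1}{2}\right)+\tau\!\left(\frac{q+1}{2}\right)+1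 & \text{if } q\equiv1\pmod4\text{ and } q\text{ is a square},\\[1ex] \tau\!\left(\frac{q-1}{2}\right)+\tau\!\left(\frac{q+1}{2}\right) & \text{otherwise.}\end{cases}$$
   Context: $\mathrm{SL}_2(q)$ is the group of $2\times2$ matrices of determinant $1$ over the finite field $\mathbb{F}_q$, and $\mathrm{PSL}_2(q)=\mathrm{SL}_2(q)/Z(\mathrm{SL}_2(q))$. $\mathrm{Irr}_{\mathbb{Q}}(G)$ denotes the set of irreducible rational characters of $G$, i.e. characters afforded by irreducible representations of $G$ over $\mathbb{Q}$ (equivalently, isomorphism classes of simple $\mathbb{Q}G$-modules). A Steinberg $\mathbb{Q}G$-module is a simple $\mathbb{Q}G$-module affording the Steinberg character, the irreducible complex character of degree $q$ of $G$. ''Remaining'' in (5) means not among the modules of parts (1)-(4). Dimensions are over $\mathbb{Q}$.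
   Formalization: Uniqueness by dimension in (3), (4) fails (q=11: d=3, 6 and the module of (5) all give dimension 10); proved instead: apart from the remaining modules of (5), each simple module of that dimension is isomorphic to the module of exactly one d' in A (resp. B) with φ(d')=φ(d). *)

(* Defs.v *)
From HB Require Import structures.
From mathcomp Require Import all_boot all_order all_fingroup all_algebra.
From mathcomp Require Import all_solvable all_field all_character.

Set Implicit Arguments.
Unset Strict Implicit.
Unset Printing Implicit Defensive.

Import GroupScope.

Section SpecialLinear.
Variable F : finFieldType.

Definition SL2 : {set {'GL_2[F]}} := [set g | (\det (GLval g) == 1)%R].

Lemma SL2_group_set : group_set SL2.
Proof.
apply/group_setP; split=> [|x y]; first by rewrite inE GL_1E det1.
rewrite !inE GL_MxE => /eqP dx /eqP dy.
by rewrite det_mulmx dx dy GRing.mulr1.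
Qed.

Canonical SL2_group := Group SL2_group_set.

Definition PSL2 : {set coset_of 'Z(SL2)} := SL2 / 'Z(SL2).
Canonical PSL2_group := Eval hnf in [group of PSL2].

End SpecialLinear.

(* Finite-dimensional QG-modules, as matrix representations over rat;         *)
(* isomorphism of modules is then similarity of representations.              *)
Record QGmodule (gT : finGroupType) (G : {group gT}) := MkQGmodule {
  qdim : nat;
  qrepr :> mx_representation rat G qdim
}.

Section Modules.
Variables (gT : finGroupType) (G : {group gT}).
Implicit Types (M N : QGmodule G) (phi : 'CF(G)).

Definition simple_mod M : Prop := mx_irreducible M.

Definition iso_mod M N : Prop := mx_rsim M N.

Definition trivial_mod M : Prop := forall x, x \in G -> M x = 1%:M%R.

(* The trace character of M, viewed in the algC-valued class functions. *)
Definition mod_char M : 'CF(G) := cfRepr (map_repr (@ratr algC) M).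

Definition steinberg_char (q : nat) phi : Prop :=
  phi \in irr G /\ phi 1 = (q%:R)%R.

Definition steinberg_mod (q : nat) M : Prop :=
  simple_mod M /\ steinberg_char q (mod_char M).

Definition irrQ phi : Prop :=
  exists2 M : QGmodule G, simple_mod M & phi = mod_char M.

Definition card_irrQ (n : nat) : Prop :=
  exists s : seq 'CF(G),
    [/\ uniq s, forall phi, phi \in s <-> irrQ phi & size s = n].

End Modules.

Definition tau (m : nat) : nat := size (divisors m).

Definition setA (q : nat) : pred nat :=
  [pred d | 2 < d <= (q + 1) %/ 2 & d %| (q + 1) %/ 2].
Definition setB (q : nat) : pred nat :=
  [pred d | 2 < d <= (q - 1) %/ 2 & d %| (q - 1) %/ 2].

Definition is_square (q : nat) : Prop := exists r : nat, q = (r ^ 2)%N.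

(* M is a simple module isomorphic neither to T, nor to S, nor to a member of *)
(* the families V (indexed by A) and W (indexed by B).                        *)
Definition remaining (gT : finGroupType) (G : {group gT}) (q : nat)
    (T S : QGmodule G) (V W : nat -> QGmodule G) (M : QGmodule G) : Prop :=
  [/\ simple_mod M, ~ iso_mod M T, ~ iso_mod M S,
      forall d, d \in setA q -> ~ iso_mod M (V d)
    & forall d, d \in setB q -> ~ iso_mod M (W d)].

(* X is a family of pairwise non-isomorphic simple modules, one for each d in *)
(* D, with X d of dimension e * totient d, and, outside the modules in R, for *)
(* each d in D the simple modules of dimension e * totient d are, up to       *)
(* isomorphism, exactly the X d' with totient d' = totient d.  Distinct d may *)
(* have the same totient (3, 4 and 6 for instance), so the dimension alone    *)
(* determines the module only within the family, not d itself.                *)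
Definition simple_family (gT : finGroupType) (G : {group gT}) (D : pred nat)
    (e : nat) (X : nat -> QGmodule G) (R : QGmodule G -> Prop) : Prop :=
  [/\ forall d, d \in D ->
        simple_mod (X d) /\ qdim (X d) = (e * totient d)%N,
      forall d d', d \in D -> d' \in D -> d <> d' -> ~ iso_mod (X d) (X d')
    & forall d, d \in D -> forall M : QGmodule G,
        simple_mod M -> qdim M = (e * totient d)%N -> ~ R M ->
        exists! d', [/\ d' \in D, totient d' = totient d & iso_mod M (X d')]].

(* Main.v *)
From HB Require Import structures.
Require Import Defs.
From mathcomp Require Import all_boot all_order all_fingroup all_algebra.
From mathcomp Require Import all_solvable all_field all_character.
From mathcomp Require Import zify ring.
From Stdlib Require Import Classical IndefiniteDescription.

Set Implicit Arguments.
Unset Strict Implicit.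
Unset Printing Implicit Defensive.

Import Order.TTheory GroupScope GRing.Theory Num.Theory.
Local Open Scope ring_scope.

(** Let U be the unipotent subgroup of G = PSL_2(q), B its normalizer, and let
    A_+ and A_- be the split and nonsplit tori, of orders (q-1)/2 and (q+1)/2.
    Every nontrivial element of G is conjugate into exactly one of U, A_+, A_-,
    and these are TI subgroups, so scalar products of class functions reduce to
    sums over U, A_+ and A_-.  Put St = Ind_B^G 1 - 1.  For a linear character
    phi of A_e, e = +-1, the class function X(phi) = e (Ind phi - (St^2 - 1)) is
    a virtual character of degree q + e, vanishing on A_{-e}; it is irreducible
    unless phi^2 = 1, and X(phi) = X(psi) only for psi = phi or phi^-1.  The
    character phi of order 2 of the torus of even order gives the sum of two
    "half" characters, and the sum of the squared degrees shows that there are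
    no further irreducible characters.  The X(phi) with phi of order d > 2 form
    a Galois orbit.  The difference f of the half characters is supported on the
    conjugates of U^#, where |f|^2 = q, so they are rational exactly when
    q = 1 mod 4 is a square.

    All Schur indices are 1, since the Schur index of a character divides its
    multiplicity in every permutation module, and two of these multiplicities
    differ by one.  Hence the simple QG-modules afford the Galois orbit sums. *)

(** * Rational modules and their characters *)

(** The formula for X(phi) treats both tori alike and needs no model of the discrete series. St
    takes the values 1, -1 and 0 on the nontrivial elements of A_+, A_- and U, so St^2 - 1 vanishes
    there on both tori and is -1 on U^#: subtracting it leaves the torus values of Ind phi intact,
    cuts the degree from q(q + e) to e(q + e), and gives X(phi) the constant value e on U^#.

    No classification of conjugacy classes is needed either. The class supports of U, A_+ and A_-
    are disjoint because the three orders are pairwise coprime, and counting them exhausts G.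

    The torus orders are consecutive integers, so exactly one is even, and all comparisons of
    multiplicities rest on this. For the X(phi) of the odd torus, the normalizer of the even torus
    is compared with G itself; for those of the even torus, its normalizer is compared with a
    dihedral subgroup of index 2; for the half characters, the odd torus is compared with G.

    The character theory runs in any group with this subgroup configuration; matrices serve only to
    establish the configuration. *)

Lemma mul_delta_mxE (R : pzRingType) m n p r (A : 'M[R]_(m, n)) (B : 'M_(p, r))
    i j k l :
  (A *m delta_mx i j *m B) k l = A k i * B j l.
Proof.
rewrite -(mul_delta_mx (0 : 'I_1)) mulmxA -colE -mulmxA -rowE.
by rewrite mxE big_ord1 !mxE.
Qed.

Lemma big_irr_seq (gT : finGroupType) (G : {group gT}) (V : nmodType)
    (L : seq 'CF(G)) (F : 'CF(G) -> V) :
    uniq L -> {subset L <= irr G} ->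
  \sum_(phi <- L) F phi = \sum_(i | 'chi[G]_i \in L) F 'chi_i.
Proof.
move=> uniqL irrL; pose t := [seq cfIirr phi | phi <- L].
have uniq_t : uniq t.
  rewrite map_inj_in_uniq // => phi psi /irrL irr_phi /irrL irr_psi.
  by move/(congr1 (fun i => 'chi_i)); rewrite !cfIirrE.
rewrite [RHS](eq_bigl (mem t)) => [|i].
  rewrite -big_uniq // big_map [LHS]big_seq [RHS]big_seq.
  by apply: eq_bigr => phi /irrL irr_phi; rewrite cfIirrE.
apply/idP/mapP=> [Li|[phi Lphi ->]]; last by rewrite cfIirrE ?irrL.
by exists 'chi_i => //; apply: irr_inj; rewrite cfIirrE ?mem_irr.
Qed.

Section RationalModules.
Variables (gT : finGroupType) (G : {group gT}).
Implicit Types M N R : QGmodule G.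

Lemma mod_charE M x : x \in G -> mod_char M x = ratr (\tr (M x)).
Proof. by move=> Gx; rewrite cfunE Gx /= map_reprE -trace_map_mx. Qed.

Lemma mod_char_Crat M x : mod_char M x \in Crat.
Proof.
have [Gx|nGx] := boolP (x \in G); last by rewrite cfun0 ?rpred0.
by rewrite mod_charE // Crat_rat.
Qed.

Lemma mod_char_char M : mod_char M \is a character.
Proof. exact: cfRepr_char. Qed.

Lemma mod_char1 M : mod_char M 1%g = (qdim M)%:R.
Proof. exact: cfRepr1. Qed.

Lemma mod_char_aut (u : {rmorphism algC -> algC}) M :
  cfAut u (mod_char M) = mod_char M.
Proof. by apply/cfunP=> x; rewrite cfunE aut_Crat ?mod_char_Crat. Qed.

Lemma iso_mod_char M N : iso_mod M N -> mod_char M = mod_char N.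
Proof.
move=> iMN; apply/cfun_inP=> x Gx; rewrite !mod_charE //.
by rewrite (mxtrace_rsim iMN).
Qed.

Lemma simple_hom_iso M N (f : 'M_(qdim M, qdim N)) :
    simple_mod M -> simple_mod N ->
    (forall x, x \in G -> M x *m f = f *m N x) -> f != 0 -> iso_mod M N.
Proof.
move=> /mx_irrP[dM simM] /mx_irrP[dN simN] homf nzf.
have kerf : kermx f = 0.
  apply/eqP; apply: contraR nzf => nzk.
  have /simM/(_ nzk) : mxmodule M (kermx f).
    apply/mxmoduleP=> x Gx; apply/sub_kermxP.
    by rewrite -mulmxA homf // mulmxA mulmx_ker mul0mx.
  rewrite -sub1mx => /sub_kermxP; rewrite mul1mx => ->; exact/eqP.
have freef : row_free f.
  have := mxrank_ker f; rewrite kerf mxrank0 => /esym/eqP.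
  by rewrite subn_eq0 /row_free eqn_leq rank_leq_row.
have fullf : row_full <<f>>%MS.
  apply: simN; last by rewrite -mxrank_eq0 genmxE mxrank_eq0.
  rewrite (eqmx_module _ (genmxE _)).
  apply/mxmoduleP=> x Gx; rewrite -homf //; exact: submxMl.
have eqd : qdim M = qdim N.
  by move: fullf; rewrite /row_full genmxE (eqP freef) => /eqP.
by exists f.
Qed.

(* The averaged matrices [\sum_x M x^-1 *m E *m N x] are homomorphisms; if they
   all vanish, then so does the scalar product of the characters. *)
Lemma simple_iso_cfdot M N :
  simple_mod M -> simple_mod N -> '[mod_char N, mod_char M] != 0 ->
  iso_mod M N.
Proof.
move=> simM simN.
pose f i j := \sum_(x in G) M x^-1%g *m delta_mx i j *m N x.
have homf i j y : y \in G -> M y *m f i j = f i j *m N y.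
  move=> Gy; rewrite mulmx_sumr mulmx_suml (reindex_inj (mulIg y)) /=.
  apply: eq_big => x; first by rewrite groupMr.
  rewrite groupMr // => Gx.
  by rewrite invMg !repr_mxM ?groupV // !mulmxA -repr_mxM ?groupV // mulgV repr_mx1 mul1mx.
case: (pickP (fun ij => f ij.1 ij.2 != 0)) => [ij nzf _|f0].
  exact: simple_hom_iso (homf ij.1 ij.2) nzf.
case/eqP; rewrite cfdotE; apply/eqP; rewrite mulf_eq0; apply/orP; right.
have -> : \sum_(x in G) mod_char N x * (mod_char M x)^* =
  ratr (\sum_(x in G) \tr (M x^-1%g) * \tr (N x)).
  rewrite rmorph_sum; apply: eq_bigr => x Gx.
  rewrite -char_inv ?mod_char_char // !mod_charE ?groupV // [RHS]rmorphM mulrC //.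
(* The (i, j) entry of X E_ij Y is X_ii Y_jj, so summing these entries gives tr X * tr Y. *)
have -> : \sum_(x in G) \tr (M x^-1%g) * \tr (N x) = \sum_i \sum_j f i j i j.
  rewrite /f.
  under [RHS]eq_bigr => i _ do under eq_bigr => j _ do rewrite summxE.
  under [RHS]eq_bigr => i _ do rewrite exchange_big.
  rewrite [RHS]exchange_big; apply: eq_bigr => x Gx.
  rewrite /mxtrace mulr_suml; apply: eq_bigr => i _.
  by rewrite mulr_sumr; apply: eq_bigr => j _; rewrite mul_delta_mxE.
rewrite big1 ?rmorph0 // => i _; rewrite big1 // => j _.
by move/negbFE/eqP: (f0 (i, j)) => /= ->; rewrite mxE.
Qed.

Lemma cfdot_simple_niso M N :
  simple_mod M -> simple_mod N -> ~ iso_mod M N ->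
  '[mod_char M, mod_char N] = 0.
Proof.
move=> simM simN nMN; apply/eqP; apply: contra_notT nMN => nz.
apply: mx_rsim_sym; exact: simple_iso_cfdot nz.
Qed.

Lemma simple_decomposition R :
  exists (I : finType) (N : I -> QGmodule G),
    (forall i, simple_mod (N i)) /\ mod_char R = \sum_i mod_char (N i).
Proof.
have redR : mx_completely_reducible R 1%:M.
  by apply: mx_Maschke_pchar; rewrite /pgroup pcharf'_nat pnatr_eq0 -lt0n.
(* [mx_reducible_semisimple] only serves boolean goals, so the goal is first turned into [false]. *)
apply: NNPP => nP; suff: false by [].
apply: (mx_reducible_semisimple (mxmodule1 R) redR) => ssR; case: nP.
case: ssR => I U W simU defW dxW.
pose modU i := mxsimple_module (simU i).
exists I, (fun i => MkQGmodule (submod_repr (modU i))); split=> [i|].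
  exact/submod_mx_irr.
apply/cfun_inP=> x Gx; rewrite sum_cfunE mod_charE //.
under [RHS]eq_bigr => i _ do rewrite mod_charE //=.
rewrite -rmorph_sum; congr ratr.
rewrite (mxtrace_dsum_mod modU (mxmodule1 R) defW dxW) //.
by rewrite (mxtrace_submod1 (mxmodule1 R)).
Qed.

(** Every irreducible character occurs in the regular character, which is afforded over the
    rationals, hence in one of the simple summands of the regular module. *)
Lemma simple_containing_irr i :
  exists2 M : QGmodule G, simple_mod M & '['chi_i, mod_char M] != 0.
Proof.
pose R : QGmodule G := MkQGmodule (regular_repr rat G).
have defR : mod_char R = cfReg G.
  rewrite -cfReprReg; apply/cfun_inP=> x Gx; rewrite !cfunE Gx.
  by rewrite map_regular_repr.
have [I [N [simN sumN]]] := simple_decomposition R.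
have [k nzk|N0] := pickP (fun k => '['chi_i, mod_char (N k)] != 0); first by exists (N k).
have: '['chi_i, cfReg G] != 0.
  rewrite cfdotC fmorph_eq0 cfReg_sum cfdot_suml (bigD1 i) //= big1 => [|j ne_ji].
    by rewrite cfdotZl cfnorm_irr mulr1 addr0 irr1_neq0.
  by rewrite cfdotZl cfdot_irr (negPf ne_ji) mulr0.
case/eqP; rewrite -defR sumN cfdot_sumr big1 // => k _.
by apply/eqP/negbFE/N0.
Qed.

(** The scalar product of two characters is a sum of products of nonnegative multiplicities, so
    orthogonal characters share no constituent. *)
Lemma cfdot_irr_char_eq0 (phi psi : 'CF(G)) i :
  phi \is a character -> psi \is a character -> '[phi, psi] = 0 ->
  '['chi_i, phi] != 0 -> '['chi_i, psi] = 0.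
Proof.
move=> Nphi Npsi o_phi_psi nz; apply/eqP; apply: contraR nz => nz.
have ge0 (xi : 'CF(G)) j : xi \is a character -> 0 <= '[xi, 'chi_j].
  by move=> Nxi; rewrite natr_ge0 // Cnat_cfdot_char_irr.
have sum0 : \sum_j '[phi, 'chi_j] * '[psi, 'chi_j]^* = 0.
  by rewrite -cfdot_sum_irr.
have pos j : true -> 0 <= '[phi, 'chi_j] * '[psi, 'chi_j]^*.
  by move=> _; rewrite mulr_ge0 ?conjC_ge0 ?ge0.
move/eqP: (psumr_eq0P pos sum0 (i := i) isT).
rewrite mulf_eq0 fmorph_eq0 => /orP[|] /eqP e0; first by rewrite cfdotC e0 rmorph0.
by move: nz; rewrite cfdotC e0 rmorph0 eqxx.
Qed.

(* The multiplicity of an irreducible character in a simple QG-module (its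
   Schur index) divides its multiplicity in any QG-module. *)
Lemma simple_mult_dvd M R i :
    simple_mod M -> '['chi_i, mod_char M] != 0 ->
  exists k : nat, '['chi_i, mod_char R] = k%:R * '['chi_i, mod_char M].
Proof.
move=> simM nzM; have [I [N [simN ->]]] := simple_decomposition R.
exists (\sum_(k | '['chi_i, mod_char (N k)] != 0%R) 1)%N.
rewrite cfdot_sumr (bigID (fun k => '['chi_i, mod_char (N k)] != 0)) /=.
rewrite [X in _ + X]big1 ?addr0 => [|k /negbNE/eqP //].
rewrite natr_sum mulr_suml; apply: eq_bigr => k nzk; rewrite mul1r.
have [iso|niso] := classic (iso_mod M (N k)); first by rewrite (iso_mod_char iso).
move/eqP: nzk; case; apply: cfdot_irr_char_eq0 nzM; rewrite ?mod_char_char //.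
exact: cfdot_simple_niso.
Qed.

Local Notation e i := (Wedderburn_id (@socle_of_Iirr gT G i)).

(* The sum of the central idempotents of [O] has rational coefficients, hence
   acts on M as a rational endomorphism, which is invertible by Schur's lemma;
   but it annihilates the constituents outside [O]. *)
Lemma simple_constt_sub M (O : {set Iirr G}) i j :
    simple_mod M -> (forall x, \sum_(k in O) 'chi_k 1%g * 'chi_k x \in Crat) ->
    i \in O -> '['chi_i, mod_char M] != 0 -> '['chi_j, mod_char M] != 0 ->
  j \in O.
Proof.
move=> simM ratO Oi Mi; apply: contraR => nOj.
pose a x := getCrat (#|G|%:R^-1 * \sum_(k in O) 'chi_k 1%g * 'chi_k x^-1%g).
have aE x : ratr (a x) = #|G|%:R^-1 * \sum_(k in O) 'chi_k 1%g * 'chi_k x^-1%g :> algC.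
  by rewrite getCratK // rpredM ?rpredV ?rpred_nat.
have aJ x y : y \in G -> a (x ^ y)%g = a x.
  move=> Gy; rewrite /a; congr (getCrat (_ * _)); apply: eq_bigr => k _.
  by rewrite -conjVg cfunJ.
pose E := \sum_(x in G) a x *: M x.
pose MC := map_repr (@ratr algC) M.
have mapE : map_mx ratr E = gring_op MC (\sum_(k in O) e k).
  rewrite /E map_mx_sum.
  under [in RHS]eq_bigr => k _ do rewrite Wedderburn_id_expansion.
  rewrite -scaler_sumr exchange_big linearZ /= linear_sum scaler_sumr.
  apply: eq_bigr => x Gx; rewrite map_mxZ [X in X *: _]aE -scaler_suml linearZ /=.
  by rewrite gring_opG // scalerA.
have cE : centgmx M E.
  apply/centgmxP => y Gy; rewrite mulmx_suml mulmx_sumr.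
  rewrite [RHS](reindex_inj (conjg_inj y)) /=.
  apply: eq_big => x; first by rewrite memJ_norm // (subsetP (normG G)).
  move=> Gx.
  by rewrite aJ // -scalemxAl -scalemxAr -!repr_mxM ?groupJ // conjgE !mulgA mulgV mul1g.
have coef k : (mod_char M).[e k]%CF = '[mod_char M, 'chi_k] * 'chi_k 1%g.
  rewrite {1}[mod_char M]cfun_sum_cfdot -xcfun_rE raddf_sum (bigD1 k) //= big1 => [|l ne_lk].
    by rewrite xcfunZl xcfun_id eqxx addr0.
  by rewrite xcfunZl xcfun_id (negPf ne_lk) mulr0.
(* The trace of [E] on M is a sum of nonnegative terms, multiplicity times degree, and the term at
   [i] is positive. *)
have nzE : E != 0.
  apply: contraNneq Mi => E0; apply/eqP.
  have: (mod_char M).[\sum_(k in O) e k]%CF = 0.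
    by rewrite xcfun_repr -mapE E0 map_mx0 mxtrace0.
  rewrite raddf_sum /= => sum0.
  have pos k : k \in O -> 0 <= (mod_char M).[e k]%CF.
    move=> _; rewrite coef mulr_ge0 //; last exact/ltW/irr1_gt0.
    by rewrite natr_ge0 // Cnat_cfdot_char_irr ?mod_char_char.
  move/eqP: (psumr_eq0P pos sum0 (i := i) Oi).
  rewrite coef mulf_eq0 (negPf (irr1_neq0 _)) orbF cfdotC fmorph_eq0.
  by move/eqP.
have uE := mx_Schur simM cE nzE.
have: gring_op MC (e j) *m map_mx ratr E = 0.
  rewrite mapE -gring_opM; last first.
    rewrite linear_sum summx_sub // => k _.
    by have := Wedderburn_id_mem (socle_of_Iirr k); rewrite genmxE mem_sub_gring => /andP[].
  rewrite mulmx_sumr linear_sum big1 // => k Ok.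
  have ne_jk : socle_of_Iirr j != socle_of_Iirr k.
    by rewrite (can_eq socle_of_IirrK); apply: contraNneq nOj => ->.
  by rewrite (Wedderburn_mulmx0 ne_jk) ?Wedderburn_id_mem ?linear0.
move/(canRL (mulmxK _)); rewrite map_unitmx uE mul0mx => /(_ isT) ej0.
have := coef j; rewrite xcfun_repr ej0 mxtrace0 => /esym/eqP.
by rewrite mulf_eq0 (negPf (irr1_neq0 _)) orbF cfdotC fmorph_eq0.
Qed.

Lemma simple_mult1 M R1 R2 i :
    simple_mod M -> '['chi_i, mod_char M] != 0 ->
    '['chi_i, mod_char R1] = '['chi_i, mod_char R2] + 1 ->
  '['chi_i, mod_char M] = 1.
Proof.
move=> simM nzM.
have [k1 ->] := simple_mult_dvd R1 simM nzM.
have [k2 ->] := simple_mult_dvd R2 simM nzM.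
have /natrP[m ->] : '['chi_i, mod_char M] \in Num.nat.
  by rewrite Cnat_cfdot_char ?irr_char ?mod_char_char.
rewrite -!natrM natr1 => /eqP; rewrite eqr_nat => /eqP def_k1m.
have /eqP-> // : m == 1%N.
by rewrite -dvdn1 -(dvdn_addr 1 (dvdn_mull k2 (dvdnn m))) addn1 -def_k1m dvdn_mull.
Qed.

(** The common degree [c] turns the rationality of the plain sum over [L] into that of the
    degree-weighted sum required by [simple_constt_sub], which then excludes constituents outside
    [L]. *)
Lemma simple_char_sum M (L : seq 'CF(G)) phi c :
    simple_mod M -> uniq L -> {subset L <= irr G} -> phi \in L ->
    {in L, forall psi : 'CF(G), psi 1%g = c} ->
    (forall x, \sum_(psi <- L) psi x \in Crat) ->
    {in L, forall psi, '[psi, mod_char M] = 1} ->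
  mod_char M = \sum_(psi <- L) psi.
Proof.
move=> simM uniqL irrL Lphi degL ratL multL.
pose O := [set k | 'chi[G]_k \in L].
have /irrP[i def_phi] := irrL _ Lphi; rewrite {phi}def_phi in Lphi.
have Mi : '['chi_i, mod_char M] != 0 by rewrite multL ?oner_neq0.
have bigL (V : nmodType) (F : 'CF(G) -> V) :
    \sum_(psi <- L) F psi = \sum_(k in O) F 'chi_k.
  by rewrite big_irr_seq //; apply: eq_bigl => k; rewrite inE.
have subO j : '['chi_j, mod_char M] != 0 -> j \in O.
  have Oi : i \in O by rewrite inE.
  apply: (simple_constt_sub simM _ Oi Mi) => x.
  under eq_bigr => k; first (rewrite inE => Lk; rewrite degL //; over).
  rewrite -mulr_sumr -(bigL _ (fun psi => psi x)) rpredM // -(degL 'chi_i) //.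
  by have /natrP[m ->] := Cnat_irr1 i; rewrite rpred_nat.
rewrite [LHS]cfun_sum_cfdot (bigL _ id) [RHS]big_mkcond; apply: eq_bigr => j _.
case: ifP => [|/negP nOj]; rewrite cfdotC.
  by rewrite inE => Lj; rewrite multL // rmorph1 scale1r.
have/eqP-> : '['chi_j, mod_char M] == 0 by apply/idPn; move/subO.
by rewrite rmorph0 scale0r.
Qed.

Lemma simple_dim1 M : qdim M = 1%N -> simple_mod M.
Proof.
case: M => d r /= d1; move: r; rewrite d1 => r; apply/mx_irrP; split=> // V _ nzV.
by rewrite /row_full eqn_leq rank_leq_col lt0n mxrank_eq0.
Qed.

Lemma trivial_mod_char M : trivial_mod M -> qdim M = 1%N -> mod_char M = 1.
Proof.
move=> trM dM; apply/cfun_inP=> x Gx.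
by rewrite mod_charE // trM // mxtrace1 dM rmorph1 cfun1E Gx.
Qed.

Lemma trivial_module_repr : mx_repr G (fun _ : gT => 1%:M : 'M[rat]_1).
Proof. by split=> // x y _ _; rewrite mulmx1. Qed.

Definition trivial_module : QGmodule G :=
  MkQGmodule (MxRepresentation trivial_module_repr).

Lemma simple_common_constt M N i :
    simple_mod M -> simple_mod N -> '['chi_i, mod_char M] != 0 ->
    '['chi_i, mod_char N] != 0 ->
  iso_mod M N.
Proof.
move=> simM simN Mi Ni; apply: NNPP => nMN; move/eqP: Ni; case.
apply: cfdot_irr_char_eq0 Mi; rewrite ?mod_char_char //.
exact: cfdot_simple_niso.
Qed.

(** * Permutation modules on right cosets *)

Section PermutationModule.
Variable K : {group gT}.
Hypothesis sKG : K \subset G.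

Definition coset_mx (x : gT) : 'M[rat]_#|rcosets K G| :=
  \matrix_(i, j) (enum_val i :* x == enum_val j)%:R.

Lemma coset_mx_repr : mx_repr G coset_mx.
Proof.
split=> [|x y Gx Gy].
  by apply/matrixP=> i j; rewrite !mxE rcoset1 (inj_eq enum_val_inj).
apply/matrixP=> i j; rewrite !mxE.
have Cix : enum_val i :* x \in rcosets K G.
  have /rcosetsP[z Gz ->] := enum_valP i.
  by rewrite -rcosetM -rcosetE imset_f ?groupM.
rewrite (bigD1 (enum_rank_in Cix (enum_val i :* x))) //= big1 => [|k ne_k].
  by rewrite !mxE enum_rankK_in // eqxx mul1r addr0 rcosetM.
rewrite mxE; case: eqP => [def_k|]; last by rewrite mul0r.
by case/eqP: ne_k; apply: enum_val_inj; rewrite enum_rankK_in.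
Qed.

Definition coset_mod : QGmodule G := MkQGmodule (MxRepresentation coset_mx_repr).

Lemma coset_mod_char : mod_char coset_mod = 'Ind[G, K] 1.
Proof.
apply/cfun_inP=> x Gx; rewrite mod_charE // cfIndE //.
have -> : \tr (coset_mod x) = \sum_(C in rcosets K G) (C :* x == C)%:R.
  by rewrite big_enum_val; apply: eq_bigr => i _; rewrite mxE.
apply: canRL (mulKf (neq0CG _)) _; rewrite raddf_sum /= mulr_sumr.
(* After y -> y^-1 the term at y tests whether x fixes the coset K y, so the sum can be taken coset
   by coset, each contributing #|K| equal terms. *)
rewrite [RHS](reindex_inj invg_inj) /=.
rewrite [RHS](partition_big (fun y => K :* y) (mem (rcosets K G))) /=; last first.
  by move=> y; rewrite groupV -rcosetE => Gy; apply: imset_f.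
apply: eq_bigr => _ /rcosetsP[z Gz ->]; rewrite rmorph_nat.
transitivity (\sum_(y in K :* z) (K :* z :* x == K :* z)%:R : algC).
  by rewrite sumr_const card_rcoset mulr_natl.
apply: eq_big => y.
  rewrite groupV; apply/idP/andP=> [Kzy|[Gy /eqP <-]]; last exact: rcoset_refl.
  rewrite (rcoset_eqP Kzy) eqxx; split=> //.
  by case/rcosetP: Kzy => k Kk ->; rewrite groupM // (subsetP sKG).
move=> /rcoset_eqP <-; rewrite cfun1E conjgE invgK -rcosetM; congr (nat_of_bool _)%:R.
by rewrite (sameP eqP rcoset_eqP) mem_rcoset mulgA.
Qed.

End PermutationModule.

End RationalModules.

(** * Sums over cyclic groups *)

Section CyclicCharacters.
Variables (gT : finGroupType) (A : {group gT}).
Hypothesis cycA : cyclic A.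

(** A generator is sent to a primitive root of unity of order #|A|, which makes the character
    faithful and its powers distinct modulo #|A|. *)
Lemma cyclic_lin_char :
  exists2 alpha : 'CF(A), alpha \is a linear_char
    & forall j k, (alpha ^+ j == alpha ^+ k) = (j == k %[mod #|A|]).
Proof.
have [a defA] := cyclicP cycA; have nA : #|A| = #[a] by rewrite defA.
have [z primz] := C_prim_root_exists (cardG_gt0 A).
(* A discrete logarithm to base [a]; the default 0 is never reached on [A]. *)
pose lg x := odflt 0%N (omap val [pick i : 'I_#|A| | a ^+ i == x]%g).
have lgK x : x \in A -> (a ^+ lg x)%g = x.
  rewrite /lg; case: pickP => [i /eqP //|no] Ax.
  have: x \in <[a]>%g by rewrite -defA.
  case/cyclePmin=> i lt_i def_x; rewrite -nA in lt_i.
  by have /= := no (Ordinal lt_i); rewrite def_x eqxx.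
have zlg x k : x \in A -> (x == a ^+ k)%g -> z ^+ lg x = z ^+ k.
  move=> Ax /eqP def_x; apply/eqP; rewrite (eq_prim_root_expr primz) nA.
  by rewrite -eq_expg_mod_order lgK // def_x.
pose r x : 'M[algC]_1 := (z ^+ lg x)%:M.
have r_repr : mx_repr A r.
  split=> [|x y Ax Ay]; first by rewrite /r (zlg _ 0%N) ?group1.
  rewrite /r -scalar_mxM -exprD; congr _%:M; apply: zlg; first exact: groupM.
  by rewrite expgD !lgK.
pose alpha := cfRepr (MxRepresentation r_repr).
have alphaE x : x \in A -> alpha x = z ^+ lg x.
  by move=> Ax; rewrite cfunE Ax mxtrace_scalar.
exists alpha.
  by rewrite qualifE /= cfRepr_char cfRepr1 eqxx.
move=> j k; rewrite -(eq_prim_root_expr primz).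
have Aa : a \in A by rewrite defA cycle_id.
apply/eqP/eqP => [/cfunP/(_ a)|eq_z].
  by rewrite !exp_cfunE // alphaE // (zlg _ 1%N) ?expg1 // expr1.
apply/cfun_inP=> x Ax; rewrite !exp_cfunE // alphaE // -!exprM mulnC [(_ * k)%N]mulnC.
by rewrite !exprM eq_z.
Qed.

End CyclicCharacters.

(** * Indices of characters of a given order, and sums over them *)

Lemma dvdn_div_inj n d e :
  (0 < n)%N -> (d %| n)%N -> (e %| n)%N -> (n %/ d = n %/ e)%N -> d = e.
Proof.
move=> n_gt0 dvd_d dvd_e eq_div; have d_gt0 := dvdn_gt0 n_gt0 dvd_d.
have div_gt0 : (0 < n %/ d)%N by rewrite divn_gt0 // dvdn_leq.
by apply/eqP; rewrite -(eqn_pmul2l div_gt0) divnK // eq_div divnK.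
Qed.

(** Here [d] is the order of the j-th power of a faithful character of a cyclic group of order n;
    the strict bounds on 2 j exclude the orders 1 and 2. *)
Lemma half_index_order n j (d := (n %/ gcdn j n)%N) : (0 < 2 * j < n)%N ->
  [/\ (2 < d)%N, (d %| n)%N & gcdn j n = (n %/ d)%N].
Proof.
case/andP=> j_gt0 lt_jn; have n_gt0 : (0 < n)%N by apply: leq_ltn_trans lt_jn.
have g_gt0 : (0 < gcdn j n)%N by rewrite gcdn_gt0 n_gt0 orbT.
have def_n : (d * gcdn j n)%N = n by rewrite divnK // dvdn_gcdr.
have le_gj : (gcdn j n <= j)%N by rewrite dvdn_leq ?dvdn_gcdl //; lia.
have d_gt2 : (2 < d)%N by move: def_n le_gj lt_jn; clear; nia.
split=> //; first by rewrite -def_n dvdn_mulr.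
by rewrite -{2}def_n mulKn // (ltn_trans _ d_gt2).
Qed.

Lemma sum_expr_unity_root (d : nat) (z : algC) :
  z ^+ d = 1 -> \sum_(0 <= k < d) z ^+ k \in Crat.
Proof.
move=> zd; have [->|nz1] := eqVneq z 1.
  by rewrite (eq_bigr (fun=> 1)) => [|k _]; rewrite ?expr1n // rpred_sum.
rewrite big_mkord; have := subrX1 z d; rewrite zd subrr => /esym/eqP.
by rewrite mulf_eq0 subr_eq0 (negPf nz1) => /eqP->; rewrite rpred0.
Qed.

(** The substitution j = k g: the characters alpha ^ j of order d are the powers of alpha ^ g with
    exponent prime to d. *)
Lemma sum_gcdn_eq (V : nmodType) d g (F : nat -> V) : (0 < g)%N ->
  \sum_(0 <= j < d * g | gcdn j (d * g) == g) F j
    = \sum_(0 <= k < d | coprime k d) F (k * g)%N.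
Proof.
move=> g_gt0.
have h_proof (j : 'I_d) : (j * g < d * g)%N by rewrite ltn_mul2r g_gt0 /=.
have h'_proof (k : 'I_(d * g)) : (k %/ g < d)%N by rewrite ltn_divLR.
rewrite !big_mkord.
rewrite (reindex_onto (fun j => Ordinal (h_proof j)) (fun k => Ordinal (h'_proof k))) /=.
  apply: eq_bigl => j; rewrite -val_eqE /= mulnK // eqxx andbT.
  by rewrite -muln_gcdl -{2}[g]mul1n eqn_pmul2r.
move=> k /eqP def_g; apply: val_inj => /=; apply: divnK.
by rewrite -{1}def_g dvdn_gcdl.
Qed.

(** The reflection j -> n - j pairs the indices; its fixed points 0 and n / 2 are excluded by [P],
    so the lower half carries exactly half of the sum. *)
Lemma sum_half_indices (V : nmodType) n (P : pred nat) (F : nat -> V) :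
    ~~ P 0%N -> (forall j, (0 < j < n)%N -> P (n - j)%N = P j /\ F (n - j)%N = F j) ->
    (forall j, (2 * j = n)%N -> ~~ P j) ->
  \sum_(0 <= j < n | P j) F j = (\sum_(j <- iota 1 n.-1./2 | P j) F j) *+ 2.
Proof.
move=> nP0 symPF nPhalf; case: n symPF nPhalf => [|n] symPF nPhalf.
  by rewrite big_geq //= mul0rn.
(* Away from 0, negation in ['I_n.+1] is the reflection j -> n.+1 - j. *)
have symF (j : 'I_n.+1) : j != 0 -> (P (- j)%R = P j) * (F (- j)%R = F j)
    * ((- j)%R = (n.+1 - j)%N :> nat).
  rewrite -val_eqE /= -lt0n => j_gt0.
  have lt_oj : (n.+1 - j < n.+1)%N by lia.
  have [|Pj Fj] := symPF j; first by rewrite j_gt0 ltn_ord.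
  by rewrite modn_small // Pj Fj.
have -> : \sum_(j <- iota 1 n./2 | P j) F j = \sum_(j < n.+1 | P j && (2 * j < n.+1)%N) F j.
  rewrite -(big_mkord (fun j => P j && (2 * j < n.+1)%N)) big_ltn_cond // (negPf nP0) /=.
  have -> : index_iota 1 n.+1 = iota 1 n./2 ++ iota (1 + n./2) (n - n./2).
    by rewrite -iotaD subnKC /index_iota ?subSS ?subn0 // -divn2 leq_div.
  rewrite big_cat /= [Y in _ = _ + Y]big_seq_cond [Y in _ + Y]big_pred0 ?addr0 => [|j].
    rewrite big_seq_cond [RHS]big_seq_cond; apply: eq_bigl => j; rewrite mem_iota.
    by case: (P j); rewrite ?andbF //=; lia.
  by rewrite mem_iota; case: (P j); rewrite ?andbF //=; lia.
rewrite big_mkord (bigID (fun j : 'I__ => (2 * j < n.+1)%N)) /= mulr2n; congr (_ + _).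
rewrite (reindex_inj (@oppr_inj _)); apply: eq_big => j.
  have [->|nz_j] := eqVneq j 0; first by rewrite oppr0 (negPf nP0).
  rewrite !symF //; case Pj: (P j) => //=.
  have /= := nPhalf j; rewrite Pj => neq; have := ltn_ord j.
  have : (2 * j)%N <> n.+1 by move/neq.
  lia.
by move=> _; have [->|nz_j] := eqVneq j 0; [rewrite oppr0 | rewrite symF].
Qed.

(** Sort the full geometric sum by gcd: the part with gcd g > 1 is the same kind of sum for d / g
    and z ^ g, which is rational by induction. Thus [z] need not be primitive, as is required when z
    is the value of a character at an arbitrary element. *)
Lemma sum_expr_coprime_Crat d (z : algC) :
  z ^+ d = 1 -> \sum_(0 <= k < d | coprime k d) z ^+ k \in Crat.
Proof.
have [n] := ubnP d; elim: n d z => // n IHn d z lt_dn zd.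
have [->|d_gt0] := posnP d; first by rewrite big_geq ?rpred0.
have gcdP k : gcdn k d \in divisors d by rewrite -dvdn_divisors ?dvdn_gcdr.
have: \sum_(0 <= k < d) z ^+ k =
      \sum_(g <- divisors d) \sum_(0 <= k < d | gcdn k d == g) z ^+ k.
  rewrite (exchange_big_dep xpredT) //=; apply: eq_bigr => k _.
  rewrite (big_rem (gcdn k d)) ?gcdP //= eqxx big1_seq ?addr0 // => g /andP[/eqP <-].
  by rewrite mem_rem_uniqF ?divisors_uniq.
rewrite [in RHS](big_rem 1%N) /=; last by rewrite -dvdn_divisors ?dvd1n.
rewrite addrC => /(canLR (addKr _)) <-; rewrite rpredD ?rpredN ?sum_expr_unity_root //.
rewrite big_seq rpred_sum // => g; rewrite mem_rem_uniq ?divisors_uniq // !inE.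
case/andP=> ne_g1; rewrite -dvdn_divisors // => /dvdnP[e def_d].
have g_gt0 : (0 < g)%N by lia.
rewrite {1 2}def_d sum_gcdn_eq //.
under eq_bigr => k _ do rewrite mulnC exprM.
apply: IHn; last by rewrite -exprM mulnC -def_d.
by nia.
Qed.

(** * Characters of groups with a PSL_2(q) configuration of subgroups *)

Section TISubgroup.
Variables (gT : finGroupType) (G H L : {group gT}).
Hypotheses (sLG : L \subset G) (nsHL : H <| L).
Hypothesis tiH : forall h g, h \in H^# -> g \in G -> (h ^ g)%g \in H -> g \in L.

(** A double count of the pairs (x, g) with x ^ g^-1 in H^#: for x = h ^ y, the TI hypothesis makes
    the possible g the coset L y. *)
Lemma sum_class_support_TI (f : gT -> algC) :
    (forall x g, x \in G -> g \in G -> f (x ^ g)%g = f x) ->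
  #|L|%:R * (\sum_(x in class_support H^# G) f x)
    = #|G|%:R * \sum_(h in H^#) f h.
Proof.
move=> fJ; have sHG : H \subset G := subset_trans (normal_sub nsHL) sLG.
set S := class_support _ _.
have -> : #|G|%:R * (\sum_(h in H^#) f h) =
          \sum_(g in G) \sum_(x in S | (x ^ g^-1)%g \in H^#) f x.
  rewrite mulr_natl -sumr_const; apply: eq_bigr => g Gg.
  rewrite [RHS](reindex_inj (conjg_inj g)) /=; apply: eq_big => h.
    rewrite conjgK andb_idl // => Hh.
    exact: memJ_class_support.
  by case/setD1P=> _ Hh; rewrite fJ // (subsetP sHG).
rewrite [RHS](exchange_big_dep (mem S)) /=; last by move=> g x _ /andP[].
rewrite mulr_sumr; apply: eq_bigr => x Sx.
under eq_bigl => g do rewrite Sx /=.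
rewrite sumr_const mulr_natl; congr (_ *+ _).
case/imset2P: Sx => h g Hh Gg ->{x}.
have [nt_h Hh'] := setD1P Hh.
rewrite -(card_rcoset L g); apply: eq_card => y.
rewrite mem_rcoset [RHS]/in_mem /= -conjgM !inE; apply/idP/andP=> [Lyg|[Gy]].
  have Gy : y \in G by rewrite -(groupMr y (groupVr Gg)) (subsetP sLG).
  split=> //; rewrite conjg_eq1 nt_h /= memJ_norm // (subsetP (normal_norm nsHL)) //.
  by rewrite -groupV invMg invgK.
rewrite conjg_eq1 nt_h /= => /(tiH Hh); rewrite groupM ?groupV // => /(_ isT).
by rewrite -groupV invMg invgK.
Qed.

End TISubgroup.

(** The last clause encodes that N acts on A by inversion: for w outside A and a in A, both w and w
    a square to 1. *)
Definition TI_torus (gT : finGroupType) (G A N : {group gT}) : Prop :=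
  [/\ cyclic A, A \subset N /\ N \subset G, #|N| = (2 * #|A|)%N,
      forall a g, a \in A^# -> g \in G -> (a ^ g)%g \in A -> g \in N
    & forall w, w \in N -> w \notin A -> (w * w)%g = 1%g].

Lemma cfdot_lin_char (gT : finGroupType) (H : {group gT}) (phi psi : 'CF(H)) :
  phi \is a linear_char -> psi \is a linear_char -> '[phi, psi] = (phi == psi)%:R.
Proof.
move=> /lin_char_irr/irrP[i ->] /lin_char_irr/irrP[j ->].
by rewrite cfdot_irr (inj_eq irr_inj).
Qed.

Section SumSquares.
Variables (gT : finGroupType) (G : {group gT}) (s : seq 'CF(G)).
Hypotheses (uniq_s : uniq s) (sirr : {subset s <= irr G}).

Let sum_squareE : #|G|%:R = \sum_(phi <- s) phi 1%g ^+ 2 +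
  \sum_(i | 'chi[G]_i \notin s) 'chi_i 1%g ^+ 2.
Proof.
rewrite -irr_sum_square (bigID (fun i => 'chi_i \in s)) /=; congr (_ + _).
by rewrite -(big_irr_seq (fun phi => phi 1%g ^+ 2)).
Qed.

Lemma sum_square_le : \sum_(phi <- s) phi 1%g ^+ 2 <= #|G|%:R.
Proof.
by rewrite sum_squareE lerDl sumr_ge0 // => i _; rewrite exprn_ge0 ?ltW ?irr1_gt0.
Qed.

Lemma sum_square_eq i : #|G|%:R <= \sum_(phi <- s) phi 1%g ^+ 2 -> 'chi_i \in s.
Proof.
rewrite sum_squareE -lerBrDl subrr => le0; apply: contraT => nsi.
have pos k : 0 <= 'chi[G]_k 1%g ^+ 2 by rewrite exprn_ge0 ?ltW ?irr1_gt0.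
move: le0; rewrite (bigD1 i) //= real_leNgt ?rpred0 ?ger0_real ?addr_ge0 ?sumr_ge0 //.
by rewrite ltr_wpDr ?sumr_ge0 // exprn_gt0 ?irr1_gt0.
Qed.

End SumSquares.

Lemma sum_lin_char (gT : finGroupType) (H : {group gT}) (phi : 'CF(H)) :
  phi \is a linear_char -> phi != 1 -> \sum_(a in H^#) phi a = -1.
Proof.
move=> lin_phi nt_phi; have := cfdot_lin_char lin_phi (cfun1_lin_char _).
rewrite (negPf nt_phi) cfdotE => /eqP; rewrite mulf_eq0 invr_eq0 (negPf (neq0CG _)) /=.
rewrite (big_setD1 1%g) //= lin_char1 // cfun11 conjC1 mulr1 addr_eq0 => /eqP def1.
apply: oppr_inj; rewrite opprK [RHS]def1; congr (- _); apply: eq_bigr => a /setD1P[_ Aa].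
by rewrite cfun1E Aa conjC1 mulr1.
Qed.

Lemma mem_half_indices n j :
  (0 < n)%N -> (j \in iota 1 n.-1./2) = (0 < 2 * j < n)%N.
Proof. by rewrite mem_iota; lia. Qed.

Lemma half_indices_mod n j k :
    (0 < 2 * j < n)%N -> (0 < 2 * k < n)%N ->
  (j == k %[mod n] = (j == k)) * ((n %| j + k)%N = false).
Proof. by move=> lej lek; rewrite !modn_small ?gtnNdvd //; lia. Qed.

Lemma odd_square_mod4 r : odd (r ^ 2) -> (r ^ 2 %% 4 = 1)%N.
Proof.
rewrite oddX /= => odd_r; rewrite -(odd_double_half r) odd_r -mulnn.
have -> : ((true + r./2.*2) * (true + r./2.*2) = (r./2 * r./2 + r./2) * 4 + 1)%N by lia.
by rewrite modnMDl.
Qed.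

(** * The subgroup configuration and the partition of the group *)

Section AbstractPSL2.
(* [A true] is the split and [A false] the nonsplit torus; [N b] is the
   normalizer of [A b]. *)
Variables (gT : finGroupType) (G U B : {group gT}) (A N : bool -> {group gT}).
Variable q : nat.
Hypotheses (q_odd : odd q) (q_gt2 : (2 < q)%N).
Hypothesis cardG : (2 * #|G| = q.-1 * q * q.+1)%N.
Hypotheses (cardU : #|U| = q) (cardB : (2 * #|B| = q * q.-1)%N).
Hypotheses (sBG : B \subset G) (nsUB : U <| B) (abelU : abelian U).
Hypothesis tiU :
  forall u g, u \in U^# -> g \in G -> (u ^ g)%g \in U -> g \in B.
Hypothesis centU :
  forall u g, u \in U^# -> g \in G -> commute u g -> g \in U.
Hypothesis invU :
  (q %% 4 = 1)%N -> forall u, u \in U^# -> u^-1%g \in (u ^: G)%g.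
Hypothesis torA : forall b, TI_torus G (A b) (N b).
Hypothesis cardA : forall b, (2 * #|A b| = if b then q.-1 else q.+1)%N.
Hypothesis splitA : exists x y, [/\ x \in G, y \in G, A true \subset B :^ x,
  A true \subset B :^ y & (B :^ x != B :^ y)%g].

Let sAN b : A b \subset N b. Proof. by case: (torA b) => _ []. Qed.
Let sNG b : N b \subset G. Proof. by case: (torA b) => _ []. Qed.
Let sAG b : A b \subset G. Proof. exact: subset_trans (sNG b). Qed.
Let sUB : U \subset B. Proof. exact: normal_sub. Qed.
Let sUG : U \subset G. Proof. exact: subset_trans sBG. Qed.
Let cardN b : #|N b| = (2 * #|A b|)%N. Proof. by case: (torA b). Qed.
Let tiA b a g : a \in (A b)^# -> g \in G -> (a ^ g)%g \in A b -> g \in N b.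
Proof. by case: (torA b) => _ _ _ tiA _; apply: tiA. Qed.
Let nsAN b : A b <| N b.
Proof. by apply: index2_normal => //; rewrite -divgS // cardN mulnK. Qed.

Let coprimeUA b : coprime #|U| #|A b|.
Proof.
rewrite cardU; move: #|_| (cardA b) => n; case: b => /= cA.
  by apply/coprimeP; [lia | exists (1%N, 2%N) => /=; lia].
rewrite coprime_sym; apply/coprimeP; [lia | exists (2%N, 1%N) => /=; lia].
Qed.

Let coprimeAA b : coprime #|A b| #|A (~~ b)|.
Proof.
wlog: b / ~~ b => [IH|].
  case: b => //; last exact: IH.
  by rewrite coprime_sym; apply: (IH false).
case: b => // _; rewrite /= coprime_sym.
have -> : #|A false| = #|A true|.+1 by have := cardA true; have := cardA false; lia.
exact: coprimenS.
Qed.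

Let Q : algC := q%:R.
Let eps (b : bool) : algC := if b then 1 else -1.

Let Qm1 : Q - 1 = q.-1%:R.
Proof. by rewrite /Q -{1}(ltn_predK q_gt2) -natr1 addrK. Qed.
Let q_gt0 : (0 < q)%N. Proof. exact: ltn_trans q_gt2. Qed.
Let q1_gt0 : (0 < q.-1)%N. Proof. by rewrite -subn1 subn_gt0 ltnW. Qed.
Let nzQ : Q != 0. Proof. by rewrite pnatr_eq0 -lt0n. Qed.
Let nzQm1 : Q - 1 != 0. Proof. by rewrite Qm1 pnatr_eq0 -lt0n. Qed.
Let nzQp1 : Q + 1 != 0. Proof. by rewrite natr1 pnatr_eq0. Qed.

Let half (m k : nat) : (2 * m = k)%N -> m%:R = k%:R / 2 :> algC.
Proof. by move=> <-; rewrite natrM mulrC mulKf ?pnatr_eq0. Qed.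

Let GE : #|G|%:R = (Q - 1) * Q * (Q + 1) / 2 :> algC.
Proof. by rewrite (half cardG) !natrM Qm1 natr1. Qed.
Let BE : #|B|%:R = Q * (Q - 1) / 2 :> algC.
Proof. by rewrite (half cardB) !natrM Qm1. Qed.
Let AE b : #|A b|%:R = (Q - eps b) / 2 :> algC.
Proof.
by rewrite (half (cardA b)); case: b; rewrite /= ?Qm1 // opprK natr1.
Qed.
Let NE b : #|N b|%:R = Q - eps b :> algC.
Proof. by rewrite cardN natrM AE mulrC divfK ?pnatr_eq0. Qed.
Let nzQe b : Q - eps b != 0.
Proof. by case: b; rewrite /= ?opprK. Qed.

Let S (H : {group gT}) := class_support H^# G.

Let coprime_class_support (H K : {group gT}) :
  coprime #|H| #|K| -> S H :&: S K = set0.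
Proof.
move=> coHK; apply/setP=> x; rewrite !inE; apply/negbTE/andP=> [[]].
case/imset2P=> h g /setD1P[nt_h Hh] _ -> /imset2P[k y /setD1P[_ Kk] _ def_hg].
case/negP: nt_h; rewrite -order_eq1 -dvdn1 -(eqP coHK) dvdn_gcd order_dvdG //=.
by rewrite -(orderJ h g) def_hg orderJ order_dvdG.
Qed.

Let notS1 (H : {group gT}) : 1%g \notin S H.
Proof.
apply/imset2P=> [[h g /setD1P[nt_h _] _ /esym/eqP]].
by rewrite conjg_eq1 (negPf nt_h).
Qed.

Let S1 (H : {group gT}) : [set 1%g] :&: S H = set0.
Proof. by apply/eqP; rewrite setI_eq0 disjoints1 notS1. Qed.

Let SG := [set 1%g] :|: S U :|: S (A true) :|: S (A false).

Let sum_SG (F : gT -> algC) :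
    (forall x g, x \in G -> g \in G -> F (x ^ g)%g = F x) ->
  \sum_(x in SG) F x = F 1%g + #|G|%:R / #|B|%:R * (\sum_(x in U^#) F x)
     + (\sum_b #|G|%:R / #|N b|%:R * \sum_(x in (A b)^#) F x).
Proof.
have sum_S : \sum_(x in SG) F x =
   F 1%g + (\sum_(x in S U) F x) + \sum_(x in S (A true)) F x + \sum_(x in S (A false)) F x.
  have SUT := coprime_class_support (coprimeUA true).
  have SUF := coprime_class_support (coprimeUA false).
  have STF := coprime_class_support (coprimeAA true).
  have sumU (X Y : {set gT}) : X :&: Y = set0 ->
    \sum_(x in X :|: Y) F x = \sum_(x in X) F x + \sum_(x in Y) F x.
    move/eqP; rewrite setI_eq0 => dXY; rewrite -bigU //.
    by apply: eq_bigl => x; rewrite !inE.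
  rewrite !sumU ?big_set1 // !setIUl ?SUT ?SUF ?STF !S1 ?set0U //.
move=> FJ; rewrite sum_S big_bool /= addrA.
have E (H L : {group gT}) : L \subset G -> H <| L ->
   (forall h g, h \in H^# -> g \in G -> (h ^ g)%g \in H -> g \in L) ->
   \sum_(x in S H) F x = #|G|%:R / #|L|%:R * \sum_(x in H^#) F x.
  move=> sLG nsHL tiH; rewrite mulrAC.
  by rewrite -(sum_class_support_TI sLG nsHL tiH FJ) mulrC mulKf ?neq0CG.
by rewrite (E U B) // (E _ (N true)) ?(E _ (N false)) //; apply: tiA.
Qed.

(** Only the cardinality of [SG] has to be compared with that of G, and it is [sum_SG] applied to
    the constant function 1. *)
Lemma group_partition : SG = G.
Proof.
have sSG : SG \subset G.
  have sSG (H : {group gT}) : H \subset G -> S H \subset G.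
    by move=> sHG; rewrite class_support_subG // (subset_trans (subD1set _ _)).
  by rewrite !subUset sub1set group1 !sSG.
apply/eqP; rewrite eqEcard sSG -leC_nat /=.
have -> : #|SG|%:R = \sum_(x in SG) 1 :> algC by rewrite sumr_const.
rewrite sum_SG // big_bool /= !sumr_const.
have D1 (H : {group gT}) : #|H^#|%:R = #|H|%:R - 1 :> algC.
  by rewrite [#|H|](cardsD1 1%g) group1 natrD addrC addKr.
rewrite !D1 cardU !AE !NE GE BE /= -/Q.
rewrite le_eqVlt; apply/orP; left; apply/eqP.
field.
by rewrite nzQ nzQm1 nzQp1.
Qed.

Lemma sum_group (f : gT -> algC) :
    (forall x g, x \in G -> g \in G -> f (x ^ g)%g = f x) ->
  \sum_(x in G) f x = f 1%g + #|G|%:R / #|B|%:R * (\sum_(x in U^#) f x)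
     + (\sum_b #|G|%:R / #|N b|%:R * \sum_(x in (A b)^#) f x).
Proof. by move=> fJ; rewrite -sum_SG // group_partition. Qed.

Lemma cfdot_group (phi psi : 'CF(G)) :
  '[phi, psi] = #|G|%:R^-1 * (phi 1%g * (psi 1%g)^*)
    + #|B|%:R^-1 * (\sum_(u in U^#) phi u * (psi u)^*)
    + \sum_b #|N b|%:R^-1 * \sum_(a in (A b)^#) phi a * (psi a)^*.
Proof.
rewrite cfdotE sum_group => [|x g Gx Gg]; last by rewrite !cfunJ.
rewrite !big_bool /=; field.
by rewrite !neq0CG.
Qed.

Lemma cfInd_coprime (H K : {group gT}) (phi : 'CF(H)) x :
  H \subset G -> coprime #|H| #|K| -> x \in K^# -> 'Ind[G] phi x = 0.
Proof.
move=> sHG coHK /setD1P[nt_x Kx]; rewrite cfIndE // big1 ?mulr0 // => g _.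
apply: cfun0; apply: contra nt_x => Hxg.
rewrite -order_eq1 -dvdn1 -(eqP coHK) dvdn_gcd.
by rewrite [(_ %| #|K|)%N]order_dvdG // -(orderJ x g) order_dvdG.
Qed.

(** * The permutation character on the q + 1 points of the projective line, and the Steinberg
    character *)

Definition PG : 'CF(G) := 'Ind[G, B] 1.

Let cardBA : #|B| = (#|U| * #|A true|)%N.
Proof.
by apply/eqP; rewrite -(eqn_pmul2l (isT : 0 < 2)%N) mulnCA cardA cardB cardU.
Qed.

Let coprimeBA : coprime #|B| #|A false|.
Proof. by rewrite cardBA coprimeMl coprimeUA (coprimeAA true). Qed.

Let cardD1 (H : {group gT}) : #|H^#|%:R = #|H|%:R - 1 :> algC.
Proof. by rewrite [#|H|](cardsD1 1%g) group1 natrD addrC addKr. Qed.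

Let divGB : #|G|%:R / #|B|%:R = Q + 1.
Proof. by rewrite GE BE; field; rewrite nzQ nzQm1. Qed.

Lemma PG_1 : PG 1%g = Q + 1.
Proof. by rewrite /PG cfInd1 // natf_indexg // divGB cfun11 mulr1. Qed.

Lemma PG_U u : u \in U^# -> PG u = 1.
Proof.
move=> U1u; have [nt_u Uu] := setD1P U1u.
rewrite /PG cfIndE //; apply: canLR (mulKf (neq0CG _)) _; rewrite mulr1.
rewrite -sumr_const [RHS]big_mkcond [LHS]big_mkcond; apply: eq_bigr => g _.
case: ifP => [Gg|/negP nGg]; last first.
  by case: ifP => // /(subsetP sBG).
rewrite cfun1E; have -> : ((u ^ g)%g \in B) = (g \in B); last by case: (g \in B).
apply/idP/idP=> [Bug|Bg]; last by rewrite groupJ // (subsetP sUB).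
apply: (tiU U1u Gg).
(* U is a normal Hall subgroup of B, so it contains every element of B whose
   order divides #|U|. *)
have coUB : coprime #|U| #|B : U|.
  by rewrite -divgS // cardBA mulKn ?cardG_gt0 // coprimeUA.
have: (#[coset U (u ^ g)] %| #|U|)%N.
  have NUug : (u ^ g)%g \in 'N(U) by rewrite (subsetP (normal_norm nsUB)).
  apply: (@dvdn_trans #[u ^ g]%g); last by rewrite orderJ order_dvdG.
  by rewrite order_dvdn -morphX // expg_order morph1.
have: (#[coset U (u ^ g)] %| #|B : U|)%N.
  by rewrite -card_quotient ?normal_norm // order_dvdG // mem_quotient.
have NUug : (u ^ g)%g \in 'N(U) by rewrite (subsetP (normal_norm nsUB)).
move=> d1 d2; have: (#[coset U (u ^ g)] %| 1)%N by rewrite -(eqP coUB) dvdn_gcd d2 d1.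
by rewrite dvdn1 order_eq1 => /eqP /coset_idr; apply.
Qed.

Lemma PG_nonsplit a : a \in (A false)^# -> PG a = 0.
Proof. exact: cfInd_coprime. Qed.

(** The two conjugates of B containing the split torus are stabilizers of two points that it fixes;
    being distinct, they yield two disjoint cosets of B in the sum defining the induced
    character. *)
Lemma PG_split_ge2 a : a \in (A true)^# -> 2 <= PG a.
Proof.
case/setD1P=> _ Aa; have [x [y [Gx Gy sAx sAy neBxy]]] := splitA.
rewrite /PG cfIndE // mulrC ler_pdivlMr ?ltr0n ?cardG_gt0 // -natrM.
have disj : [disjoint (x^-1 *: B)%g & (y^-1 *: B)%g].
  rewrite -setI_eq0; apply: contraR neBxy => /set0Pn[g].
  case/setIP=> /lcosetP[b Bb ->] /lcosetP[c Bc eq_bc].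
  have -> : y = (c * b^-1 * x)%g.
    by apply: (can_inj invgK); rewrite !invMg !invgK mulgA eq_bc mulgK.
  by rewrite conjsgM (normsP (normG B) (c * b^-1)%g) // groupM ?groupV.
apply: le_trans (_ : \sum_(g in (x^-1 *: B :|: y^-1 *: B)%g) 1 <= _).
  rewrite sumr_const cardsU (eqP (_ : #|_ :&: _| == 0%N)) ?cards_eq0 ?setI_eq0 //.
  by rewrite subn0 !card_lcoset mul2n addnn.
rewrite [leLHS]big_mkcond [leRHS]big_mkcond ler_sum // => g _.
have sub z : z \in G -> A true \subset B :^ z -> g \in (z^-1 *: B)%g ->
   (g \in G) && ((a ^ g)%g \in B).
  move=> Gz sAz /lcosetP[b Bb ->]; rewrite groupM ?groupV //=; last exact: (subsetP sBG).
  rewrite conjgM memJ_norm; last exact: (subsetP (normG B)).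
  by rewrite -mem_conjg (subsetP sAz).
rewrite cfun1E; case: ifP => [/setUP[]/sub|_].
- by case/(_ Gx sAx)/andP=> -> ->.
- by case/(_ Gy sAy)/andP=> -> ->.
by case: ifP => // _; rewrite ler0n.
Qed.

(** Transitivity, in the form '[PG, 1] = 1, prescribes the sum of [PG] over the nontrivial elements
    of the split torus. That sum is the one given by the lower bound 2, so the bound is attained
    everywhere. *)
Lemma PG_split a : a \in (A true)^# -> PG a = 2.
Proof.
have sum0 : \sum_(t in (A true)^#) (PG t - 2) = 0.
  have: '[PG, 1] = 1 by rewrite -Frobenius_reciprocity cfRes_cfun1 // cfnorm1.
  rewrite cfdot_group big_bool /= PG_1 cfun11 conjC1.
  rewrite (eq_bigr (fun=> 1)) => [|u U1u]; last first.
    by rewrite PG_U // cfun1E (subsetP sUG) ?conjC1 ?mulr1 //; case/setD1P: U1u.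
  rewrite [X in _ + (_ + _ * X)]big1 => [|u A1u]; last by rewrite PG_nonsplit ?mul0r.
  rewrite (eq_bigr PG) => [|u]; last first.
    by case/setD1P=> _ Au; rewrite cfun1E (subsetP (sAG true)) // conjC1 mulr1.
  rewrite sumr_const -mulr_natr mul1r cardD1 cardU sumrB sumr_const -[_ *+ #|_|]mulr_natr cardD1.
  rewrite AE BE NE GE /= -/Q; set s := \sum_(_ in _) _ => def1.
  rewrite mulr0 addr0 !mulr1 addrC in def1.
  have -> : s = (Q - 1) * ((Q - 1)^-1 * s) by rewrite mulrA mulfV ?mul1r.
  rewrite (canRL (addrK _) def1); field.
  by rewrite nzQ nzQm1 nzQp1.
move=> A1a; apply/eqP; rewrite -subr_eq0; apply/eqP.
apply: (psumr_eq0P _ sum0 A1a) => t A1t; rewrite subr_ge0; exact: PG_split_ge2.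
Qed.

Definition StG : 'CF(G) := PG - 1.
Definition DeltaG : 'CF(G) := StG ^+ 2 - 1.
Definition XG b (phi : 'CF(A b)) : 'CF(G) := eps b *: ('Ind[G] phi - DeltaG).

Let cfun1G x : x \in G -> (1 : 'CF(G)) x = 1.
Proof. by move=> Gx; rewrite cfun1E Gx. Qed.
Let GU u : u \in U^# -> u \in G.
Proof. by case/setD1P=> _ /(subsetP sUG). Qed.
Let GA b a : a \in (A b)^# -> a \in G.
Proof. by case/setD1P=> _ /(subsetP (sAG b)). Qed.

Lemma StG_1 : StG 1%g = Q.
Proof. by rewrite !cfunE PG_1 cfun11 addrK. Qed.
Lemma StG_U u : u \in U^# -> StG u = 0.
Proof. by move=> U1u; rewrite !cfunE PG_U // cfun1G ?GU // subrr. Qed.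
Lemma StG_A b a : a \in (A b)^# -> StG a = eps b.
Proof.
move=> Aa; rewrite !cfunE cfun1G ?(GA Aa) //.
by case: b Aa => Aa; [rewrite PG_split | rewrite PG_nonsplit] => //; rewrite /eps; ring.
Qed.

Let eps2 b : eps b * eps b = 1.
Proof. by case: b; rewrite /= ?mulr1 // mulrNN mulr1. Qed.

Let DeltaGE x : DeltaG x = StG x * StG x - (1 : 'CF(G)) x.
Proof. by rewrite /DeltaG expr2; move: StG => s; rewrite !cfunE. Qed.
Let XGE b (phi : 'CF(A b)) x : XG phi x = eps b * ('Ind[G] phi x - DeltaG x).
Proof. by rewrite /XG; move: DeltaG ('Ind[G] phi) => s t; rewrite !cfunE. Qed.

Lemma DeltaG_1 : DeltaG 1%g = Q ^+ 2 - 1.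
Proof. by rewrite DeltaGE StG_1 cfun11 expr2. Qed.
Lemma DeltaG_U u : u \in U^# -> DeltaG u = -1.
Proof.
by move=> U1u; rewrite DeltaGE StG_U // cfun1G ?GU // mul0r sub0r.
Qed.
Lemma DeltaG_A b a : a \in (A b)^# -> DeltaG a = 0.
Proof.
move=> Aa; rewrite DeltaGE (StG_A Aa) cfun1G ?(GA Aa) //.
by rewrite eps2 subrr.
Qed.

Lemma StG_vchar : StG \in 'Z[irr G].
Proof. by rewrite rpredB ?cfun1_vchar // cfInd_vchar ?cfun1_vchar. Qed.
Lemma DeltaG_vchar : DeltaG \in 'Z[irr G].
Proof. by rewrite rpredB ?cfun1_vchar // rpredX // StG_vchar. Qed.

Let divGA b : #|G|%:R / #|A b|%:R = Q * (Q + eps b).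
Proof.
rewrite GE AE; case: b (nzQe b) => /= nz; field; last by rewrite opprK in nz *.
by [].
Qed.

(** * The virtual characters X(phi) and their scalar products *)

Section TorusCharacter.
Variables (b : bool) (phi : 'CF(A b)).
Hypothesis lin_phi : phi \is a linear_char.

(** By the TI property only the g in N contribute; those in A fix [a], and the other half inverts
    it. *)
Lemma cfInd_A a : a \in (A b)^# -> 'Ind[G] phi a = phi a + (phi a)^*.
Proof.
move=> A1a; have [_ Aa] := setD1P A1a; have [_ _ _ _ invA] := torA b.
rewrite cfIndE //; apply: canLR (mulKf (neq0CG _)) _.
have sumN : \sum_(g in G) phi (a ^ g)%g = \sum_(g in N b) phi (a ^ g)%g.
  rewrite (bigID (mem (N b))) /= [X in _ + X]big1 ?addr0.
    by apply: eq_bigl => g; rewrite andb_idl // => /(subsetP (sNG b)).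
  move=> g /andP[Gg nNg]; apply: cfun0; apply: contra nNg; exact: tiA A1a Gg.
rewrite {}sumN (bigID (mem (A b))) /= mulrDr; congr (_ + _).
  rewrite (eq_bigl (mem (A b))) => [|g]; last first.
    by rewrite andb_idl // => /(subsetP (sAN b)).
  rewrite (eq_bigr (fun=> phi a)) => [|g Ag]; first by rewrite sumr_const mulr_natl.
  by rewrite cfunJgen ?genGid.
(* Both g and g a lie outside A, so both square to 1, whence g a g = a^-1. *)
have invE g : g \in N b -> g \notin A b -> (a ^ g = a^-1)%g.
  move=> Ng nAg; have g2 := invA g Ng nAg.
  have ga2 : (g * a * (g * a))%g = 1%g.
    by apply: invA; [rewrite groupM // (subsetP (sAN b)) | rewrite groupMr].
  have gV : g^-1%g = g by apply/eqP; rewrite eq_invg_mul g2.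
  by rewrite conjgE gV; apply: (mulIg a); rewrite mulVg -ga2 !mulgA.
rewrite -lin_charV_conj // (eq_bigr (fun=> phi a^-1%g)) => [|g /andP[Ng nAg]].
  rewrite (eq_bigl (mem (N b :\: A b))) => [|g]; last by rewrite !inE andbC.
  rewrite sumr_const cardsDS // cardN mul2n -addnn addnK mulr_natl //.
by rewrite invE.
Qed.

Let W1 : 'Ind[G] phi 1%g = Q * (Q + eps b).
Proof. by rewrite cfInd1 // natf_indexg // divGA lin_char1 ?mulr1. Qed.

Lemma XG_1 : XG phi 1%g = Q + eps b.
Proof.
rewrite XGE W1 DeltaG_1.
have -> : Q * (Q + eps b) - (Q ^+ 2 - 1) = Q * eps b + 1 by ring.
by rewrite mulrDr mulrCA eps2 !mulr1.
Qed.

Lemma XG_U u : u \in U^# -> XG phi u = eps b.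
Proof.
move=> U1u; rewrite XGE DeltaG_U // (cfInd_coprime _ (sAG b) _ U1u); last first.
  by rewrite coprime_sym coprimeUA.
by rewrite sub0r opprK mulr1.
Qed.

Lemma XG_A a : a \in (A b)^# -> XG phi a = eps b * (phi a + (phi a)^*).
Proof. by move=> A1a; rewrite XGE (DeltaG_A A1a) subr0 cfInd_A. Qed.

Lemma XG_A' a : a \in (A (~~ b))^# -> XG phi a = 0.
Proof.
move=> A1a; rewrite XGE (DeltaG_A A1a) subr0.
by rewrite (cfInd_coprime _ (sAG b) (coprimeAA b) A1a) mulr0.
Qed.

Lemma XG_vchar : XG phi \in 'Z[irr G].
Proof.
rewrite scale_zchar //; first by rewrite /eps; case: b; rewrite ?rpredN rpred1.
by rewrite rpredB ?DeltaG_vchar // cfInd_vchar // char_vchar // lin_charW.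
Qed.

End TorusCharacter.

Section TorusCharacterProducts.
Variables (b : bool) (phi psi : 'CF(A b)).
Hypotheses (lin_phi : phi \is a linear_char) (lin_psi : psi \is a linear_char).

(** Over all of A the four products give scalar products of phi with psi and with psi^-1; the 4 is
    the removed term at 1, namely 2 * 2. *)
Lemma sum_lin_char2 :
  \sum_(a in (A b)^#) (phi a + (phi a)^*) * (psi a + (psi a)^*)^*
    = 2 * #|A b|%:R * ((phi == psi)%:R + (phi * psi == 1)%:R) - 4.
Proof.
have E1 : \sum_(a in A b) phi a * (psi a)^* = #|A b|%:R * (phi == psi)%:R.
  by rewrite -cfdot_lin_char // cfdotE mulVKf ?neq0CG.
have E2 : \sum_(a in A b) phi a * psi a = #|A b|%:R * (phi * psi == 1)%:R.
  rewrite -cfdot_lin_char ?rpredM ?rpred1 // cfdotE mulVKf ?neq0CG //.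
  by apply: eq_bigr => a Aa; rewrite cfun1E Aa conjC1 mulr1 cfunE.
have E3 : \sum_(a in A b) (phi a)^* * psi a = #|A b|%:R * (phi == psi)%:R.
  have -> : #|A b|%:R * (phi == psi)%:R = (#|A b|%:R * (phi == psi)%:R)^* :> algC.
    by rewrite rmorphM !rmorph_nat.
  by rewrite -E1 rmorph_sum; apply: eq_bigr => a _; rewrite rmorphM /= conjCK.
have E4 : \sum_(a in A b) (phi a)^* * (psi a)^* = #|A b|%:R * (phi * psi == 1)%:R.
  have -> : #|A b|%:R * (phi * psi == 1)%:R = (#|A b|%:R * (phi * psi == 1)%:R)^* :> algC.
    by rewrite rmorphM !rmorph_nat.
  by rewrite -E2 rmorph_sum; apply: eq_bigr => a _; rewrite rmorphM.
have sumA : \sum_(a in A b) (phi a + (phi a)^*) * (psi a + (psi a)^*)^*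
      = 2 * #|A b|%:R * ((phi == psi)%:R + (phi * psi == 1)%:R).
  rewrite (eq_bigr (fun a => phi a * (psi a)^* + phi a * psi a
     + ((phi a)^* * (psi a)^* + (phi a)^* * psi a))) => [|a _].
    by rewrite !big_split /= E1 E2 E3 E4; ring.
  by rewrite rmorphD /= conjCK; ring.
rewrite -sumA [in RHS](big_setD1 1%g) //= !lin_char1 // rmorph1 rmorphD rmorph1.
by ring.
Qed.

(** The Kronecker terms come from the torus, where #|N| = 2 #|A|; the leftover -4 of [sum_lin_char2]
    cancels against the contributions of 1 and U^#. *)
Lemma cfdot_XG :
  '[XG phi, XG psi] = (phi == psi)%:R + (phi * psi == 1)%:R.
Proof.
rewrite cfdot_group !XG_1 //.
rewrite (eq_bigr (fun=> 1)) => [|u U1u]; last first.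
  by rewrite !XG_U // /eps; case: (b); rewrite ?rmorphN rmorph1 ?mulrNN mulr1.
rewrite sumr_const -[1 *+ _]mulr_natr mul1r cardD1 cardU.
have conj_eps : (eps b)^* = eps b by rewrite /eps; case: (b); rewrite ?rmorphN rmorph1.
rewrite (bigD1 b) //= [X in _ + (_ + X)]big1 => [|c ne_cb]; last first.
  have -> : c = ~~ b by move: ne_cb; case: c b => [] [].
  by rewrite big1 ?mulr0 // => a A1a; rewrite XG_A' // mul0r.
rewrite (eq_bigr (fun a => (phi a + (phi a)^*) * (psi a + (psi a)^*)^*)); last first.
  move=> a A1a; rewrite !XG_A // rmorphM /= conj_eps mulrACA -[RHS]mul1r; congr (_ * _).
  exact: eps2.
rewrite sum_lin_char2 addr0 rmorphD /= conj_eps /Q rmorph_nat -/Q.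
rewrite NE AE GE BE; set d := _ + _%:R.
rewrite /eps; case: (b); field; rewrite ?opprK ?nzQ ?nzQm1 ?nzQp1 //.
Qed.

Hypothesis nt_phi : phi != 1.

(** One computation for the orthogonality to 1, to [StG] and to the characters of the other torus,
    all of which are constant on U^# and on the nontrivial elements of A. The last term uses that a
    nontrivial phi sums to -1 there. *)
Lemma cfdot_XG_const (xi : 'CF(G)) c d e :
    xi 1%g = c -> {in U^#, forall u, xi u = d} -> {in (A b)^#, forall a, xi a = e} ->
  '[XG phi, xi] = (Q + eps b) * c^* / #|G|%:R + eps b * (Q - 1) * d^* / #|B|%:R
                   - 2 * eps b * e^* / (Q - eps b).
Proof.
move=> xi1 xiU xiA; rewrite cfdot_group XG_1 // xi1.
rewrite (eq_bigr (fun=> eps b * d^*)) => [|u U1u]; last by rewrite XG_U // xiU.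
rewrite sumr_const -[(eps b * _) *+ _]mulr_natr cardD1 cardU.
rewrite (bigD1 b) //= [X in _ + (_ + X)]big1 => [|c' ne_cb]; last first.
  have -> : c' = ~~ b by move: ne_cb; case: c' b => [] [].
  by rewrite big1 ?mulr0 // => a A1a; rewrite XG_A' // mul0r.
rewrite (eq_bigr (fun a => eps b * e^* * (phi a + (phi a)^*))) => [|a A1a]; last first.
  by rewrite XG_A // xiA //; ring.
rewrite -mulr_sumr big_split /= sum_lin_char //.
have -> : \sum_(i in (A b)^#) (phi i)^* = -1.
  by rewrite -rmorph_sum /= sum_lin_char // rmorphN rmorph1.
rewrite NE -/Q; move: (nzQe b) => nz; field.
by rewrite nz !neq0CG.
Qed.

Lemma cfdot_XG_1 : '[XG phi, 1] = 0.
Proof.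
rewrite (@cfdot_XG_const 1 1 1 1) ?cfun11 // => [|u U1u|a A1a]; last first.
- by rewrite cfun1G // (GA A1a).
- by rewrite cfun1G // (GU U1u).
rewrite GE BE rmorph1 /eps; case: (b); field; rewrite ?opprK ?nzQ ?nzQm1 ?nzQp1 //.
Qed.

Lemma cfdot_XG_St : '[XG phi, StG] = 0.
Proof.
rewrite (@cfdot_XG_const StG Q 0 (eps b)) ?StG_1 // => [|u U1u|a A1a]; last first.
- exact: StG_A.
- exact: StG_U.
rewrite GE BE rmorph0 {2}/Q rmorph_nat -/Q.
rewrite /eps; case: (b); rewrite ?rmorphN rmorph1; field; rewrite ?opprK ?nzQ ?nzQm1 ?nzQp1 //.
Qed.

End TorusCharacterProducts.

Lemma cfdot_XG_compl b (phi : 'CF(A b)) (psi : 'CF(A (~~ b))) :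
  phi \is a linear_char -> psi \is a linear_char -> phi != 1 ->
  '[XG phi, XG psi] = 0.
Proof.
move=> lin_phi lin_psi nt_phi.
rewrite (@cfdot_XG_const b phi lin_phi nt_phi _ (Q + eps (~~ b)) (eps (~~ b)) 0).
- rewrite GE BE rmorph0 rmorphD /= {2}/Q rmorph_nat -/Q /eps.
  case: (b); rewrite ?rmorphN rmorph1; field; rewrite ?opprK ?nzQ ?nzQm1 ?nzQp1 //.
- exact: XG_1.
- by move=> u U1u; rewrite XG_U.
by move=> a A1a; rewrite XG_A' // negbK.
Qed.

Lemma cfnorm_StG : '[StG] = 1.
Proof.
rewrite cfdot_group StG_1 [\sum_(u in _) _]big1 => [|u U1u]; last by rewrite StG_U ?mul0r.
rewrite (eq_bigr (fun b => #|N b|%:R^-1 * #|(A b)^#|%:R)) => [|b _]; last first.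
  congr (_ * _); rewrite -sumr_const; apply: eq_bigr => a A1a.
  by rewrite (StG_A A1a) /eps; case: (b); rewrite ?rmorphN rmorph1 ?mulrNN mulr1.
rewrite big_bool /= !cardD1 !NE !AE GE BE /Q rmorph_nat -/Q /eps.
by field; rewrite ?opprK ?nzQ ?nzQm1 ?nzQp1.
Qed.

Lemma cfdot_StG_1 : '[StG, 1] = 0.
Proof.
rewrite cfdot_group StG_1 cfun11 [\sum_(u in _) _]big1 => [|u U1u]; last by rewrite StG_U ?mul0r.
rewrite (eq_bigr (fun b => #|N b|%:R^-1 * (eps b * #|(A b)^#|%:R))) => [|b _]; last first.
  congr (_ * _); rewrite mulr_natr -sumr_const; apply: eq_bigr => a A1a.
  by rewrite (StG_A A1a) cfun1G ?(GA A1a) // rmorph1 mulr1.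
rewrite big_bool /= !cardD1 !NE !AE GE BE rmorph1 -/Q /eps.
by field; rewrite ?opprK ?nzQ ?nzQm1 ?nzQp1.
Qed.

Lemma vchar1_irr (chi : 'CF(G)) :
  chi \in 'Z[irr G] -> '[chi] = 1 -> 0 < chi 1%g -> chi \in irr G.
Proof.
move=> Zchi n1; have [[] [i ->]] := vchar_norm1P Zchi n1; last by rewrite scale1r mem_irr.
by rewrite expr1 scaleN1r cfunE oppr_gt0 lt_gtF ?irr1_gt0.
Qed.

Lemma StG_irr : StG \in irr G.
Proof.
by apply: vchar1_irr StG_vchar cfnorm_StG _; rewrite StG_1 ltr0n.
Qed.

Let Qe_gt0 b : 0 < Q + eps b.
Proof.
rewrite /eps; case: b; first by rewrite natr1 ltr0n.
by rewrite Qm1 ltr0n.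
Qed.

Lemma XG_irr b (phi : 'CF(A b)) :
  phi \is a linear_char -> phi ^+ 2 != 1 -> XG phi \in irr G.
Proof.
move=> lin_phi nphi2; apply: vchar1_irr (XG_vchar _) _ _ => //; last by rewrite XG_1.
by rewrite cfdot_XG // eqxx -expr2 (negPf nphi2) addr0.
Qed.

(** * The generic irreducible characters *)

Variable alpha : forall b, 'CF(A b).
Hypothesis lin_alpha : forall b, alpha b \is a linear_char.
Hypothesis alpha_eq : forall b j k,
  (alpha b ^+ j == alpha b ^+ k) = (j == k %[mod #|A b|]).

Local Notation n b := #|A b|.
Local Notation X b j := (XG (alpha b ^+ j)).

Let lin_alphaX b j : alpha b ^+ j \is a linear_char.
Proof. by rewrite rpredX ?lin_alpha. Qed.

Let alphaX_eq1 b j : (alpha b ^+ j == 1) = (n b %| j)%N.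
Proof. by have := alpha_eq b j 0; rewrite expr0 => ->; rewrite mod0n. Qed.

Lemma cfdot_X b j k : '[X b j, X b k] = (j == k %[mod n b])%:R + (n b %| j + k)%N%:R.
Proof. by rewrite cfdot_XG ?lin_alphaX // alpha_eq -exprD alphaX_eq1. Qed.

Lemma X_irr b j : ~~ (n b %| 2 * j)%N -> X b j \in irr G.
Proof.
move=> ndvd; apply: XG_irr; first exact: lin_alphaX.
by rewrite -exprM mulnC alphaX_eq1.
Qed.

Let cfdot_Ind1 (H : {group gT}) (chi : 'CF(G)) : H \subset G ->
  '[chi, 'Ind[G, H] 1] = #|H|%:R^-1 * \sum_(x in H) chi x.
Proof.
move=> sHG; rewrite -cfdot_Res_l cfdotE; congr (_ * _); apply: eq_bigr => x Hx.
by rewrite cfResE // cfun1E Hx rmorph1 mulr1.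
Qed.

(** The j with 0 < 2 j < n, one for each pair of mutually inverse powers of [alpha b]; the trivial
    character and the one of order 2 are left out. *)
Definition torus_indices b := iota 1 (n b).-1./2.
Local Notation J := torus_indices.

Let mem_J b j : j \in J b -> (0 < 2 * j < n b)%N.
Proof. by rewrite mem_half_indices ?cardG_gt0. Qed.

Let J_ndvd2 b j : j \in J b -> ~~ (n b %| 2 * j)%N.
Proof. by case/mem_J/andP=> j_gt0 lt_jn; rewrite gtnNdvd. Qed.
Let J_ndvd b j : j \in J b -> ~~ (n b %| j)%N.
Proof. by move/J_ndvd2; apply: contra; apply: dvdn_mull. Qed.

Let X_inj b : {in J b &, injective (fun j => X b j)}.
Proof.
move=> j k Jj Jk /= eqX; apply/eqP; apply/contraT => ne_jk.
have := cfdot_X b j k; rewrite {1}eqX cfdot_X eqxx.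
rewrite !half_indices_mod ?mem_J // (negPf ne_jk) !addr0.
by move/eqP; rewrite oner_eq0.
Qed.

Definition generic_irr : seq 'CF(G) :=
  1 :: StG :: [seq X true j | j <- J true] ++ [seq X false j | j <- J false].

Lemma generic_irr_irr : {subset generic_irr <= irr G}.
Proof.
move=> phi; rewrite !inE mem_cat => /or3P[/eqP->|/eqP->|].
- by rewrite -irr0 mem_irr.
- exact: StG_irr.
by case/orP=> /mapP[j /J_ndvd2 nd ->]; apply: X_irr.
Qed.

Let irr_neq (phi psi : 'CF(G)) : psi \in irr G -> '[phi, psi] = 0 -> phi != psi.
Proof.
move=> /irrP[i ->] o_phi; apply/eqP=> def_phi; move/eqP: o_phi.
by rewrite def_phi cfnorm_irr oner_eq0.
Qed.

Let X_neq1 b j : j \in J b -> X b j != 1.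
Proof.
move=> Jj; apply: irr_neq; first by rewrite -irr0 mem_irr.
by rewrite cfdot_XG_1 ?lin_alphaX // alphaX_eq1 J_ndvd.
Qed.
Let X_neqSt b j : j \in J b -> X b j != StG.
Proof.
move=> Jj; apply: irr_neq StG_irr _.
by rewrite cfdot_XG_St ?lin_alphaX // alphaX_eq1 J_ndvd.
Qed.

Lemma generic_irr_uniq : uniq generic_irr.
Proof.
rewrite /= cat_uniq !map_inj_in_uniq ?iota_uniq; try exact: X_inj.
rewrite inE !mem_cat !negb_or eq_sym (irr_neq _ cfdot_StG_1) -?irr0 ?mem_irr //=.
rewrite irr0 andbT; apply/and3P; split.
- by apply/andP; split; apply/mapP=> [[j Jj /esym/eqP]]; apply/negP; apply: X_neq1.
- by apply/andP; split; apply/mapP=> [[j Jj /esym/eqP]]; apply/negP; apply: X_neqSt.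
apply/hasPn=> _ /mapP[j Jj ->]; apply/mapP=> [[k Jk eqX]].
have /eqP := @cfdot_XG_compl true (alpha true ^+ k) (alpha false ^+ j)
   (lin_alphaX _ _) (lin_alphaX _ _) (eq_ind_r negb (J_ndvd Jk) (alphaX_eq1 _ _)).
by rewrite eqX cfdot_X eqxx -natrD pnatr_eq0.
Qed.

Let cfInd_Crat (H : {group gT}) (phi : 'CF(H)) x : H \subset G ->
  (forall y, phi y \in Crat) -> 'Ind[G] phi x \in Crat.
Proof.
by move=> sHG ratphi; rewrite cfIndE // rpredM ?rpredV ?rpred_nat // rpred_sum.
Qed.

Lemma PG_Crat x : PG x \in Crat.
Proof.
by apply: cfInd_Crat => // y; rewrite cfun1E rpred_nat.
Qed.

Lemma DeltaG_Crat x : DeltaG x \in Crat.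
Proof.
have St_Crat : StG x \in Crat.
  rewrite /StG; move: (PG_Crat x); move: PG => P Px.
  by rewrite !cfunE rpredB // cfun1E rpred_nat.
by rewrite DeltaGE rpredB ?rpredM // cfun1E rpred_nat.
Qed.

(** Induction is linear and [DeltaG] is rational, so only sums of powers of roots of unity on the
    torus remain. *)
Lemma sum_XG_Crat b (beta : 'CF(A b)) d x :
    beta \is a linear_char -> beta ^+ d = 1 ->
  \sum_(0 <= k < d | coprime k d) XG (beta ^+ k) x \in Crat.
Proof.
move=> lin_beta beta_d; under eq_bigr => k _ do rewrite XGE.
rewrite -mulr_sumr rpredM ?sumrB ?rpredB //.
- by rewrite /eps; case: (b); rewrite ?rpredN rpred1.
- rewrite -sum_cfunE -linear_sum /=; apply: cfInd_Crat => // y; rewrite sum_cfunE.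
  have [Ay|nAy] := boolP (y \in A b); last by rewrite big1 ?rpred0 // => k _; rewrite cfun0.
  under eq_bigr => k _ do rewrite exp_cfunE //.
  by apply: sum_expr_coprime_Crat; rewrite -exp_cfunE // beta_d cfun1E Ay.
by rewrite rpred_sum // => k _; apply: DeltaG_Crat.
Qed.

(** * The half characters and the completeness of the list *)

(* [A b0] is the torus of even order. *)
Section Halves.
Variables (b0 : bool) (m : nat).
Hypothesis n_even : n b0 = (2 * m)%N.
Local Notation e := (eps b0).
Local Notation Xh := (X b0 m).

Let m_gt0 : (0 < m)%N.
Proof. by have := cardG_gt0 (A b0); rewrite n_even muln_gt0. Qed.

(** With r the parity of n, the nontrivial characters with phi^2 != 1 number n - 1 or n - 2, and
    [J b] has half as many indices. *)
Let size_J b (r : bool) k : n b = (2 * k + r)%N -> (0 < k + r)%N ->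
  (size (J b))%:R = (n b)%:R / 2 - (if r then 1 / 2 else 1) :> algC.
Proof.
move=> nE kr_gt0; rewrite size_iota.
have -> : (n b).-1./2 = (k + r).-1.
  by rewrite nE; move: kr_gt0; clear; case: r => /=; lia.
have -> : (k + r).-1%:R = (k + r)%:R - 1 :> algC.
  by rewrite -{2}(ltn_predK kr_gt0) -natr1 addrK.
by rewrite nE (natrD _ (2 * k)) natrM natrD; case: r {nE kr_gt0} => /=; field.
Qed.

Let n_odd : exists k, n (~~ b0) = (2 * k + 1)%N.
Proof.
exists (n (~~ b0))./2; have := cardA true; have := cardA false; move: n_even q_odd q_gt0.
by clear; case: b0 => /=; lia.
Qed.

(** The deficit (Q + e)^2 / 2 is twice the square of (Q + e) / 2: exactly the room for two
    characters of half the degree of [Xh]. *)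
Lemma sum_square_generic :
  \sum_(phi <- generic_irr) phi 1%g ^+ 2 = #|G|%:R - (Q + e) ^+ 2 / 2.
Proof.
rewrite !big_cons cfun11 StG_1 big_cat !big_map /=.
have sumJ b : \sum_(j <- J b) X b j 1%g ^+ 2 = (size (J b))%:R * (Q + eps b) ^+ 2.
  rewrite (eq_bigr (fun=> (Q + eps b) ^+ 2)) => [|j _]; last by rewrite XG_1 ?lin_alphaX.
  by rewrite big_const_seq count_predT iter_addr_0 mulr_natl.
rewrite !sumJ.
have sE : (size (J b0))%:R = (Q - e) / 4 - 1.
  rewrite (@size_J b0 false m) /= ?addn0 // AE; by field.
have sO : (size (J (~~ b0)))%:R = (Q + e) / 4 - 1 / 2.
  have [k nE] := n_odd; rewrite (@size_J _ true k nE) ?addn1 // AE /eps.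
  by case: (b0) => /=; field.
by move: sE sO; rewrite GE /eps; case: (b0) => /= -> ->; field.
Qed.

Lemma cfnorm_Xh : '[Xh] = 2.
Proof. by rewrite cfdot_X eqxx addnn -mul2n -n_even dvdnn. Qed.

Lemma cfdot_Xh_generic phi : phi \in generic_irr -> '[Xh, phi] = 0.
Proof.
have ndvd_m : ~~ (n b0 %| m)%N by rewrite gtnNdvd // n_even ltn_Pmull.
have nt_m : alpha b0 ^+ m != 1 by rewrite alphaX_eq1.
rewrite !inE mem_cat => /or3P[/eqP->|/eqP->|].
- by rewrite cfdot_XG_1 ?lin_alphaX.
- by rewrite cfdot_XG_St ?lin_alphaX.
have XJ b j : j \in J b -> '[Xh, X b j] = 0.
  have [->{b} Jj|/negPf ne_b Jj] := eqVneq b b0.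
    have := mem_J Jj; rewrite cfdot_X n_even => ltj.
    have [lt_m2m [lt_jm /andP[mj_gt0 lt_mj]]] : (m < 2 * m)%N /\ (j < m)%N /\ (0 < m + j < 2 * m)%N.
      by move: m_gt0 ltj; clear; lia.
    by rewrite !modn_small ?(ltn_trans lt_jm) // gtn_eqF // gtnNdvd // addr0.
  have def_b : b = ~~ b0 by move: ne_b; case: (b) (b0) => [] [].
  by rewrite def_b; apply: cfdot_XG_compl; rewrite ?lin_alphaX.
by case/orP=> /mapP[j Jj ->]; apply: XJ.
Qed.

(** Having norm 2, [Xh] is a signed sum of two irreducible characters. If a and b are their signed
    degrees, then a + b = Q + e and the squared degrees found so far add up to #|G| + (a - b)^2 / 2.
    This cannot exceed #|G|, so a = b, both signs are positive, and no irreducible character is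
    missing. *)
Lemma irr_classification : exists i1 i2,
  [/\ i1 != i2, Xh = 'chi_i1 + 'chi_i2, 'chi_i1 1%g = (Q + e) / 2,
      'chi_i2 1%g = (Q + e) / 2
    & uniq ('chi_i1 :: 'chi_i2 :: generic_irr) /\
      forall i, 'chi_i \in 'chi_i1 :: 'chi_i2 :: generic_irr].
Proof.
have Zirr := XG_vchar (lin_alphaX b0 m).
have [[[|x [|y [|? ?]]] //= sz] [/= orth Zxy]] := zchar_small_norm Zirr cfnorm_Xh isT.
rewrite !big_cons big_nil addr0 => defX.
have /andP[/= /and3P[/eqP nx /eqP ny _] oxy] := orth.
have [Zx Zy] : x \in 'Z[irr G] /\ y \in 'Z[irr G].
  by split; apply: Zxy; rewrite !inE eqxx ?orbT.
have [s1 [i1 def_x]] := vchar_norm1P Zx nx.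
have [s2 [i2 def_y]] := vchar_norm1P Zy ny.
have oxy0 : '[x, y] = 0 by apply/eqP; move: oxy; rewrite !andbT.
have ne12 : i1 != i2.
  apply: contra_eqN oxy0 => /eqP E.
  rewrite def_x def_y; rewrite cfdotZl cfdotZr E cfnorm_irr mulr1 rmorph_sign.
  by rewrite mulf_eq0 !signr_eq0.
have notin k (s : bool) : '[Xh, 'chi_k] = (-1) ^+ s -> 'chi_k \notin generic_irr.
  move=> Xk; apply/negP=> /cfdot_Xh_generic; rewrite Xk => /eqP.
  by rewrite signr_eq0.
have nin1 : 'chi_i1 \notin generic_irr.
  apply: (notin _ s1); rewrite defX def_x def_y cfdotDl !cfdotZl !cfdot_irr eqxx.
  by rewrite eq_sym (negPf ne12) mulr0 addr0 mulr1.
have nin2 : 'chi_i2 \notin generic_irr.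
  apply: (notin _ s2); rewrite defX def_x def_y cfdotDl !cfdotZl !cfdot_irr eqxx.
  by rewrite (negPf ne12) mulr0 add0r mulr1.
have uniq_s : uniq ('chi_i1 :: 'chi_i2 :: generic_irr).
  by rewrite 2!cons_uniq in_cons negb_or (inj_eq irr_inj) ne12 nin1 nin2 generic_irr_uniq.
have sub_s : {subset 'chi_i1 :: 'chi_i2 :: generic_irr <= irr G}.
  move=> phi; rewrite in_cons => /predU1P[->|]; first exact: mem_irr.
  by rewrite in_cons => /predU1P[->|/generic_irr_irr//]; apply: mem_irr.
set d1 := 'chi_i1 1%g; set d2 := 'chi_i2 1%g.
pose a := (-1) ^+ s1 * d1; pose b := (-1) ^+ s2 * d2.
have def_ab : a + b = Q + e.
  by rewrite -(XG_1 (lin_alphaX b0 m)) defX def_x def_y !cfunE.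
have sum_s : \sum_(phi <- 'chi_i1 :: 'chi_i2 :: generic_irr) phi 1%g ^+ 2
    = #|G|%:R + (a - b) ^+ 2 / 2.
  rewrite 2!big_cons sum_square_generic -/d1 -/d2 -def_ab.
  have -> : d1 ^+ 2 = a ^+ 2 by rewrite exprMn sqrr_sign mul1r.
  have -> : d2 ^+ 2 = b ^+ 2 by rewrite exprMn sqrr_sign mul1r.
  by field.
have [d1_gt0 d2_gt0] : 0 < d1 /\ 0 < d2 by rewrite !irr1_gt0.
have real_ab : a - b \is Num.real.
  by rewrite rpredB ?rpredM ?rpredX ?rpredN ?rpred1 ?gtr0_real.
have eq_ab : a = b.
  apply/eqP; rewrite -subr_eq0 -sqrf_eq0 eq_le real_exprn_even_ge0 // andbT.
  have := sum_square_le uniq_s sub_s; rewrite sum_s gerDl pmulr_lle0 //.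
  by rewrite invr_gt0 ltr0n.
have a_half : a = (Q + e) / 2 by rewrite -def_ab -eq_ab; field.
have a_gt0 : 0 < a by rewrite a_half divr_gt0 ?ltr0n.
have s1F : s1 = false.
  by move: a_gt0; rewrite /a; case: (s1) => //; rewrite expr1 mulN1r oppr_gt0 lt_gtF.
have s2F : s2 = false.
  move: a_gt0; rewrite eq_ab /b; case: (s2) => //.
  by rewrite expr1 mulN1r oppr_gt0 lt_gtF.
have [aE bE] : a = d1 /\ b = d2 by rewrite /a /b s1F s2F !mul1r.
exists i1, i2; split=> //.
- by rewrite defX def_x def_y s1F s2F !scale1r.
- by rewrite -a_half aE.
- by rewrite -a_half eq_ab bE.
split=> // i; apply: sum_square_eq => //.
by rewrite sum_s eq_ab subrr expr0n mul0r addr0.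
Qed.

Lemma generic_irr_U phi u v :
  phi \in generic_irr -> u \in U^# -> v \in U^# -> phi u = phi v.
Proof.
move=> gphi U1u U1v; move: gphi; rewrite !inE mem_cat => /or3P[/eqP->|/eqP->|].
- by rewrite !cfun1G ?GU.
- by rewrite !StG_U.
by case/orP=> /mapP[j _ ->]; rewrite !XG_U ?lin_alphaX.
Qed.

Let cent1U u : u \in U^# -> 'C_G[u] = U.
Proof.
move=> U1u; have [_ Uu] := setD1P U1u; apply/setP=> g.
rewrite inE; apply/andP/idP=> [[Gg /cent1P cug]|Ug].
  by apply: centU U1u Gg _.
by split; [apply: (subsetP sUG) | apply/cent1P; apply: (centsP abelU)].
Qed.

(** By the TI property fusion in U^# takes place in B, where the class of u has #|B : U| = (q - 1) /
    2 elements, too few to fill U^#. *)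
Lemma unipotent_nonconj u : u \in U^# -> exists2 v, v \in U^# & v \notin (u ^: G)%g.
Proof.
move=> U1u; have [_ Uu] := setD1P U1u.
case: (boolP [exists v in U^#, v \notin (u ^: G)%g]) => [/exists_inP//|].
rewrite negb_exists_in => /forall_inP all_conj.
have sub : U^# \subset (u ^: B)%g.
  apply/subsetP=> v U1v; have := all_conj v U1v; rewrite negbK => /imsetP[g Gg def_v].
  have [_ Uv] := setD1P U1v.
  by rewrite def_v memJ_class // (tiU U1u) // -def_v.
have := subset_leq_card sub; rewrite -index_cent1.
have -> : ('C_B[u] = U)%g.
  by rewrite -(setIidPl sBG) -setIA cent1U // (setIidPr sUB).
have := cardsD1 1%g U; rewrite group1 -divgS // cardBA cardU.
have := cardA true; have := q1_gt0; rewrite /= mulKn // => h1 h2 h3 h4.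
exfalso; move: h1 h2 h3 h4; clear; move: #|A true| => t; move: #|U^#| => x.
by case: q => //= q'; lia.
Qed.

Section HalfCharacters.
Variables i1 i2 : Iirr G.
Hypotheses (ne_i12 : i1 != i2) (def_Xh : Xh = 'chi_i1 + 'chi_i2).
Hypotheses (chi_i1_1 : 'chi_i1 1%g = (Q + e) / 2) (chi_i2_1 : 'chi_i2 1%g = (Q + e) / 2).
Hypothesis irrP : forall i, 'chi_i \in 'chi_i1 :: 'chi_i2 :: generic_irr.
Local Notation f := ('chi_i1 - 'chi_i2).

Let chi2E x : 'chi_i2 x = Xh x - 'chi_i1 x.
Proof. by rewrite def_Xh cfunE addrC addKr. Qed.

Let fE x : f x = 'chi_i1 x - 'chi_i2 x.
Proof. by rewrite !cfunE. Qed.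

(** The difference of two column orthogonality relations. Characters constant on U^# drop out; since
    [Xh] is one of them, the two halves change by opposite amounts from u to v, and their terms
    combine into [f]. *)
Let orth_U u v g : u \in U^# -> v \in U^# -> g \in G ->
  ('chi_i1 u - 'chi_i1 v) * (f g)^* = Q *+ (u \in g ^: G) - Q *+ (v \in g ^: G).
Proof.
move=> U1u U1v Gg.
have CQ w : w \in U^# -> Q = #|'C_G[w]|%:R by move=> U1w; rewrite cent1U // cardU.
rewrite [Y in Y *+ _ - _](CQ u) // [Y in _ - Y *+ _](CQ v) //.
rewrite -!second_orthogonality_relation // -sumrB.
rewrite (bigD1 i1) //= (bigD1 i2) //=; last by rewrite eq_sym.
rewrite big1 ?addr0 => [|i /andP[ne1 ne2]].
  by rewrite fE (chi2E u) (chi2E v) !XG_U ?lin_alphaX // rmorphB /=; ring.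
have := irrP i; rewrite !in_cons !(inj_eq irr_inj) (negPf ne1) (negPf ne2) /=.
by move=> gen_i; rewrite (generic_irr_U gen_i U1u U1v) subrr.
Qed.

(* On [U^#], all the irreducible characters but the two halves are constant, so
   the second orthogonality relation only involves [f]. *)
Lemma half_diff_U u : u \in U^# -> f u * (f u)^* = Q.
Proof.
move=> U1u; have [v U1v ncj] := unipotent_nonconj U1u.
have ncj' : u \notin (v ^: G)%g by rewrite class_sym.
have := orth_U U1u U1v (GU U1u); rewrite class_refl (negPf ncj) subr0 mulr1n => orth_u.
have := orth_U U1u U1v (GU U1v); rewrite class_refl (negPf ncj') sub0r mulr1n => orth_v.
have nzD : 'chi_i1 u - 'chi_i1 v != 0.
  by apply: contra_eq_neq orth_u => ->; rewrite mul0r eq_sym.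
(* The relations at g = u and at g = v have right-hand sides Q and -Q and the same nonzero first
   factor. *)
have fv : f v = - f u.
  apply: (can_inj conjCK); apply: (mulfI nzD).
  by rewrite orth_v rmorphN mulrN orth_u.
suff E : 'chi_i1 u - 'chi_i1 v = f u by rewrite -{1}E.
have -> : 'chi_i1 u - 'chi_i1 v = (f u - f v) / 2.
  by rewrite !fE (chi2E u) (chi2E v) !XG_U ?lin_alphaX //; field.
by rewrite fv; field.
Qed.

(** For such x the relation of [orth_U] has right-hand side 0, while its first factor is nonzero for
    nonconjugate u and v. *)
Lemma half_diff_out x : x \in G -> x \notin class_support U^# G -> f x = 0.
Proof.
move=> Gx nSx; have ncj u : u \in U^# -> u \notin (x ^: G)%g.
  move=> U1u; apply: contra nSx; rewrite class_sym => /imsetP[g Gg ->].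
  exact: memJ_class_support.
have [u U1u] : exists u, u \in U^#.
  have /trivgPn[u Uu nt_u] : U :!=: 1%g by rewrite -cardG_gt1 cardU ltnW.
  by exists u; rewrite !inE nt_u.
have [v U1v ncj_uv] := unipotent_nonconj U1u.
have := orth_U U1u U1v Gx; rewrite !(negPf (ncj _ _)) // subr0 => /eqP.
rewrite mulf_eq0 fmorph_eq0 => /orP[|/eqP//].
have := orth_U U1u U1v (GU U1u); rewrite class_refl [v \in _](negPf ncj_uv) subr0 mulr1n.
by move=> E /eqP D0; move/eqP: E; rewrite D0 mul0r eq_sym (negPf nzQ).
Qed.

Lemma half_diff_A b a : a \in (A b)^# -> f a = 0.
Proof.
move=> A1a; apply: half_diff_out (GA A1a) _.
have Sa : a \in S (A b) by apply: mem_class_support.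
apply/negP=> SUa; have := coprime_class_support (coprimeUA b).
by move/setP/(_ a); rewrite !inE SUa Sa.
Qed.

Lemma half_diff_values x : f x = 0 \/ exists2 u, u \in U^# & f x = f u.
Proof.
have [Gx|nGx] := boolP (x \in G); last by left; rewrite cfun0.
have [/imset2P[u g U1u Gg ->]|nSx] := boolP (x \in class_support U^# G).
  by right; exists u; rewrite ?cfunJ.
by left; apply: half_diff_out.
Qed.

Lemma half_A b a : a \in (A b)^# -> 'chi_i1 a = Xh a / 2.
Proof.
move/half_diff_A; rewrite fE chi2E => f0.
have -> : Xh a = 'chi_i1 a + 'chi_i1 a - ('chi_i1 a - (Xh a - 'chi_i1 a)) by ring.
by rewrite f0; field.
Qed.

(** As [alpha b0 ^+ m] has order 2, its orbit sum has the single exponent k = 1. *)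
Lemma Xh_Crat x : Xh x \in Crat.
Proof.
have := @sum_XG_Crat b0 (alpha b0 ^+ m) 2 x (lin_alphaX _ _).
have -> : (alpha b0 ^+ m) ^+ 2 = 1.
  by apply/eqP; rewrite -exprM mulnC -n_even alphaX_eq1.
by move/(_ erefl); rewrite big_mkcond big_nat_recl // big_nat1 /= add0r expr1.
Qed.

(** When u is conjugate to its inverse, [f u] is real, so its square is q = r^2 and [f u] is r or
    -r. *)
Lemma half_Crat : (q %% 4 = 1)%N -> is_square q ->
  forall x, 'chi_i1 x \in Crat /\ 'chi_i2 x \in Crat.
Proof.
move=> q1 [r def_q].
have fU u : u \in U^# -> f u \in Crat.
  move=> U1u; have real_fu : (f u)^* = f u.
    have conjf y : f y^-1%g = (f y)^* by rewrite !fE rmorphB /= !char_inv ?irr_char.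
    by have /imsetP[g Gg def_uV] := invU q1 U1u; rewrite -conjf def_uV cfunJ.
  have := half_diff_U U1u; rewrite real_fu -expr2 /Q def_q natrX => /eqP.
  by rewrite eqf_sqr => /orP[]/eqP->; rewrite ?rpredN rpred_nat.
have f_Crat x : f x \in Crat.
  by have [->|[u U1u ->]] := half_diff_values x; rewrite ?rpred0 ?fU.
move=> x; have [def1 def2] : 'chi_i1 x = (Xh x + f x) / 2 /\ 'chi_i2 x = (Xh x - f x) / 2.
  by rewrite fE chi2E; split; field.
by rewrite {1}def1 def2 !(rpredM, rpredB, rpredD) ?rpredV ?rpred_nat ?Xh_Crat ?f_Crat.
Qed.

(** A rational value [f u] is an algebraic integer, hence an integer, so q is a square; an odd
    square is 1 modulo 4. *)
Lemma half_not_Crat :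
  ~ ((q %% 4 = 1)%N /\ is_square q) -> ~ forall x, 'chi_i1 x \in Crat.
Proof.
move=> nq ratchi; apply: nq.
have [u U1u] : exists u, u \in U^#.
  have /trivgPn[u Uu nt_u] : U :!=: 1%g by rewrite -cardG_gt1 cardU ltnW.
  by exists u; rewrite !inE nt_u.
have fu_Crat : f u \in Crat.
  rewrite fE chi2E !(rpredB, ratchi, Xh_Crat) //.
have fu_Int : f u \in Num.int.
  by rewrite Cint_rat_Aint // fE rpredB ?Aint_irr.
have /natrP[r def_r] := natr_norm_int fu_Int.
have := half_diff_U U1u; rewrite -normCK def_r -natrX => /eqP.
rewrite eqr_nat => /eqP def_q; split; last by exists r.
by rewrite -def_q; apply: odd_square_mod4; rewrite def_q.
Qed.

(** Off the identity [f] and [Xh] both vanish on this odd torus, so the multiplicity is the degree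
    (Q + e) / 2 divided by the order of the torus, which equals it. *)
Lemma half_mult : '['chi_i1, 'Ind[G, A (~~ b0)] 1] = 1.
Proof.
rewrite cfdot_Ind1 // (big_setD1 1%g) //= chi_i1_1 big1 ?addr0 => [|a A1a].
  rewrite AE /eps; move: nzQm1 nzQp1.
  by case: (b0) => /= nz1 nz2; field; rewrite ?opprK.
rewrite (half_A A1a) XG_A' ?lin_alphaX ?mul0r //.
Qed.

End HalfCharacters.

(** * Multiplicities in the permutation modules of dihedral subgroups *)

Let torA2 w : w \in N b0 -> w \notin A b0 -> (w * w = 1)%g.
Proof. by have [_ _ _ _ invA] := torA b0; apply: invA. Qed.

(** U and the other torus have odd order, so the partition leaves only the conjugates of [A b0] for
    an involution. *)
Lemma involution_conj w : w \in N b0 -> w \notin A b0 ->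
  exists2 g, g \in G & (w ^ g)%g \in (A b0)^#.
Proof.
move=> Nw nAw; have w2 := torA2 Nw nAw.
have nt_w : w != 1%g by apply: contraNneq nAw => ->.
have ow : #[w] = 2%N by apply: nt_prime_order => //; rewrite expgS expg1.
have odd_S (H : {group gT}) : odd #|H| -> w \notin S H.
  move=> odd_H; apply/negP=> /imset2P[h g /setD1P[_ Hh] _ def_w].
  have := order_dvdG Hh; rewrite -(orderJ h g) -def_w ow dvdn2 odd_H //.
have : w \in SG by rewrite group_partition (subsetP (sNG b0)).
have odd_A' : odd #|A (~~ b0)|.
  by have [k ->] := n_odd; rewrite addn1 /= oddM.
rewrite !inE (negPf nt_w) (negPf (odd_S U _)) ?cardU //= => Sw.
have {Sw} /imset2P[h g A1h Gg ->] : w \in S (A b0).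
  by move: Sw (odd_S _ odd_A'); case: (b0) => /orP[->|->].
by exists g^-1%g; rewrite ?groupV // conjgK.
Qed.

(** Both elements are conjugate to the only involution of the cyclic group [A b0]. *)
Lemma cfun_involution (chi : 'CF(G)) w v : w \in N b0 -> w \notin A b0 ->
  v \in N b0 -> v \notin A b0 -> chi w = chi v.
Proof.
move=> Nw nAw Nv nAv.
have [g Gg A1wg] := involution_conj Nw nAw.
have [h Gh A1vh] := involution_conj Nv nAv.
rewrite -(cfunJ chi w Gg) -(cfunJ chi v Gh); congr (chi _).
have [[nt_wg Awg] [nt_vh Avh]] := (setD1P A1wg, setD1P A1vh).
have o2 x : x \in N b0 -> x \notin A b0 -> #[x] = 2%N.
  move=> Nx nAx; have nt_x : x != 1%g by apply: contraNneq nAx => ->.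
  by apply: nt_prime_order => //; rewrite expgS expg1 torA2.
have [cycA _ _ _ _] := torA b0.
have : (<[w ^ g]> == <[v ^ h]>)%g.
  rewrite (eq_subG_cyclic cycA) ?cycle_subG //.
  by rewrite -!orderE !orderJ !o2.
move/eqP=> eqc; have : (w ^ g)%g \in <[v ^ h]>%g by rewrite -eqc cycle_id.
by rewrite cycle2g ?orderJ ?o2 // !inE (negPf nt_wg) => /eqP.
Qed.

(** The character vanishes on every nontrivial element of [N b0], including the involutions outside
    [A b0] since these are conjugate into it; the multiplicity is its degree Q - e divided by #|N
    b0| = Q - e. *)
Lemma Xc_mult j : ~~ (n (~~ b0) %| j)%N -> '[X (~~ b0) j, 'Ind[G, N b0] 1] = 1.
Proof.
move=> ndvd; have A0 a : a \in (A b0)^# -> X (~~ b0) j a = 0.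
  by move=> A1a; rewrite XG_A' ?lin_alphaX // negbK.
rewrite cfdot_Ind1 // (big_setD1 1%g) //= XG_1 ?lin_alphaX // big1 ?addr0 => [|a].
  have -> : Q + eps (~~ b0) = Q - e by rewrite /eps; case: (b0); rewrite ?opprK.
  by rewrite NE mulVf.
case/setD1P=> nt_a Na; have [Aa|nAa] := boolP (a \in A b0).
  by rewrite A0 // !inE nt_a.
by have [g Gg A1ag] := involution_conj Na nAa; rewrite -(cfunJ _ _ Gg) A0.
Qed.

(* [K] is a dihedral subgroup of index 2 in [N b0]: its rotations are the
   squares of [A b0], on which [alpha b0 ^+ j] is still nontrivial. *)
Lemma X_mult j : ~~ (n b0 %| 2 * j)%N ->
  exists2 K : {group gT}, K \subset G
    & '[X b0 j, 'Ind[G, K] 1] = '[X b0 j, 'Ind[G, N b0] 1] + 1.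
Proof.
move=> ndvd; have [cycA _ _ _ _] := torA b0; have [a defA] := cyclicP cycA.
have oa : #[a] = (2 * m)%N by rewrite -n_even defA.
pose A2 := <[a ^+ 2]>%G; have oA2 : #|A2| = m.
  by rewrite -orderE orderXdiv ?oa ?dvdn_mulr // mulKn.
have sA2A : A2 \subset A b0 by rewrite defA cycleX.
have [w Nw nAw] : exists2 w, w \in N b0 & w \notin A b0.
  apply/subsetPn; apply/negP=> /subset_leq_card.
  by rewrite cardN leqNgt ltn_Pmull.
have w2 := torA2 Nw nAw.
have nt_w : w != 1%g by apply: contraNneq nAw => ->.
have ow : #[w] = 2%N by apply: nt_prime_order => //; rewrite expgS expg1.
have wA : <[w]>%g :&: A b0 = 1%g.
  apply/trivgP/subsetP=> x /setIP[wx].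
  have /set2P[->|->] : x \in [set 1%g; w] by rewrite -cycle2g.
    by rewrite group1.
  by rewrite (negPf nAw).
have nA2w : <[w]>%g \subset 'N(A2).
  have charA2 : A2 \char A b0 by rewrite sub_cyclic_char.
  have /andP[_] := char_normal_trans charA2 (nsAN b0).
  by apply: subset_trans; rewrite cycle_subG.
pose K := (A2 <*> <[w]>)%G; have defK : K = (A2 * <[w]>)%g :> {set gT} by rewrite /= norm_joinEr.
have sKN : K \subset N b0.
  by rewrite join_subG (subset_trans sA2A) //= cycle_subG.
have oK : #|K| = (2 * m)%N.
  rewrite defK TI_cardMg ?oA2 -?orderE ?ow 1?mulnC //.
  by apply/trivgP; rewrite /= -wA [A2 :&: _]setIC; apply: setIS.
have KA : K :&: A b0 = A2.
  by rewrite defK -group_modl // wA mulg1.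
exists K; first exact: subset_trans sKN (sNG b0).
pose v := X b0 j w.
have sumH (H : {group gT}) (D : {set gT}) : H \subset N b0 -> H :&: A b0 = D ->
  \sum_(x in H) X b0 j x = \sum_(x in D) X b0 j x + (#|H| - #|D|)%:R * v.
  move=> sHN <-; rewrite (big_setID (A b0)) /=; congr (_ + _).
  have -> : (#|H| - #|H :&: A b0|)%N = #|H :\: A b0| by rewrite cardsD.
  rewrite mulr_natl -sumr_const; apply: eq_bigr => x /setDP[Hx nAx].
  by apply: cfun_involution => //; apply: (subsetP sHN).
have sumX (D : {set gT}) : 1%g \in D -> D \subset A b0 -> \sum_(x in D) X b0 j x =
    Q + e + e * \sum_(x in D :\ 1%g) ((alpha b0 ^+ j) x + ((alpha b0 ^+ j) x)^*).
  move=> D1 sDA; rewrite (big_setD1 1%g) //= XG_1 ?lin_alphaX //; congr (_ + _).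
  rewrite mulr_sumr; apply: eq_bigr => x /setD1P[nt_x Dx].
  by rewrite XG_A ?lin_alphaX // !inE nt_x (subsetP sDA).
pose phi := 'Res[A2] (alpha b0 ^+ j).
have lin_phi : phi \is a linear_char by rewrite cfRes_lin_char ?lin_alphaX.
have nt_phi : phi != 1.
  apply: contraNneq ndvd => phi1; rewrite -alphaX_eq1; apply/eqP/cfun_inP=> x Ax.
  have A2xx : (x ^+ 2)%g \in A2.
    by move: Ax; rewrite defA => /cycleP[k ->]; rewrite -expgM mulnC expgM mem_cycle.
  rewrite mulnC exprM exp_cfunE // -lin_charX ?lin_alphaX //.
  by rewrite -(cfResE _ sA2A A2xx) -/phi phi1 !cfun1E A2xx Ax.
have conj_sum (D : {set gT}) (psi : gT -> algC) : \sum_(x in D) psi x = -1 ->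
    \sum_(x in D) (psi x + (psi x)^*) = -2.
  by move=> sum1; rewrite big_split /= sum1 -rmorph_sum /= sum1 rmorphN rmorph1 -opprD.
have nt_alpha : alpha b0 ^+ j != 1.
  by rewrite alphaX_eq1; apply: contra ndvd; apply: dvdn_mull.
have QE : Q = 4 * m%:R + e.
  have := AE b0; rewrite n_even natrM => E.
  have -> : 4 * m%:R = 2 * (2 * m%:R) :> algC by ring.
  by rewrite E; field.
(* Over [A2] and over [A b0] alike the sum is (Q + e) - 2 e = 4 m. With the common value v on
   outside involutions, the average is 2 + v / 2 over K and 1 + v / 2 over [N b0]. *)
have sumA2 : \sum_(x in A2) X b0 j x = 4 * m%:R.
  rewrite sumX // conj_sum; first by rewrite QE; ring.
  rewrite -[RHS](sum_lin_char lin_phi nt_phi); apply: eq_bigr => x /setD1P[_ A2x].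
  by rewrite cfResE.
have sumA : \sum_(x in A b0) X b0 j x = 4 * m%:R.
  by rewrite sumX // conj_sum; [rewrite QE; ring | rewrite sum_lin_char ?lin_alphaX].
rewrite !cfdot_Ind1 ?(subset_trans sKN (sNG b0)) //.
rewrite (sumH K A2) // (sumH (N b0) (A b0)) ?(setIidPr (sAN b0)) // sumA2 sumA oK oA2.
have sub_double k : (2 * k - k = k)%N by rewrite mul2n -addnn addnK.
rewrite cardN n_even !sub_double.
have nzm : m%:R != 0 :> algC by rewrite pnatr_eq0 -lt0n.
by rewrite !natrM; field.
Qed.

Lemma X_schur b j : ~~ (n b %| 2 * j)%N -> exists R1 R2 : QGmodule G,
  '[X b j, mod_char R1] = '[X b j, mod_char R2] + 1.
Proof.
have [->{b}|/negPf ne_b] := eqVneq b b0 => ndvd.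
  have [K sKG multK] := X_mult ndvd.
  by exists (coset_mod G K), (coset_mod G (N b0)); rewrite !coset_mod_char.
have def_b : b = ~~ b0 by move: ne_b; case: (b) (b0) => [] [].
exists (coset_mod G (N b0)), (coset_mod G G).
rewrite (coset_mod_char (sNG b0)) (coset_mod_char (subxx G)) cfInd_id.
have ndvd_j : ~~ (n b %| j)%N by apply: contra ndvd; apply: dvdn_mull.
rewrite cfdot_XG_1 ?lin_alphaX ?alphaX_eq1 // add0r.
by rewrite def_b in ndvd_j *; apply: Xc_mult.
Qed.

(** * Galois orbits and the modules that afford their sums *)

Definition orbit_irr b d : seq 'CF(G) :=
  [seq X b j | j <- J b & gcdn j (n b) == (n b %/ d)%N].

(** Inverse powers of [alpha b] give irreducible characters with nonzero scalar product, hence equal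
    ones. *)
Let X_sym b j k : ~~ (n b %| 2 * j)%N -> (n b %| j + k)%N -> X b j = X b k.
Proof.
move=> ndvdj dvd_jk.
have ndvdk : ~~ (n b %| 2 * k)%N.
  apply: contra ndvdj => dvdk; rewrite -(dvdn_addl _ dvdk) -mulnDr.
  exact: dvdn_mull.
have /irrP[i def_j] := X_irr ndvdj; have /irrP[l def_k] := X_irr ndvdk.
have := cfdot_X b j k; rewrite dvd_jk def_j def_k cfdot_irr.
by case: eqP => [->//|_] /eqP; rewrite /= -natrD eq_sym pnatr_eq0 addn1.
Qed.

(** The automorphism acts on [alpha b ^+ j], whose values are d-th roots of unity, as the k-th
    power; it commutes with induction and fixes the rational [DeltaG]. *)
Let cfAut_X (u : {rmorphism algC -> algC}) b j d k : (n b %| j * d)%N ->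
  (forall z, z ^+ d = 1 -> u z = z ^+ k) -> cfAut u (X b j) = X b (j * k).
Proof.
move=> dvd_n u_exp.
have Delta_u : cfAut u DeltaG = DeltaG.
  by apply/cfunP=> x; rewrite cfunE aut_Crat ?DeltaG_Crat.
have alpha_u : cfAut u (alpha b ^+ j) = alpha b ^+ (j * k).
  apply/cfun_inP=> x Ax; have -> : cfAut u (alpha b ^+ j) x = u ((alpha b ^+ j) x) by rewrite cfunE.
  rewrite u_exp; first by rewrite exprM [RHS](exp_cfunE _ _ Ax).
  rewrite -(exp_cfunE _ _ Ax) -exprM.
  by have /eqP-> : alpha b ^+ (j * d) == 1; rewrite ?alphaX_eq1 // cfun1E Ax.
rewrite /XG cfAutZ raddfB /= cfAutInd Delta_u alpha_u; congr (_ *: _).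
by rewrite /eps; case: (b); rewrite ?rmorphN rmorph1.
Qed.

Section Orbit.
Variables (b : bool) (d : nat).
Hypotheses (d_gt2 : (2 < d)%N) (dvd_dn : (d %| n b)%N).
Let g := (n b %/ d)%N.
Let nE : n b = (d * g)%N. Proof. by rewrite mulnC divnK. Qed.
Let g_gt0 : (0 < g)%N.
Proof. by have := cardG_gt0 (A b); rewrite nE muln_gt0 => /andP[]. Qed.

(** The orbit keeps one index of each pair j, n - j. Doubling restores all exponents prime to d,
    over which rationality is known; d > 2 keeps n / 2 out. *)
Lemma sum_orbit_irr (V : nmodType) (F : 'CF(G) -> V) :
  (\sum_(phi <- orbit_irr b d) F phi) *+ 2
    = \sum_(0 <= k < d | coprime k d) F (X b (k * g)).
Proof.
rewrite big_map big_filter -(sum_gcdn_eq _ (fun j => F (X b j))) // -nE -/g.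
rewrite (sum_half_indices (P := fun j => gcdn j (n b) == g) (F := fun j => F (X b j))) //.
- by rewrite gcd0n nE; move: d_gt2 g_gt0; clear; nia.
- move=> j /andP[j_gt0 lt_jn]; have le_jn := ltnW lt_jn.
  have -> : gcdn (n b - j) (n b) = gcdn j (n b).
    by rewrite -{2 3}(subnK le_jn) gcdnDl gcdnDr gcdnC.
  split=> //; congr F; have [dvd2|ndvd2] := boolP (n b %| 2 * j)%N.
    congr (X b _); move: dvd2 => /dvdnP[c def_2j].
    have c1 : c = 1%N by move: def_2j j_gt0 lt_jn; clear; nia.
    by move: def_2j; rewrite c1; clear; lia.
  apply/esym; apply: X_sym => //; by rewrite subnKC.
move=> j def_n; apply/eqP=> gcd_j.
have def_g : g = j by rewrite -gcd_j -def_n; apply/gcdn_idPl; apply: dvdn_mull.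
by move: d_gt2 g_gt0 def_n; rewrite nE def_g; clear; nia.
Qed.

Let lin_beta := lin_alphaX b g.

Let dvd2g : ~~ (n b %| 2 * g)%N.
Proof. by rewrite nE dvdn_pmul2r // gtnNdvd. Qed.

Lemma orbit_irr_irr : {subset orbit_irr b d <= irr G}.
Proof.
by move=> phi /mapP[j]; rewrite mem_filter => /andP[_ /J_ndvd2 nd ->]; apply: X_irr.
Qed.

Lemma orbit_irr_uniq : uniq (orbit_irr b d).
Proof.
rewrite map_inj_in_uniq ?filter_uniq ?iota_uniq // => j k.
by rewrite !mem_filter => /andP[_ Jj] /andP[_ Jk]; apply: X_inj.
Qed.

Lemma mem_orbit_irr : X b g \in orbit_irr b d.
Proof.
apply: map_f; rewrite mem_filter mem_half_indices ?cardG_gt0 //.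
rewrite [gcdn _ _](gcdn_idPl _) ?eqxx /=; last by rewrite nE dvdn_mull.
by rewrite muln_gt0 g_gt0 nE ltn_pmul2r.
Qed.

(** Multiplicity 1 is established for one member by [X_schur] and carried to the others by field
    automorphisms, which fix the rational character of M. *)
Lemma orbit_module : exists M : QGmodule G, [/\ simple_mod M,
  mod_char M = \sum_(phi <- orbit_irr b d) phi
  & qdim M = (n (~~ b) * totient d)%N].
Proof.
have /irrP[i def_i] := X_irr dvd2g.
have [M simM nzM] := simple_containing_irr i.
have [R1 [R2 multR]] := X_schur dvd2g.
have multM : '[X b g, mod_char M] = 1.
  by rewrite def_i in multR *; apply: simple_mult1 multR.
have deg_orb : {in orbit_irr b d, forall psi : 'CF(G), psi 1%g = Q + eps b}.
  by move=> psi /mapP[j _ ->]; rewrite XG_1 ?lin_alphaX.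
have half_sum (V : lmodType algC) (F : 'CF(G) -> V) :
    \sum_(phi <- orbit_irr b d) F phi = 2^-1 *: \sum_(0 <= k < d | coprime k d) F (X b (k * g)).
  by rewrite -sum_orbit_irr -scaler_nat scalerA mulVf ?scale1r ?pnatr_eq0.
have defM : mod_char M = \sum_(phi <- orbit_irr b d) phi.
  apply: (@simple_char_sum _ _ M _ _ (Q + eps b) simM orbit_irr_uniq orbit_irr_irr mem_orbit_irr) => //.
    move=> x; rewrite (half_sum algC^o (fun phi => phi x)) rpredM ?rpredV ?rpred_nat //.
    under eq_bigr => k _ do rewrite mulnC exprM.
    by apply: sum_XG_Crat => //; apply/eqP; rewrite -exprM alphaX_eq1 nE mulnC.
  move=> psi /mapP[j]; rewrite mem_filter => /andP[/eqP gcd_j Jj] ->.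
  have /dvdnP[k def_j] : (g %| j)%N by rewrite -/g in gcd_j; rewrite -gcd_j dvdn_gcdl.
  have cokd : coprime k d.
    move: gcd_j; rewrite -/g def_j nE -muln_gcdl => /eqP.
    by rewrite -{2}[g]mul1n eqn_pmul2r.
  have [u u_exp] := Qn_aut_exists cokd.
  rewrite def_j mulnC -(cfAut_X _ u_exp); last by rewrite nE mulnC.
  by rewrite -(mod_char_aut u M) cfdot_aut_char ?mod_char_char // multM rmorph1.
exists M; split=> //; apply/eqP; rewrite -(eqr_nat algC) -mod_char1 defM sum_cfunE.
rewrite big_seq (eq_bigr (fun=> Q + eps b)) -?big_seq => [|phi /deg_orb //].
have -> : \sum_(phi <- orbit_irr b d) (Q + eps b) =
    2^-1 * \sum_(0 <= k < d | coprime k d) (Q + eps b).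
  exact: (half_sum algC^o (fun=> Q + eps b)).
have -> : \sum_(0 <= k < d | coprime k d) (Q + eps b) = (Q + eps b) * (totient d)%:R.
  rewrite totient_count_coprime natr_sum mulr_sumr big_mkcond; apply: eq_bigr => k _.
  by rewrite coprime_sym; case: coprime; rewrite ?mulr1 ?mulr0.
rewrite natrM AE mulrA [_^-1 * _]mulrC; apply/eqP; congr (_ / _ * _).
by rewrite /eps; case: (b); rewrite ?opprK.
Qed.

End Orbit.

(** * The labelled list of simple modules *)

Local Notation label := (bool + bool * nat + bool)%type.

Variable sq : bool.
Hypothesis sqP : sq <-> (q %% 4 = 1)%N /\ is_square q.

(* [inl (inl true)] and [inl (inl false)] label the trivial and the Steinberg
   module, [inl (inr (b, d))] the orbit of the characters of order [d] of [A b],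
   and [inr h] the modules built from the half characters, of which there are
   two when [sq] holds and one otherwise. *)
Definition valid_label (l : label) : bool :=
  match l with
  | inl (inl _) => true
  | inl (inr (b, d)) => (2 < d)%N && (d %| n b)%N
  | inr h => sq || ~~ h
  end.

Definition label_dim (l : label) : nat :=
  match l with
  | inl (inl t) => if t then 1%N else q
  | inl (inr (b, d)) => (n (~~ b) * totient d)%N
  | inr _ => if sq then n (~~ b0) else (2 * n (~~ b0))%N
  end.

Definition label_irr i1 i2 (l : label) : seq 'CF(G) :=
  match l with
  | inl (inl t) => [:: if t then 1 else StG]
  | inl (inr (b, d)) => orbit_irr b d
  | inr h => if sq then [:: 'chi_(if h then i2 else i1)] else [:: 'chi_i1; 'chi_i2]
  end.

Let orbit_generic b d phi : phi \in orbit_irr b d ->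
  [/\ phi \in generic_irr, phi != 1 & phi != StG].
Proof.
case/mapP=> j; rewrite mem_filter => /andP[_ Jj ->]; rewrite X_neq1 ?X_neqSt //; split=> //.
rewrite !inE mem_cat; apply/orP; right; apply/orP; right; apply/orP.
by case: (b) Jj => Jj; [left | right]; apply: map_f.
Qed.

Let orbit_inj b c d d' phi : (d %| n b)%N -> (d' %| n c)%N ->
  phi \in orbit_irr b d -> phi \in orbit_irr c d' -> (b, d) = (c, d').
Proof.
move=> dvd_d dvd_d' /mapP[j]; rewrite mem_filter => /andP[/eqP gj Jj ->].
case/mapP=> k; rewrite mem_filter => /andP[/eqP gk Jk] eqX.
have [def_c|ne_bc] := eqVneq c b; last first.
  have def_c : c = ~~ b by move: ne_bc; case: c b {eqX gk gj Jk Jj dvd_d dvd_d'} => [] [].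
  rewrite def_c in eqX Jk.
  have nt : alpha b ^+ j != 1 by rewrite alphaX_eq1 J_ndvd.
  have /eqP := cfdot_XG_compl (lin_alphaX b j) (lin_alphaX (~~ b) k) nt.
  by rewrite -eqX cfdot_X eqxx -natrD pnatr_eq0.
rewrite def_c in eqX Jk gk dvd_d' *; have def_k := X_inj Jj Jk eqX.
move: gk; rewrite -def_k gj => eq_div; congr (_, _).
exact: dvdn_div_inj (cardG_gt0 (A b)) dvd_d dvd_d' eq_div.
Qed.

Let char_GG : mod_char (coset_mod G G) = 1.
Proof. by rewrite coset_mod_char // cfInd_id. Qed.

(** [PG] is 1 + [StG], so [StG] occurs once in the permutation module on the cosets of B and not at
    all in the trivial module. *)
Lemma St_module : exists M : QGmodule G,
  [/\ simple_mod M, mod_char M = \sum_(phi <- [:: StG]) phi & qdim M = q].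
Proof.
have /irrP[i def_i] := StG_irr.
have [M simM nzM] := simple_containing_irr i.
have multM : '[StG, mod_char M] = 1.
  rewrite def_i; apply: (simple_mult1 (R1 := coset_mod G B) (R2 := coset_mod G G)) => //.
  rewrite char_GG coset_mod_char // -def_i cfdot_StG_1 add0r.
  by rewrite -/PG -(subrK 1 PG) -/StG cfdotDr cfnorm_StG cfdot_StG_1 addr0.
have defM : mod_char M = \sum_(phi <- [:: StG]) phi.
  apply: (@simple_char_sum _ _ M _ StG Q) => //.
  - by move=> phi; rewrite inE => /eqP->; apply: StG_irr.
  - by rewrite inE.
  - by move=> phi; rewrite inE => /eqP->; apply: StG_1.
  - move=> x; rewrite big_seq1 /StG; move: (PG_Crat x); move: PG => P Px.
    by rewrite !cfunE rpredB // cfun1E rpred_nat.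
  by move=> phi; rewrite inE => /eqP->.
exists M; split=> //; apply/eqP; rewrite -(eqr_nat algC) -mod_char1 defM big_seq1.
by rewrite StG_1.
Qed.

Section HalfModules.
Variables i1 i2 : Iirr G.
Hypotheses (ne_i12 : i1 != i2) (def_Xh : Xh = 'chi_i1 + 'chi_i2).
Hypotheses (chi_i1_1 : 'chi_i1 1%g = (Q + e) / 2) (chi_i2_1 : 'chi_i2 1%g = (Q + e) / 2).
Hypotheses (uniq_irr : uniq ('chi_i1 :: 'chi_i2 :: generic_irr)).
Hypothesis irrs : forall i, 'chi_i \in 'chi_i1 :: 'chi_i2 :: generic_irr.

Let nin1 : 'chi_i1 \notin generic_irr.
Proof. by move: uniq_irr; rewrite cons_uniq in_cons negb_or -andbA => /and3P[]. Qed.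
Let nin2 : 'chi_i2 \notin generic_irr.
Proof. by move: uniq_irr; rewrite 2!cons_uniq => /and3P[]. Qed.

Let halfE : (Q + e) / 2 = (n (~~ b0))%:R.
Proof. by rewrite AE /eps; case: (b0); rewrite ?opprK. Qed.

Let notin_1 i : 'chi_i \notin generic_irr -> '['chi_i, 1] = 0.
Proof.
rewrite !inE !negb_or => /and3P[ne1 _ _]; rewrite -irr0 cfdot_irr -(inj_eq irr_inj).
by rewrite irr0 (negPf ne1).
Qed.

Lemma half_schur M : simple_mod M -> '['chi_i1, mod_char M] != 0 ->
  '['chi_i1, mod_char M] = 1.
Proof.
move=> simM nzM; apply: (simple_mult1 (R1 := coset_mod G (A (~~ b0))) (R2 := coset_mod G G)) => //.
by rewrite char_GG notin_1 // add0r coset_mod_char // (half_mult ne_i12 def_Xh).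
Qed.

Lemma half_module_split : sq -> exists M : QGmodule G,
  [/\ simple_mod M, mod_char M = \sum_(phi <- [:: 'chi_i1]) phi & qdim M = n (~~ b0)].
Proof.
move=> sqT; have [q1 q_sq] := (sqP.1 sqT).
have [M simM /half_schur multM] := simple_containing_irr i1.
have defM : mod_char M = \sum_(phi <- [:: 'chi_i1]) phi.
  apply: (@simple_char_sum _ _ M _ 'chi_i1 ((Q + e) / 2)) => //.
  - by move=> phi; rewrite inE => /eqP->; apply: mem_irr.
  - by rewrite inE.
  - by move=> phi; rewrite inE => /eqP->.
  - by move=> x; rewrite big_seq1; have [] := half_Crat ne_i12 def_Xh irrs q1 q_sq x.
  by move=> phi; rewrite inE => /eqP->; apply: multM.
exists M; split=> //; apply/eqP; rewrite -(eqr_nat algC) -mod_char1 defM big_seq1.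
by rewrite chi_i1_1 halfE.
Qed.

(** This is [half_schur] with i1 and i2 exchanged; it is supplied once the section is closed. *)
Hypothesis half_mult2 : forall M, simple_mod M -> '['chi_i2, mod_char M] != 0 ->
  '['chi_i2, mod_char M] = 1.

(** A simple module containing only the first half would afford it, against [half_not_Crat]; so it
    contains both. *)
Lemma half_module_nonsplit : ~~ sq -> exists M : QGmodule G,
  [/\ simple_mod M, mod_char M = \sum_(phi <- [:: 'chi_i1; 'chi_i2]) phi
    & qdim M = (2 * n (~~ b0))%N].
Proof.
move=> nsq; have [M simM nzM] := simple_containing_irr i1; have multM := half_schur simM nzM.
have deg12 : {in [:: 'chi_i1; 'chi_i2], forall phi : 'CF(G), phi 1%g = (Q + e) / 2}.
  by move=> phi; rewrite !inE => /orP[]/eqP->.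
have rat12 x : \sum_(phi <- [:: 'chi_i1; 'chi_i2]) phi x \in Crat.
  by rewrite big_cons big_seq1; have := Xh_Crat x; rewrite def_Xh cfunE.
have uniq12 : uniq [:: 'chi_i1; 'chi_i2] by rewrite /= inE (inj_eq irr_inj) ne_i12.
have irr12 : {subset [:: 'chi_i1; 'chi_i2] <= irr G}.
  by move=> phi; rewrite !inE => /orP[]/eqP->; apply: mem_irr.
have ratO x : \sum_(k in [set i1; i2]) 'chi_k 1%g * 'chi_k x \in Crat.
  rewrite big_setU1 ?inE //= big_set1 chi_i1_1 chi_i2_1 -mulrDr halfE.
  by rewrite rpredM ?rpred_nat //; have := rat12 x; rewrite big_cons big_seq1.
have subO j : '['chi_j, mod_char M] != 0 -> j \in [set i1; i2].
  by apply: simple_constt_sub simM ratO _ nzM; rewrite !inE eqxx.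
have nzM2 : '['chi_i2, mod_char M] != 0.
  apply/negP=> /eqP zM2; case: (half_not_Crat ne_i12 def_Xh irrs).
    by move/sqP; apply/negP.
  move=> x; suff <- : mod_char M = 'chi_i1 by apply: mod_char_Crat.
  rewrite [LHS]cfun_sum_cfdot (bigD1 i1) //= big1 => [|j ne_j].
    by rewrite addr0 cfdotC multM rmorph1 scale1r.
  suff -> : '[mod_char M, 'chi_j] = 0 by rewrite scale0r.
  rewrite cfdotC; have [//|/subO] := eqVneq '['chi_j, mod_char M] 0.
    by move->; rewrite rmorph0.
  by rewrite !inE (negPf ne_j) => /eqP->; rewrite zM2 rmorph0.
have multM2 := half_mult2 simM nzM2.
have defM : mod_char M = \sum_(phi <- [:: 'chi_i1; 'chi_i2]) phi.
  apply: (@simple_char_sum _ _ M _ 'chi_i1 _ simM uniq12 irr12 _ deg12 rat12).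
    by rewrite inE eqxx.
  by move=> phi; rewrite !inE => /orP[]/eqP->.
exists M; split=> //; apply/eqP; rewrite -(eqr_nat algC) -mod_char1 defM big_cons big_seq1.
by rewrite cfunE chi_i1_1 chi_i2_1 halfE -natrD addnn mul2n.
Qed.

End HalfModules.

(** Each irreducible character belongs to exactly one list [L l], and [Mod l] affords the sum of
    that list, so comparing constituents matches simple modules with valid labels. *)
Lemma simple_classification : exists Mod : label -> QGmodule G,
  [/\ forall l, valid_label l -> simple_mod (Mod l) /\ qdim (Mod l) = label_dim l,
      forall l l', valid_label l -> valid_label l' -> iso_mod (Mod l) (Mod l') -> l = l',
      forall M, simple_mod M -> exists2 l, valid_label l & iso_mod M (Mod l),
      trivial_mod (Mod (inl (inl true)))
    & steinberg_mod q (Mod (inl (inl false)))].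
Proof.
have [i1 [i2 [ne12 defX deg1 deg2 [uniq12 irrs]]]] := irr_classification.
have ne21 : i2 != i1 by rewrite eq_sym.
have defX' : Xh = 'chi_i2 + 'chi_i1 by rewrite addrC.
have irrs' i : 'chi_i \in 'chi_i2 :: 'chi_i1 :: generic_irr.
  by have := irrs i; rewrite !in_cons orbCA.
have [[nin1 nin2] uniqg] : ('chi_i1 \notin generic_irr /\ 'chi_i2 \notin generic_irr)
    /\ uniq generic_irr.
  move: uniq12; rewrite 2!cons_uniq in_cons negb_or -andbA.
  by case/and4P=> _ -> -> ->.
have uniq21 : uniq ('chi_i2 :: 'chi_i1 :: generic_irr).
  by rewrite 2!cons_uniq in_cons negb_or (inj_eq irr_inj) ne21 nin1 nin2.
pose L := label_irr i1 i2.
(* Invalid labels receive the trivial module as a placeholder, so that choice applies to all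
   labels. *)
have exM l : exists M : QGmodule G, valid_label l ->
    [/\ simple_mod M, mod_char M = \sum_(phi <- L l) phi, qdim M = label_dim l
      & l = inl (inl true) -> trivial_mod M].
  case: l => [[[]|[b d]]|h].
  - exists (trivial_module G) => _.
    have tr1 : trivial_mod (trivial_module G) by [].
    by split=> //; [apply: simple_dim1 | rewrite big_seq1 trivial_mod_char].
  - by have [M [simM defM dM]] := St_module; exists M.
  - have [/andP[d_gt2 dvd_d]|nv] := boolP ((2 < d)%N && (d %| n b)%N).
      by have [M [simM defM dM]] := orbit_module d_gt2 dvd_d; exists M.
    by exists (trivial_module G); rewrite /= (negPf nv).
  have [sqT|nsq] := boolP sq.
    rewrite /L /= sqT; case: h.
      by have [M [simM defM dM]] := half_module_split ne21 defX' deg2 uniq21 irrs' sqT; exists M.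
    by have [M [simM defM dM]] := half_module_split ne12 defX deg1 uniq12 irrs sqT; exists M.
  rewrite /L /= (negPf nsq); case: h; first by exists (trivial_module G).
  have mult2 := half_schur ne21 defX' deg2 uniq21 irrs'.
  by have [M [simM defM dM]] := half_module_nonsplit ne12 defX deg1 deg2 uniq12 irrs mult2 nsq; exists M.
have [Mod ModP] := functional_choice _ exM.
have L_irr l : valid_label l -> uniq (L l) /\ {subset L l <= irr G}.
  have irr1 phi : phi \in irr G -> {subset [:: phi] <= irr G} by move=> iphi psi; rewrite inE => /eqP->.
  case: l => [[t|[b d]]|h] /=.
  - move=> _; split=> //; apply: irr1; case: t; last exact: StG_irr.
    by rewrite -irr0 mem_irr.
  - by case/andP=> d_gt2 dvd_d; split; [apply: orbit_irr_uniq | apply: orbit_irr_irr].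
  rewrite /L /=; case: (sq) => _; first by split=> //; apply: irr1; apply: mem_irr.
  split; first by rewrite /= inE (inj_eq irr_inj) ne12.
  by move=> phi; rewrite !inE => /orP[]/eqP->; apply: mem_irr.
have L_cfdot l i : valid_label l -> '['chi_i, mod_char (Mod l)] = ('chi_i \in L l)%:R.
  move=> vl; have [uL iL] := L_irr l vl; have [_ -> _ _] := ModP l vl.
  rewrite cfdot_sumr (big_irr_seq (fun phi => '['chi_i, phi])) //.
  have [Li|nLi] := boolP ('chi_i \in L l).
    rewrite (bigD1 i) //= cfnorm_irr big1 ?addr0 // => k /andP[_ ne_k].
    by rewrite cfdot_irr eq_sym (negPf ne_k).
  rewrite big1 // => k Lk; rewrite cfdot_irr; case: eqP => // eq_ik.
  by rewrite eq_ik Lk in nLi.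
have cover i : exists2 l, valid_label l & 'chi_i \in L l.
  have := irrs i; rewrite in_cons => /predU1P[->|].
    exists (inr false); first by rewrite /= orbT.
    by rewrite /L /=; case: (sq); rewrite !inE eqxx.
  rewrite in_cons => /predU1P[->|].
    (* The second half has its own label [inr true] when [sq] holds, and shares [inr false] with the
       first half otherwise. *)
    exists (inr sq); first by rewrite /=; case: (sq).
    by rewrite /L /=; case: (sq); rewrite !inE eqxx ?orbT.
  rewrite in_cons => /predU1P[->|]; first by exists (inl (inl true)); rewrite // inE.
  rewrite in_cons => /predU1P[->|]; first by exists (inl (inl false)); rewrite // inE.
  have XL b j : j \in J b -> exists2 l, valid_label l & X b j \in L l.
    move=> Jj; have [d_gt2 dvd_d def_g] := half_index_order (mem_J Jj).
    exists (inl (inr (b, (n b %/ gcdn j (n b))%N))); first by rewrite /= d_gt2.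
    by apply: map_f; rewrite mem_filter -def_g eqxx.
  by rewrite mem_cat => /orP[] /mapP[j Jj ->]; apply: XL.
have disj l l' phi : valid_label l -> valid_label l' -> phi \in L l -> phi \in L l' -> l = l'.
  have half_gen h : phi \in L (inr h) -> phi \notin generic_irr.
    rewrite /L /=; case: (sq); first by rewrite inE => /eqP->; case: (h).
    by rewrite !inE => /orP[]/eqP->.
  have small_gen t : phi \in L (inl (inl t)) -> phi \in generic_irr.
    by rewrite inE => /eqP->; rewrite !inE; case: (t); rewrite eqxx ?orbT.
  have small_orb t bd : phi \in L (inl (inl t)) -> phi \in L (inl (inr bd)) -> False.
    rewrite inE => /eqP-> ; case: bd => b d /orbit_generic[_].
    by case: (t); rewrite eqxx.
  case: l l' => [[t|[b d]]|h] [[t'|[b' d']]|h'].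
  - move=> _ _; rewrite !inE => /eqP-> /eqP; case: (t) (t') => [] [] //.
      by move/esym=> E; have := cfdot_StG_1; rewrite E cfnorm1 => /eqP; rewrite oner_eq0.
    by move=> E; have := cfdot_StG_1; rewrite E cfnorm1 => /eqP; rewrite oner_eq0.
  - by move=> _ _ Lt /(small_orb _ _ Lt).
  - by move=> _ _ /small_gen gphi /half_gen/negP.
  - by move=> _ _ Lbd /small_orb/(_ Lbd).
  - move=> /andP[_ dvd_d] /andP[_ dvd_d'] Lbd Lbd'.
    by rewrite (orbit_inj dvd_d dvd_d' Lbd Lbd').
  - by move=> _ _ /orbit_generic[gphi _ _] /half_gen/negP.
  - by move=> _ _ /half_gen/negP ngphi /small_gen.
  - by move=> _ _ /half_gen/negP ngphi /orbit_generic[].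
  rewrite /L /=; case: (sq) => /=; last by case: (h) (h') => [] [].
  rewrite !inE => _ _ /eqP-> /eqP/irr_inj; case: (h) (h') => [] [] // /eqP.
    by rewrite (negPf ne21).
  by rewrite (negPf ne12).
have L_nonempty l : valid_label l -> exists i, 'chi_i \in L l.
  move=> vl; have [_ iL] := L_irr l vl.
  suff [phi Lphi] : exists phi, phi \in L l.
    by have /irrP[i def_i] := iL _ Lphi; exists i; rewrite -def_i.
  case: l vl {iL} => [[t|[b d]]|h] /=.
  - by move=> _; eexists; rewrite inE.
  - by case/andP=> d_gt2 dvd_d; eexists; apply: mem_orbit_irr.
  by move=> _; rewrite /L /=; case: (sq); eexists; apply: mem_head.
exists Mod; split.
- by move=> l /ModP[].
- move=> l l' vl vl' iso; have [i Li] := L_nonempty l vl.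
  apply: (disj _ _ 'chi_i) => //; apply/negP=> nLi.
  have := L_cfdot l' i vl'; rewrite -(iso_mod_char iso) L_cfdot // Li.
  by case: ('chi_i \in L l') nLi => // _ /eqP; rewrite oner_eq0.
- move=> M simM.
  have [i Mi] : exists i, '['chi_i, mod_char M] != 0.
    have : mod_char M != 0.
      apply/eqP=> M0; have := mod_char1 M; rewrite M0 cfunE => /esym/eqP.
      by rewrite pnatr_eq0; have /mx_irrP[/gtn_eqF->] := simM.
    case/neq0_has_constt=> i; rewrite irr_consttE => Mi; exists i.
    by rewrite cfdotC fmorph_eq0.
  have [l vl Li] := cover i; exists l => //; have [simMl _ _ _] := ModP l vl.
  by apply: simple_common_constt Mi _ => //; rewrite L_cfdot // Li oner_eq0.
- by have [_ _ _ trT] := ModP (inl (inl true)) isT; apply: trT.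
have [simS defS _ _] := ModP (inl (inl false)) isT.
by split=> //; rewrite /steinberg_char defS big_seq1 StG_1 StG_irr.
Qed.

End Halves.

End AbstractPSL2.

(** * The subgroups of PSL_2(q) *)

Lemma coset_conj (gT : finGroupType) (H : {set gT}) x y :
  x \in 'N(H) -> y \in 'N(H) -> (coset H x ^ coset H y = coset H (x ^ y))%g.
Proof. by move=> Nx Ny; rewrite morphJ. Qed.

(** * Entries of 2 by 2 matrices and the order of SL_2(q) *)

Section ConcretePSL2.
Variable F : finFieldType.
Local Notation q := #|F|.
Local Notation GL := {'GL_2[F]}.
Implicit Types (g x y u : GL) (a b c d t : F).

Definition c00 g : F := GLval g 0 0.
Definition c01 g : F := GLval g 0 1.
Definition c10 g : F := GLval g 1 0.
Definition c11 g : F := GLval g 1 1.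

Let ord2 (i : 'I_2) : i = 0 \/ i = 1.
Proof. by case: i => [[|[|//]]] i2; [left | right]; apply: val_inj. Qed.

Lemma GL2_inj x y : c00 x = c00 y -> c01 x = c01 y -> c10 x = c10 y ->
  c11 x = c11 y -> x = y.
Proof.
move=> e00 e01 e10 e11; apply/val_inj/matrixP=> i j.
by case: (ord2 i) (ord2 j) => -> [] ->.
Qed.

Lemma GL2M x y :
  (c00 (x * y)%g = c00 x * c00 y + c01 x * c10 y) *
  (c01 (x * y)%g = c00 x * c01 y + c01 x * c11 y) *
  (c10 (x * y)%g = c10 x * c00 y + c11 x * c10 y) *
  (c11 (x * y)%g = c10 x * c01 y + c11 x * c11 y).
Proof.
have l0 : lift ord0 (ord0 : 'I_1) = 1 by apply: val_inj.
by do !split; rewrite /c00 /c01 /c10 /c11 GL_MxE mxE big_ord_recl big_ord1 ?l0.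
Qed.

Lemma GL2_1 : (c00 1%g = 1) * (c01 1%g = 0) * (c10 1%g = 0) * (c11 1%g = 1).
Proof. by do !split; rewrite /c00 /c01 /c10 /c11 GL_1E mxE. Qed.

Lemma det_mx22 (M : 'M[F]_2) : \det M = M 0 0 * M 1 1 - M 0 1 * M 1 0.
Proof.
have l0 : lift 0 (0 : 'I_1) = 1 :> 'I_2 by apply: val_inj.
have l1 : lift 1 (0 : 'I_1) = 0 :> 'I_2 by apply: val_inj.
rewrite (expand_det_row _ 0) big_ord_recl big_ord1 /cofactor !det_mx11 !mxE l0 l1.
by rewrite /= expr0 expr1; ring.
Qed.

Local Notation det2 g := (c00 g * c11 g - c01 g * c10 g).

Lemma det2M x y : det2 (x * y)%g = det2 x * det2 y.
Proof. by rewrite !GL2M; ring. Qed.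

Lemma SL2E g : (g \in SL2 F) = (det2 g == 1).
Proof. by rewrite inE (det_mx22 (GLval g)). Qed.

(** Singular entries fall back on the identity matrix, hence the determinant condition in [mkE]. *)
Definition mk a b c d : GL := insubd (1%g : GL)
  (\matrix_(i, j) (if i == 0 then if j == 0 then a else b else if j == 0 then c else d)
    : 'M[F]_2).

Lemma mkE a b c d : a * d - b * c != 0 ->
  [/\ c00 (mk a b c d) = a, c01 (mk a b c d) = b, c10 (mk a b c d) = c
    & c11 (mk a b c d) = d].
Proof.
move=> nz; rewrite /c00 /c01 /c10 /c11 /mk val_insubd.
set M := (\matrix_(i, j) _).
have -> : M \is a GRing.unit.
  by rewrite -[_ \is a _]/(M \in unitmx) unitmxE det_mx22 !mxE /= unitfE.
by rewrite !mxE.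
Qed.

(** Every invertible matrix is uniquely diag(t, 1) times a matrix of determinant 1, with t its
    determinant, so #|GL_2| = (q - 1) #|SL_2|. *)
Lemma card_SL2 : #|SL2 F| = (q.-1 * q * q.+1)%N.
Proof.
pose f (p : F * GL) := (mk p.1 0 0 1%R * p.2)%g.
pose D := [set p : F * GL | (p.1 != 0) && (p.2 \in SL2 F)].
have cD : #|D| = (q.-1 * #|SL2 F|)%N.
  have -> : D = setX [set~ 0] (SL2 F) by apply/setP=> [[t g]]; rewrite !inE.
  by rewrite cardsX cardsC1.
have mkt t : t != 0 -> [/\ c00 (mk t 0 0 1) = t, c01 (mk t 0 0 1) = 0,
   c10 (mk t 0 0 1) = 0 & c11 (mk t 0 0 1) = 1].
  by move=> nzt; apply: mkE; rewrite mulr1 mulr0 subr0.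
have det_t t : t != 0 -> det2 (mk t 0 0 1) = t.
  by move/mkt=> [e00 e01 e10 e11]; rewrite e00 e01 e10 e11; ring.
have det_f p : p \in D -> det2 (f p) = p.1.
  case: p => t g; rewrite inE /= SL2E => /andP[nzt /eqP dg].
  by rewrite /f det2M det_t //= dg mulr1.
have inj_f : {in D &, injective f}.
  move=> p p' Dp Dp' eqf; have eqt := det_f p Dp; rewrite eqf det_f // in eqt.
  case: p p' {Dp Dp'} eqf eqt => t g [t' g'] /= eqf eqt; rewrite /f eqt /= in eqf.
  by rewrite eqt (mulgI _ _ _ eqf).
have im_f : f @: D = [set: GL].
  apply/setP=> g; rewrite inE; apply/imsetP.
  have nz : det2 g != 0 by have := GL_det g; rewrite (det_mx22 (GLval g)).
  exists (det2 g, (mk (det2 g) 0 0 1%R)^-1 * g)%g; last by rewrite /f /= mulKVg.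
  rewrite inE nz SL2E /= -(inj_eq (mulfI nz)) mulr1.
  by rewrite -{1}(det_t _ nz) -det2M mulKVg.
have := card_in_imset inj_f; rewrite im_f cD.
have -> : #|[set: GL]| = (q * q.-1 ^ 2 * q.+1)%N by rewrite -card_GL_2.
have q1_gt0 : (0 < q.-1)%N by rewrite -subn1 subn_gt0 finRing_gt1.
move=> E; apply/eqP; rewrite -(eqn_pmul2l q1_gt0) -E; apply/eqP.
by rewrite -mulnn; lia.
Qed.

End ConcretePSL2.

Definition torus_order (q : nat) (b : bool) : nat := if b then q.-1./2 else q.+1./2.

(** [psl2_label] and [psl2_dim] restate [valid_label] and [label_dim] with numbers in place of the
    orders of the tori. *)
Definition psl2_label (q : nat) (sq : bool) (l : bool + bool * nat + bool) : bool :=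
  match l with
  | inl (inl _) => true
  | inl (inr (b, d)) => (2 < d)%N && (d %| torus_order q b)%N
  | inr h => sq || ~~ h
  end.

Definition psl2_dim (q : nat) (b0 sq : bool) (l : bool + bool * nat + bool) : nat :=
  match l with
  | inl (inl true) => 1
  | inl (inl false) => q
  | inl (inr (b, d)) => torus_order q (~~ b) * totient d
  | inr _ => if sq then torus_order q (~~ b0) else 2 * torus_order q (~~ b0)
  end.

(* Matrices enter only through their entries: working in an abstract group keeps
   unification from unfolding the concrete group of invertible matrices. *)
Section SpecialLinearGroup.
Variables (F : finFieldType) (gT : finGroupType) (S : {group gT}).
Variables (c00 c01 c10 c11 : gT -> F) (mk : F -> F -> F -> F -> gT).
Implicit Types (g x y u : gT) (a b c d t : F).
Local Notation q := #|F|.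
Local Notation Z := ('Z(S))%g.

Hypothesis GL2_inj : forall x y, c00 x = c00 y -> c01 x = c01 y ->
  c10 x = c10 y -> c11 x = c11 y -> x = y.
Hypothesis GL2M : forall x y,
  (c00 (x * y)%g = c00 x * c00 y + c01 x * c10 y) *
  (c01 (x * y)%g = c00 x * c01 y + c01 x * c11 y) *
  (c10 (x * y)%g = c10 x * c00 y + c11 x * c10 y) *
  (c11 (x * y)%g = c10 x * c01 y + c11 x * c11 y).
Hypothesis GL2_1 :
  (c00 1%g = 1) * (c01 1%g = 0) * (c10 1%g = 0) * (c11 1%g = 1).
Hypothesis mkE : forall a b c d, a * d - b * c != 0 ->
  [/\ c00 (mk a b c d) = a, c01 (mk a b c d) = b, c10 (mk a b c d) = c
    & c11 (mk a b c d) = d].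
Hypothesis SL2E : forall g, (g \in S) = (c00 g * c11 g - c01 g * c10 g == 1).

Lemma mk_SL2 a b c d : a * d - b * c = 1 -> mk a b c d \in S.
Proof.
move=> d1; have nz : a * d - b * c != 0 by rewrite d1 oner_neq0.
by have [e00 e01 e10 e11] := mkE nz; rewrite SL2E e00 e01 e10 e11 d1.
Qed.

Hypothesis nz2 : 2 != 0 :> F.

Let nz11 : -1 != 1 :> F.
Proof. by rewrite -subr_eq0 -opprD oppr_eq0 -[1 + 1]/(2 : F). Qed.

Let sqr1 a : a ^+ 2 = 1 -> a = 1 \/ a = -1.
Proof. by move/eqP; rewrite sqrf_eq1 => /orP[]/eqP; [left | right]. Qed.

Definition upper : gT := mk 1 1 0 1.
Definition lower : gT := mk 1 0 1 1.

Let upperE : [/\ c00 upper = 1, c01 upper = 1, c10 upper = 0 & c11 upper = 1].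
Proof. by apply: mkE; rewrite mulr0 subr0 mulr1 oner_neq0. Qed.
Let lowerE : [/\ c00 lower = 1, c01 lower = 0, c10 lower = 1 & c11 lower = 1].
Proof. by apply: mkE; rewrite mul0r subr0 mulr1 oner_neq0. Qed.
Let upper_SL : upper \in S.
Proof. by apply: mk_SL2; ring. Qed.
Let lower_SL : lower \in S.
Proof. by apply: mk_SL2; ring. Qed.

(** Commuting with the two elementary matrices [upper] and [lower] already forces a matrix to be
    scalar. *)
Lemma center_SL2 z : (z \in Z) = [&& z \in S, c01 z == 0, c10 z == 0 & c00 z == c11 z].
Proof.
apply/idP/and4P=> [/centerP[Sz cz]|[Sz /eqP z01 /eqP z10 /eqP z00]].
  have [u00 u01 u10 u11] := upperE; have [l00 l01 l10 l11] := lowerE.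
  have cu := cz _ upper_SL; have cl := cz _ lower_SL.
  have := congr1 c00 cu; rewrite !GL2M ?u00 ?u01 ?u10 ?u11 => e1.
  have := congr1 c01 cu; rewrite !GL2M ?u00 ?u01 ?u10 ?u11 => e2.
  have := congr1 c00 cl; rewrite !GL2M ?l00 ?l01 ?l10 ?l11 => e3.
  have z10 : c10 z = 0 by move: e1; rewrite !mulr1 !mulr0 !mul1r addr0 -{1}[c00 z]addr0 => /addrI.
  have z01 : c01 z = 0 by move: e3; rewrite !mulr1 !mul1r !mul0r addr0 -{2}[c00 z]addr0 => /addrI.
  split; rewrite ?z01 ?z10 //; apply/eqP.
  by move: e2; rewrite z01 !mulr1 !mul1r add0r addr0.
apply/centerP; split=> // g Sg; apply: GL2_inj; rewrite !GL2M ?z01 ?z10 ?z00; ring.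
Qed.

Lemma center_SL2_diag z : z \in Z -> c00 z = 1 \/ c00 z = -1.
Proof.
rewrite center_SL2 SL2E => /and4P[/eqP d /eqP z01 /eqP z10 /eqP z11].
by move: d; rewrite z01 z10 -z11 mulr0 subr0 -expr2; apply: sqr1.
Qed.

Lemma card_center_SL2 : #|Z| = 2%N.
Proof.
pose z : gT := mk (-1) 0 0 (-1).
have zE : [/\ c00 z = -1, c01 z = 0, c10 z = 0 & c11 z = -1].
  by apply: mkE; rewrite mulr0 subr0 mulrNN mulr1 oner_neq0.
have [z00 z01 z10 z11] := zE.
have -> : Z = [set 1%g; z].
  apply/setP=> x; rewrite in_set2; apply/idP/orP=> [Zx|[]/eqP->].
  - have := Zx; rewrite center_SL2 => /and4P[_ /eqP x01 /eqP x10 /eqP x11].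
    have [x00|x00] := center_SL2_diag Zx; [left | right]; apply/eqP/GL2_inj;
      by rewrite ?GL2_1 ?z00 ?z01 ?z10 ?z11 -?x11 ?x00.
  - exact: group1.
  rewrite center_SL2 z00 z01 z10 z11 !eqxx !andbT SL2E z00 z01 z10 z11.
  by rewrite mulr0 subr0 mulrNN mulr1.
rewrite cards2; case: eqP => // /(congr1 c00); rewrite z00 GL2_1 => /esym/eqP.
by rewrite (negPf nz11).
Qed.

Let nZS : S \subset 'N(Z).
Proof. exact: normal_norm (center_normal S). Qed.

Section Quotient.
Variable H : {group gT}.
Hypotheses (sZH : Z \subset H) (sHS : H \subset S).

Let nsZH : Z <| H.
Proof. by apply: normalS (center_normal S). Qed.

Lemma mem_quotient_center g : g \in S -> (coset Z g \in H / Z)%g = (g \in H).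
Proof.
move=> Sg; have NZg : g \in 'N(Z) := subsetP nZS g Sg.
by rewrite -[in RHS](quotientGK nsZH) morphpreE inE NZg inE.
Qed.

Lemma card_quotient_center : (2 * #|(H / Z)%g|)%N = #|H|.
Proof.
by rewrite card_quotient ?normal_norm // -[RHS](Lagrange sZH) card_center_SL2.
Qed.

End Quotient.

Lemma PSL2P (x : coset_of Z) : reflect (exists2 g, g \in S & x = coset Z g) (x \in (S / Z)%g).
Proof.
apply: (iffP idP) => [/morphimP[g _ Sg ->]|[g Sg ->]]; first by exists g.
exact: mem_quotient.
Qed.

Lemma quotient_centerP (H : {group gT}) (x : coset_of Z) : H \subset S ->
  x \in (H / Z)%g -> exists2 g, g \in H & x = coset Z g.
Proof. by move=> _ /morphimP[g _ Hg ->]; exists g. Qed.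

Lemma coset_centerJ g h : g \in S -> h \in S ->
  (coset Z g ^ coset Z h = coset Z (g ^ h))%g.
Proof.
move=> Sg Sh; have Ng := subsetP nZS _ Sg.
have Nh := subsetP nZS _ Sh.
by rewrite coset_conj.
Qed.

(** * Full preimages in SL_2(q) of the unipotent, Borel and torus subgroups *)

Definition Uset := [set g in S | (c10 g == 0) && (c00 g == c11 g)].
Definition Bset := [set g in S | c10 g == 0].
(* The matrices a + b J of determinant 1, where J = [[0, d], [1, 0]] has square
   d: a torus, split exactly when [d] is a nonzero square. *)
Definition Aset d := [set g in S | (c00 g == c11 g) && (c01 g == d * c10 g)].
(** The second alternative describes the matrices that anticommute with J, so conjugation by them
    sends a + b J to its inverse a - b J. *)
Definition Nset d := [set g in S | (c00 g == c11 g) && (c01 g == d * c10 g)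
                                || (c00 g == - c11 g) && (c01 g == - (d * c10 g))].

Lemma UsetE g : (g \in Uset) = [&& g \in S, c10 g == 0 & c00 g == c11 g].
Proof. by rewrite [LHS]in_set. Qed.
Lemma BsetE g : (g \in Bset) = (g \in S) && (c10 g == 0).
Proof. by rewrite [LHS]in_set. Qed.
Lemma AsetE d g : (g \in Aset d) = [&& g \in S, c00 g == c11 g & c01 g == d * c10 g].
Proof. by rewrite [LHS]in_set. Qed.
Lemma NsetE d g : (g \in Nset d) = (g \in S) &&
  ((c00 g == c11 g) && (c01 g == d * c10 g)
    || (c00 g == - c11 g) && (c01 g == - (d * c10 g))).
Proof. by rewrite [LHS]in_set. Qed.

Let S1 : 1%g \in S. Proof. exact: group1. Qed.

Lemma Uset_group : group_set Uset.
Proof.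
apply/group_setP; split=> [|x y]; first by rewrite UsetE S1 !GL2_1 !eqxx.
rewrite !UsetE => /and3P[Sx /eqP x10 /eqP x00] /and3P[Sy /eqP y10 /eqP y00].
by rewrite groupM // !GL2M x10 y10 x00 y00 !(mul0r, mulr0) !(add0r, addr0) !eqxx.
Qed.
Canonical Ugroup := Group Uset_group.

Lemma Bset_group : group_set Bset.
Proof.
apply/group_setP; split=> [|x y]; first by rewrite BsetE S1 !GL2_1 !eqxx.
rewrite !BsetE => /andP[Sx /eqP x10] /andP[Sy /eqP y10].
by rewrite groupM // !GL2M x10 y10 !(mul0r, mulr0) !(add0r, addr0) !eqxx.
Qed.
Canonical Bgroup := Group Bset_group.

Lemma Aset_group d : group_set (Aset d).
Proof.
apply/group_setP; split=> [|x y]; first by rewrite AsetE S1 !GL2_1 mulr0 !eqxx.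
rewrite !AsetE => /and3P[Sx /eqP x00 /eqP x01] /and3P[Sy /eqP y00 /eqP y01].
rewrite groupM // !GL2M x01 y01 x00 y00 /=.
by apply/andP; split; apply/eqP; ring.
Qed.
Canonical Agroup d := Group (Aset_group d).

Lemma Nset_group d : group_set (Nset d).
Proof.
apply/group_setP; split=> [|x y]; first by rewrite NsetE S1 !GL2_1 mulr0 !eqxx.
rewrite !NsetE => /andP[Sx Nx] /andP[Sy Ny]; rewrite groupM // !GL2M /=.
case/orP: Nx => /andP[/eqP-> /eqP->]; case/orP: Ny => /andP[/eqP-> /eqP->].
- by apply/orP; left; apply/andP; split; apply/eqP; ring.
- by apply/orP; right; apply/andP; split; apply/eqP; ring.
- by apply/orP; right; apply/andP; split; apply/eqP; ring.
by apply/orP; left; apply/andP; split; apply/eqP; ring.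
Qed.
Canonical Ngroup d := Group (Nset_group d).

Lemma U_sub_S : Uset \subset S.
Proof. by apply/subsetP=> g; rewrite UsetE => /andP[]. Qed.
Lemma B_sub_S : Bset \subset S.
Proof. by apply/subsetP=> g; rewrite BsetE => /andP[]. Qed.
Lemma N_sub_S d : Nset d \subset S.
Proof. by apply/subsetP=> g; rewrite NsetE => /andP[]. Qed.

Lemma center_sub_U : Z \subset Uset.
Proof. by apply/subsetP=> z; rewrite center_SL2 UsetE => /and4P[-> _ -> ->]. Qed.
Lemma center_sub_B : Z \subset Bset.
Proof. by apply/subsetP=> z; rewrite center_SL2 BsetE => /and4P[-> _ -> _]. Qed.
Lemma center_sub_A d : Z \subset Aset d.
Proof.
apply/subsetP=> z; rewrite center_SL2 AsetE => /and4P[-> /eqP-> /eqP-> ->].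
by rewrite mulr0 eqxx.
Qed.
Lemma A_sub_N d : Aset d \subset Nset d.
Proof. by apply/subsetP=> g; rewrite AsetE NsetE => /andP[-> ->]. Qed.
Lemma U_sub_B : Uset \subset Bset.
Proof. by apply/subsetP=> g; rewrite UsetE BsetE => /and3P[-> -> _]. Qed.

Let detS g : g \in S -> c00 g * c11 g - c01 g * c10 g = 1.
Proof. by rewrite SL2E => /eqP. Qed.

Lemma card_Bset : #|Bset| = (q * q.-1)%N.
Proof.
pose f (p : F * F) := mk p.1 p.2 0 p.1^-1.
have fE p : p.1 != 0 -> [/\ c00 (f p) = p.1, c01 (f p) = p.2, c10 (f p) = 0 & c11 (f p) = p.1^-1].
  by move=> nz; apply: mkE; rewrite mulr0 subr0 mulfV ?oner_neq0.
pose D := setX [set~ (0 : F)] [set: F].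
have -> : Bset = f @: D.
  apply/setP=> g; apply/idP/imsetP=> [|[[a b]]].
    rewrite BsetE => /andP[Sg /eqP g10]; exists (c00 g, c01 g).
      rewrite !inE andbT /=; apply/eqP=> g00; have := detS Sg.
      by rewrite g00 g10 mul0r mulr0 subr0 => /eqP; rewrite eq_sym oner_eq0.
    have d1 := detS Sg; rewrite g10 mulr0 subr0 in d1.
    have nz : c00 g != 0 by apply/eqP=> z; move: d1; rewrite z mul0r => /eqP; rewrite eq_sym oner_eq0.
    have [e00 e01 e10 e11] := fE (c00 g, c01 g) nz.
    by apply: GL2_inj; rewrite ?e00 ?e01 ?e10 ?e11 //=; apply: (mulfI nz); rewrite d1 mulfV.
  case/setXP; rewrite in_setC1 => nz _ ->; have [e00 e01 e10 e11] := fE (a, b) nz.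
  by rewrite BsetE SL2E e00 e01 e10 e11 /= mulfV // mulr0 subr0 !eqxx.
rewrite card_in_imset => [|[a b] [a' b']]; first by rewrite cardsX cardsC1 cardsT mulnC.
case/setXP; rewrite in_setC1 => nz _ /setXP[]; rewrite in_setC1 => nz' _ eqf.
have [e00 e01 _ _] := fE (a, b) nz; have [e00' e01' _ _] := fE (a', b') nz'.
by congr (_, _); [rewrite -[a]e00 eqf e00' | rewrite -[b]e01 eqf e01'].
Qed.

(** Determinant 1 makes the repeated diagonal entry 1 or -1: the factor 2 is the center. *)
Lemma card_Uset : #|Uset| = (2 * q)%N.
Proof.
pose f (p : F * F) := mk p.1 p.2 0 p.1.
have fE p : p.1 != 0 -> [/\ c00 (f p) = p.1, c01 (f p) = p.2, c10 (f p) = 0 & c11 (f p) = p.1].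
  by move=> nz; apply: mkE; rewrite mulr0 subr0 mulf_neq0.
pose D := setX [set (1 : F); -1] [set: F].
have nzD a : a \in [set (1 : F); -1] -> a != 0 /\ a * a = 1.
  by case/set2P=> ->; rewrite ?oppr_eq0 oner_neq0 ?mulrNN mulr1.
have -> : Uset = f @: D.
  apply/setP=> g; apply/idP/imsetP=> [|[[a b]]].
    rewrite UsetE => /and3P[Sg /eqP g10 /eqP g11]; exists (c00 g, c01 g).
      have := detS Sg; rewrite g10 -g11 mulr0 subr0 -expr2 => /sqr1 g00.
      by rewrite !inE andbT /=; case: g00 => ->; rewrite eqxx ?orbT.
    have d1 := detS Sg; rewrite g10 -g11 mulr0 subr0 in d1.
    have nz : c00 g != 0 by apply/eqP=> z; move: d1; rewrite z mul0r => /eqP; rewrite eq_sym oner_eq0.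
    have [e00 e01 e10 e11] := fE (c00 g, c01 g) nz.
    by apply: GL2_inj; rewrite ?e00 ?e01 ?e10 ?e11.
  case/setXP=> /nzD[nz aa] _ ->; have [e00 e01 e10 e11] := fE (a, b) nz.
  by rewrite UsetE SL2E e00 e01 e10 e11 /= aa mulr0 subr0 !eqxx.
rewrite card_in_imset => [|[a b] [a' b']].
  by rewrite cardsX cardsT cards2 eq_sym nz11.
case/setXP=> Da _ /setXP[Da' _] eqf.
have [[nz _] [nz' _]] := (nzD a Da, nzD a' Da').
have [e00 e01 _ _] := fE (a, b) nz; have [e00' e01' _ _] := fE (a', b') nz'.
by congr (_, _); [rewrite -[a]e00 eqf e00' | rewrite -[b]e01 eqf e01'].
Qed.

(** * Orders of the tori by counting points on a conic *)

Definition conic d := [set p : F * F | p.1 ^+ 2 - d * p.2 ^+ 2 == 1].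

Lemma conicE d p : (p \in conic d) = (p.1 ^+ 2 - d * p.2 ^+ 2 == 1).
Proof. by rewrite [LHS]in_set. Qed.

Lemma card_Aset_conic d : #|Aset d| = #|conic d|.
Proof.
pose h g := (c00 g, c10 g).
have inj_h : {in Aset d &, injective h}.
  move=> x y; rewrite !AsetE => /and3P[_ /eqP x00 /eqP x01] /and3P[_ /eqP y00 /eqP y01] [e00 e10].
  by apply: GL2_inj; rewrite -?x00 -?y00 ?x01 ?y01 ?e10.
rewrite -(card_in_imset inj_h); apply: eq_card => [[a b]].
apply/imsetP/idP=> [[g + [-> ->]]|].
  rewrite AsetE conicE /= => /and3P[/detS d1 /eqP x00 /eqP x01].
  by rewrite -[X in _ == X]d1 -x00 x01; apply/eqP; ring.
rewrite conicE /= => /eqP ab1; have d1 : a * a - (d * b) * b = 1 by rewrite -ab1; ring.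
have nz : a * a - (d * b) * b != 0 by rewrite d1 oner_neq0.
have [e00 e01 e10 e11] := mkE nz.
exists (mk a (d * b) b a); last by rewrite /h e00 e10.
by rewrite AsetE mk_SL2 // e00 e01 e10 e11 !eqxx.
Qed.

(* The lines through the point (-1, 0) parametrize the conic. *)
Lemma card_conic d : d != 0 ->
  (#|conic d| + #|[set m : F | (d * m ^+ 2 == 1)%R]| = q.+1)%N.
Proof.
(* [D] holds the slopes of lines that meet the conic only in (-1, 0); the point (-1, 0) itself has
   no slope, which accounts for the q + 1. *)
move=> nzd; set D := [set m : F | _].
pose f (m : F) := ((1 + d * m ^+ 2) / (1 - d * m ^+ 2), 2 * m / (1 - d * m ^+ 2)).
have nzD m : (m \in ~: D) = (1 - d * m ^+ 2 != 0).
  by rewrite !inE eq_sym subr_eq0.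
have fK m : m \in ~: D -> m = (f m).2 / ((f m).1 + 1).
  rewrite nzD /f /= => nz; field; rewrite nz /=.
  have -> : 1 + d * m ^+ 2 + (1 - d * m ^+ 2) = 2 by ring.
  by [].
have defP : conic d :\ (-1, 0) = f @: (~: D).
  apply/setP=> [[a b]]; apply/idP/imsetP=> [|[m Dm [-> ->]]].
    rewrite in_setD1 conicE /= => /andP[ne /eqP ab1].
    have db : d * b ^+ 2 = a ^+ 2 - 1 by rewrite -ab1; ring.
    have nza : a + 1 != 0.
      apply: contraNneq ne => /eqP; rewrite addr_eq0 => /eqP a1.
      move/eqP: db; rewrite a1 sqrrN expr1n subrr mulf_eq0 (negPf nzd) sqrf_eq0 /=.
      by move/eqP->.
    have key : 1 - d * (b / (a + 1)) ^+ 2 = 2 / (a + 1).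
      have -> : 1 - d * (b / (a + 1)) ^+ 2 = ((a + 1) ^+ 2 - d * b ^+ 2) / (a + 1) ^+ 2 by field.
      by rewrite db; field.
    have nzk : 2 / (a + 1) != 0 by rewrite mulf_neq0 ?invr_eq0.
    exists (b / (a + 1)); first by rewrite nzD key.
    have key2 : 1 + d * (b / (a + 1)) ^+ 2 = 2 * a / (a + 1).
      have -> : 1 + d * (b / (a + 1)) ^+ 2 = 2 - (1 - d * (b / (a + 1)) ^+ 2) by ring.
      by rewrite key; field.
    by rewrite /f key key2; congr (_, _); field; rewrite nz2 nza.
  rewrite nzD in Dm; rewrite in_setD1 conicE /=; apply/andP; split.
    apply/eqP=> [[e1 _]]; move/eqP: nz2; apply.
    have -> : 2 = (1 - d * m ^+ 2) * ((1 + d * m ^+ 2) / (1 - d * m ^+ 2) + 1) :> F by field.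
    by rewrite e1 addNr mulr0.
  by apply/eqP; field.
have inj_f : {in ~: D &, injective f}.
  by move=> m m' Dm Dm' eqf; rewrite (fK m) // (fK m') // eqf.
have P1 : (-1, 0) \in conic d by rewrite conicE /= sqrrN expr1n expr0n mulr0 subr0.
rewrite (cardsD1 (-1, 0)) P1 defP card_in_imset // -(cardsC D).
by rewrite add1n addSn addnC.
Qed.

Lemma card_Aset_split : #|Aset 1| = q.-1.
Proof.
have := card_conic (oner_neq0 F); rewrite -card_Aset_conic.
have -> : [set m : F | 1 * m ^+ 2 == 1] = [set 1; -1].
  by apply/setP=> m; rewrite !inE mul1r sqrf_eq1.
rewrite cards2 eq_sym nz11 addn2 => [[<-]].
by rewrite /= .
Qed.

Lemma card_Aset_nonsplit d : (forall m : F, m ^+ 2 != d) -> #|Aset d| = q.+1.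
Proof.
move=> nsq; have nzd : d != 0 by have := nsq 0; rewrite expr0n eq_sym.
rewrite -(card_conic nzd) -card_Aset_conic.
have -> : [set m : F | d * m ^+ 2 == 1] = set0; last by rewrite cards0 addn0.
apply/setP=> m; rewrite !inE; apply/negP=> /eqP dm.
have nzm : m != 0 by apply/eqP=> m0; move: dm; rewrite m0 expr0n mulr0 => /esym/eqP; rewrite oner_eq0.
have := nsq m^-1; rewrite exprVn; apply/negP; rewrite negbK; apply/eqP.
by apply: (mulIf (expf_neq0 2 nzm)); rewrite dm mulVf ?expf_neq0.
Qed.

Lemma card_squares : (q <= 2 * #|[set m ^+ 2 | m in [set: F]]|)%N.
Proof.
rewrite -[q]cardsT -sum1_card (partition_big_imset (fun m : F => m ^+ 2)) /=.
rewrite mulnC -sum_nat_const; apply: leq_sum => _ /imsetP[m _ ->].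
rewrite sum1dep_card -(leq_add2r 0) addn0.
apply: leq_trans (_ : #|[set m; - m]| <= _)%N; last by rewrite cards2; case: (_ != _).
by apply: subset_leq_card; apply/subsetP=> x; rewrite !inE eqf_sqr.
Qed.

Hypothesis q_odd : odd q.

(** Were squaring surjective on the finite field, it would be injective, but 1 and -1 have the same
    square. *)
Lemma nonsquare_exists : exists d : F, forall m : F, m ^+ 2 != d.
Proof.
have [/existsP[d /forallP nsq]|] := boolP [exists d : F, [forall m : F, m ^+ 2 != d]].
  by exists d.
rewrite negb_exists => /forallP all_sq.
have im_sq : [set m ^+ 2 | m in [set: F]] = [set: F].
  apply/setP=> d; rewrite inE; have := all_sq d; rewrite negb_forall => /existsP[m].
  by rewrite negbK => /eqP <-; apply: imset_f; rewrite inE.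
have /imset_injP inj_sq : #|[set m ^+ 2 | m in [set: F]]| == #|[set: F]| by rewrite im_sq.
by have /eqP := inj_sq _ _ (in_setT (-1)) (in_setT 1) (sqrrN 1); rewrite (negPf nz11).
Qed.

(** Pigeonhole: the sets of all a^2 and of all d b^2 - 1 have equal size, at least q / 2, and q is
    odd, so they meet. *)
Lemma norm_m1_exists d : d != 0 -> exists p : F * F, p.1 ^+ 2 - d * p.2 ^+ 2 = -1.
Proof.
move=> nzd; pose sq := [set m ^+ 2 | m in [set: F]]; pose sh := [set d * s - 1 | s in sq].
have card_sh : #|sh| = #|sq|.
  by rewrite card_imset // => s t /addIr/(mulfI nzd).
have /set0Pn[x /setIP[/imsetP[a _ ->] /imsetP[_ /imsetP[b _ ->] def_a]]] : sq :&: sh != set0.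
  apply: contraL card_squares => /eqP disj; rewrite -ltnNge -/sq.
  have := cardsUI sq sh; rewrite disj cards0 addn0 card_sh addnn -mul2n => cU.
  have le_q : (2 * #|sq| <= q)%N by rewrite -cU -[q]cardsT subset_leq_card ?subsetT.
  rewrite ltn_neqAle le_q andbT.
  by apply: contraL q_odd => /eqP <-; rewrite oddM.
by exists (a, b); rewrite /= def_a; ring.
Qed.

(** * TI properties, normalizers and centralizers through matrix entries *)

Lemma tr_conj x g : c00 (x ^ g)%g + c11 (x ^ g)%g = c00 x + c11 x.
Proof.
have trM y z : c00 (y * z)%g + c11 (y * z)%g = c00 (z * y)%g + c11 (z * y)%g.
  by rewrite !GL2M; ring.
by rewrite conjgE trM -mulgA mulgV mulg1.
Qed.

(** Write u g = g v. If the lower left entry of g is nonzero, the entry equations give u and v the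
    same diagonal and then make the upper right entry of u vanish, so u is central. *)
Lemma TI_Uset u g : u \in Uset -> u \notin Z -> g \in S -> (u ^ g)%g \in Uset -> g \in Bset.
Proof.
rewrite center_SL2 !UsetE => /and3P[Su /eqP u10 /eqP u11].
rewrite Su u10 eqxx u11 eqxx !andbT /= => nz_u.
move=> Sg /and3P[_ /eqP v10 /eqP v11]; rewrite BsetE Sg /=.
move: (conjgC u g) v10 v11; move: (u ^ g)%g => v E v10 v11.
have e10 := congr1 c10 E; have e00 := congr1 c00 E.
rewrite !GL2M u10 v10 v11 ?u11 in e10 e00.
apply: contraR nz_u => nz_g10; apply/eqP.
have eq_uv : c11 u = c11 v.
  (* An idiom used throughout: after cancellation, the goal differs from an entry equation only by
     ring identities at both ends. *)
  by apply: (mulfI nz_g10); apply: (etrans _ (etrans e10 _)); ring.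
have : c01 u * c10 g = 0.
  apply: (addrI (c11 u * c00 g)); rewrite [in RHS]eq_uv.
  by apply: (etrans _ (etrans e00 _)); ring.
by move/eqP; rewrite mulf_eq0 (negPf nz_g10) orbF => /eqP.
Qed.

(** Trace and determinant are preserved, so x = a + b J is conjugated to a + b J or a - b J with b
    nonzero; g then commutes or anticommutes with J. *)
Lemma TI_Aset d x g : d != 0 -> x \in Aset d -> x \notin Z -> g \in S ->
  (x ^ g)%g \in Aset d -> g \in Nset d.
Proof.
move=> nzd; rewrite center_SL2 !AsetE => /and3P[Sx /eqP x00 /eqP x01].
rewrite Sx x00 eqxx andbT /= => nz_x Sg /and3P[Sv /eqP v00 /eqP v01].
have nz_x10 : c10 x != 0.
  by apply: contra nz_x => /eqP e; rewrite x01 e mulr0 !eqxx.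
have E := conjgC x g; have tr := tr_conj x g; move: E tr v00 v01 Sv.
move: (x ^ g)%g => v E tr v00 v01 Sv.
have x11 : c11 v = c11 x.
  by apply: (mulfI nz2); rewrite !mulr_natl !mulr2n -{1}v00 tr x00.
have dx := detS Sx; have dv := detS Sv; rewrite x00 x01 in dx; rewrite v00 v01 x11 in dv.
have : c10 v ^+ 2 = c10 x ^+ 2.
  apply: (mulfI nzd); apply: (addrI (-(c11 x * c11 x))); apply: oppr_inj.
  by apply: (etrans _ (etrans (etrans dv (esym dx)) _)); ring.
have e00 := congr1 c00 E; have e01 := congr1 c01 E.
have e10 := congr1 c10 E; have e11 := congr1 c11 E.
rewrite !GL2M x00 x01 v00 v01 x11 in e00 e01 e10 e11.
rewrite NsetE Sg /= => /eqP; rewrite eqf_sqr => /orP[]/eqP v10; rewrite v10 in e00 e01 e10 e11.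
  apply/orP; left; apply/andP; split; apply/eqP; apply: (mulfI nz_x10).
    by apply: (addrI (c11 x * c10 g)); apply: (etrans _ (etrans e10 _)); ring.
  by apply: (addrI (c11 x * c00 g)); apply: (etrans _ (etrans (esym e00) _)); ring.
apply/orP; right; apply/andP; split; apply/eqP; apply: (mulfI nz_x10).
  by apply: (addrI (c11 x * c10 g)); apply: (etrans _ (etrans e10 _)); ring.
apply: oppr_inj; apply: (addrI (c11 x * c00 g)).
by apply: (etrans _ (etrans (esym e00) _)); ring.
Qed.

(** By Cayley-Hamilton a matrix of trace 0 and determinant 1 squares to -1. *)
Lemma NsetD_sqr d w : w \in Nset d -> w \notin Aset d -> (w * w)%g \in Z.
Proof.
rewrite NsetE AsetE center_SL2 => /andP[Sw].
case/orP=> [->|/andP[/eqP w00 /eqP w01] nAw]; first by rewrite Sw.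
rewrite groupM // !GL2M w00 w01 /=.
by apply/and3P; split; apply/eqP; ring.
Qed.

(** A matrix anticommuting with J has determinant -(x^2 - d y^2), so a solution of x^2 - d y^2 = -1
    is what provides an element outside the torus; two cosets then make up [Nset d]. *)
Lemma card_Nset d : d != 0 -> #|Nset d| = (2 * #|Aset d|)%N.
Proof.
move=> nzd; have [[x y] /= xy1] := norm_m1_exists nzd.
have d1 : x * (- x) - (- (d * y)) * y = 1 by apply: oppr_inj; rewrite -xy1; ring.
have nz : x * (- x) - (- (d * y)) * y != 0 by rewrite d1 oner_neq0.
have [w00 w01 w10 w11] := mkE nz; have Sw := mk_SL2 d1.
move: (mk _ _ _ _) w00 w01 w10 w11 Sw => w w00 w01 w10 w11 Sw.
have Nw : w \in Nset d by rewrite NsetE Sw w00 w01 w10 w11 opprK !eqxx orbT.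
have self_opp a : a = - a -> a = 0.
  by move=> e; apply: (mulfI nz2); rewrite mulr0 mulr_natl mulr2n {2}e subrr.
have nAw : w \notin Aset d.
  apply/negP; rewrite AsetE w00 w01 w10 w11 => /and3P[_ /eqP/self_opp x0 /eqP].
  move/esym/self_opp/eqP; rewrite mulf_eq0 (negPf nzd) /= => /eqP y0.
  by move/eqP: d1; rewrite x0 y0 oppr0 !mulr0 subr0 eq_sym oner_eq0.
have anti g : g \in Nset d -> g \notin Aset d -> c00 g = - c11 g /\ c01 g = - (d * c10 g).
  rewrite NsetE AsetE => /andP[-> /orP[->//|/andP[/eqP-> /eqP->]] _] //.
have -> : Nset d = Aset d :|: Aset d :* w.
  apply/setP=> g; rewrite in_setU mem_rcoset; apply/idP/orP=> [Ng|[/(subsetP (A_sub_N d))//|]].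
    have [|nAg] := boolP (g \in Aset d); [by left | right].
    have Sg := subsetP (N_sub_S d) _ Ng.
    rewrite -(groupMr _ (_ : w * w \in Agroup d)%g); last exact: (subsetP (center_sub_A d)) (NsetD_sqr Nw nAw).
    rewrite mulgA mulgKV AsetE groupM // !GL2M /=.
    have [-> ->] := anti g Ng nAg; have [-> ->] := anti w Nw nAw.
    by apply/andP; split; apply/eqP; ring.
  move/(subsetP (A_sub_N d)) => Ngw.
  have := @groupM _ (Ngroup d) _ _ Ngw Nw.
  by rewrite mulgKV.
rewrite cardsU card_rcoset (_ : _ :&: _ = set0) ?cards0 ?subn0 ?mul2n -?addnn //.
apply/setP=> g; rewrite in_setI mem_rcoset in_set0; apply/negP=> /andP[Ag Agw].
have := @groupM _ (Agroup d) _ _ (groupVr (Ag : g \in Agroup d)) Agw.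
by rewrite mulKg => /groupVl Aw; case/negP: nAw.
Qed.

(* The matrix a + b J is sent to a + b s, where s is a square root of d. *)
Lemma Aset_cyclic d : d != 0 -> cyclic (Aset d).
Proof.
move=> nzd; have nzp : 'X^2 - d%:P != 0 :> {poly F} by rewrite -size_poly_gt0 size_XnsubC.
have [L [rs Dp _]] := FinSplittingFieldFor nzp.
have [s] : exists s : L, s ^+ 2 = in_alg L d.
  have szp : size (map_poly (in_alg L) ('X^2 - d%:P)) = 3%N.
    by rewrite size_map_poly size_XnsubC.
  case: rs Dp => [/eqp_size|s rs Dp]; first by rewrite szp big_nil size_poly1.
  exists s; have : root (map_poly (in_alg L) ('X^2 - d%:P)) s.
    by rewrite (eqp_root Dp) big_cons rootM root_XsubC eqxx.
  rewrite rmorphB /= map_polyXn map_polyC /= rootE !hornerE subr_eq0.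
  by move/eqP.
(* From here on [iota] is just a ring morphism under which d becomes a square. *)
move=> s2_alg; have [iota s2] : exists iota : {rmorphism F -> L}, s ^+ 2 = iota d.
  by exists (in_alg L).
pose f g : L := iota (c00 g) + iota (c10 g) * s.
apply: (field_mul_group_cyclic (f := f) (G := Agroup d)) => [x y|x].
  rewrite !AsetE => /and3P[_ /eqP x00 /eqP x01] /and3P[_ /eqP y00 /eqP y01].
  rewrite /f !GL2M -x00 x01.
  have -> : iota (c00 x * c00 y + d * c10 x * c10 y) = 
     iota (c00 x) * iota (c00 y) + s ^+ 2 * iota (c10 x) * iota (c10 y) :> L.
    by rewrite s2 rmorphD !rmorphM.
  by rewrite rmorphD !rmorphM /=; ring.
rewrite AsetE => /and3P[Sx /eqP x00 /eqP x01]; split=> [f1|->]; last first.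
  by rewrite /f !GL2_1 rmorph1 rmorph0 mul0r addr0.
have dx := detS Sx; rewrite -x00 x01 in dx.
(* The determinant is the norm (a + b s)(a - b s) = 1; with a + b s = 1 this gives a - b s = 1, so a
   = 1 and then d b^2 = 0. *)
have f2 : iota (c00 x) - iota (c10 x) * s = 1 :> L.
  rewrite -[LHS]mul1r -{1}f1 /f -[RHS](rmorph1 iota) -dx rmorphB !rmorphM -s2.
  by ring.
have nz2L : 2 != 0 :> L by rewrite -(rmorph_nat iota) fmorph_eq0.
have c1 : iota (c00 x) = 1 :> L.
  apply: (mulfI nz2L); rewrite mulr1.
  by apply: (etrans _ (congr2 +%R f1 f2)); rewrite /f; ring.
have {}c1 : c00 x = 1 by apply: (fmorph_inj iota); rewrite c1 rmorph1.
have : (c10 x) ^+ 2 = 0.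
  apply: (mulfI nzd); rewrite mulr0; move: dx; rewrite c1 => dx.
  by apply: oppr_inj; apply: (addrI 1); rewrite oppr0 addr0 -[RHS]dx; ring.
move/eqP; rewrite sqrf_eq0 => /eqP x10.
by apply: GL2_inj; rewrite !GL2_1 -?x00 // x01 x10 mulr0.
Qed.

Lemma Uset_abelian : abelian Uset.
Proof.
apply/centsP=> u; rewrite UsetE => /and3P[_ /eqP u10 /eqP u11] v.
rewrite UsetE => /and3P[_ /eqP v10 /eqP v11].
by apply: GL2_inj; rewrite !GL2M ?u10 ?u11 ?v10 ?v11; ring.
Qed.

Lemma Uset_normal : Uset <| Bset.
Proof.
rewrite /normal U_sub_B /=; apply/subsetP=> g; rewrite BsetE => /andP[Sg /eqP g10]; rewrite inE.
apply/subsetP=> _ /imsetP[u Uu ->]; have := tr_conj u g.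
move: Uu; rewrite !UsetE => /and3P[Su /eqP u10 /eqP u11].
rewrite groupJ //=; have E := conjgC u g; move: E; move: (u ^ g)%g => v E tr.
have e10 := congr1 c10 E; have e11 := congr1 c11 E; have e00 := congr1 c00 E.
rewrite !GL2M u10 g10 u11 in e10 e11 e00.
have dg := detS Sg; rewrite g10 mulr0 subr0 in dg.
have nz00 : c00 g != 0 by apply/eqP=> z; move/eqP: dg; rewrite z mul0r eq_sym oner_eq0.
have nz11g : c11 g != 0 by apply/eqP=> z; move/eqP: dg; rewrite z mulr0 eq_sym oner_eq0.
have v10 : c10 v = 0.
  by apply: (mulfI nz11g); apply: (etrans _ (etrans (esym e10) _)); ring.
have v11 : c11 v = c11 u.
  by apply: (mulfI nz11g); apply: (etrans _ (etrans (esym e11) _)); ring.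
have v00 : c00 v = c11 u.
  apply: (mulfI nz00); rewrite v10 in e00.
  by apply: (etrans _ (etrans (esym e00) _)); ring.
by rewrite v10 v00 v11 !eqxx.
Qed.

(** Commuting modulo the center allows u ^ g = -u, which the trace excludes. Once u ^ g = u, the
    upper right entry of u, nonzero, forces g to have equal diagonal entries. *)
Lemma cent_Uset u g : u \in Uset -> u \notin Z -> g \in S ->
  (u ^ g * u^-1)%g \in Z -> g \in Uset.
Proof.
move=> Uu nZu Sg Zug; have Uug : (u ^ g)%g \in Ugroup.
  have := @groupM _ Ugroup _ _ (subsetP center_sub_U _ Zug) Uu.
  by rewrite mulgKV.
have := TI_Uset Uu nZu Sg Uug; rewrite BsetE UsetE => /andP[-> g10]; rewrite g10 /=.
move: Uu Uug nZu; rewrite center_SL2 !UsetE.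
move=> /and3P[Su /eqP u10 /eqP u11] /and3P[_ /eqP v10 /eqP v11].
rewrite Su u10 u11 !eqxx !andbT /= => nz01.
have tr : c11 (u ^ g)%g = c11 u.
  by apply: (mulfI nz2); have := tr_conj u g; rewrite u11 v11 !mulr_natl !mulr2n.
have Zc : (u ^ g * u^-1)%g = 1%g.
  move: (Zug); rewrite center_SL2 => /and4P[_ /eqP z01 /eqP z10 /eqP z11].
  have E : (u ^ g * u^-1 * u = u ^ g)%g by rewrite mulgKV.
  have := congr1 c11 E; rewrite GL2M z10 tr mul0r add0r => e.
  have nzu : c11 u != 0.
    apply/eqP=> z; have := detS Su; rewrite z u10 !mulr0 subr0 => /eqP.
    by rewrite eq_sym oner_eq0.
  have {}e : c11 (u ^ g * u^-1)%g = 1 by apply: (mulIf nzu); rewrite e mul1r.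
  by apply: GL2_inj; rewrite !GL2_1 // z11 e.
have E := conjgC u g; have uv : (u ^ g)%g = u.
  by have := congr1 (mulg^~ u) Zc; rewrite /= mulgKV mul1g.
rewrite uv in E; have := congr1 c01 E; rewrite !GL2M u11 => e.
apply/eqP/(mulfI nz01); apply: (addrI (c11 u * c01 g)).
by apply: (etrans _ (etrans (esym e) _)); ring.
Qed.

(** Were -1 not a square, [Aset (-1)] would have order q + 1 and contain the rotation w of order 4,
    so 4 would divide q + 1. *)
Lemma sqrt_m1_exists : (q %% 4 = 1)%N -> exists i : F, i ^+ 2 = -1.
Proof.
move=> q4; have [/existsP[i /eqP]|] := boolP [exists i : F, i ^+ 2 == -1]; first by exists i.
rewrite negb_exists => /forallP/card_Aset_nonsplit cA.
have d1 : 0 * 0 - -1 * 1 = 1 :> F by ring.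
have nz : 0 * 0 - -1 * 1 != 0 :> F by rewrite d1 oner_neq0.
have [w00 w01 w10 w11] := mkE nz; have Sw := mk_SL2 d1.
move: (mk _ _ _ _) w00 w01 w10 w11 Sw => w w00 w01 w10 w11 Sw.
have Aw : w \in Agroup (-1) by rewrite AsetE Sw w00 w01 w10 w11 mulr1 !eqxx.
have w2E : (c00 (w ^+ 2)%g = -1) * (c01 (w ^+ 2)%g = 0)
    * (c10 (w ^+ 2)%g = 0) * (c11 (w ^+ 2)%g = -1).
  by rewrite expgS expg1 !GL2M w00 w01 w10 w11; do !split; ring.
have w4 : (w ^+ 4 = 1)%g.
  rewrite (expgD w 2 2).
  move: (w ^+ 2)%g w2E => v vE.
  by apply: GL2_inj; rewrite !GL2M !vE !GL2_1; ring.
have nw2 : (w ^+ 2 != 1)%g.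
  by apply: contraNneq nz11 => /(congr1 c00); rewrite w2E GL2_1 => ->.
have d4 : (#[w]%g %| 4)%N by rewrite order_dvdn w4.
have nd2 : ~~ (#[w]%g %| 2)%N by rewrite order_dvdn.
have o4 : #[w]%g = 4%N.
  by move: d4 nd2 (dvdn_leq (isT : (0 < 4)%N) d4); case: #[w]%g => [|[|[|[|[|n]]]]].
have : (4 %| q.+1)%N by rewrite -o4 -cA; exact: (order_dvdG Aw).
by move/dvdnP=> [m em]; move: q4 em; clear; lia.
Qed.

(** Conjugation by diag(i, -i) with i^2 = -1 negates the upper right entry. *)
Lemma invg_Uset u : (q %% 4 = 1)%N -> u \in Uset -> exists2 g, g \in S & (u ^ g = u^-1)%g.
Proof.
move=> /sqrt_m1_exists[i i2]; rewrite UsetE => /and3P[Su /eqP u10 /eqP u11].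
have d1 : i * - i - 0 * 0 = 1 by rewrite mulrN -expr2 i2; ring.
have nz : i * - i - 0 * 0 != 0 by rewrite d1 oner_neq0.
have [g00 g01 g10 g11] := mkE nz; exists (mk i 0 0 (-i)); first exact: mk_SL2.
move: (mk _ _ _ _) g00 g01 g10 g11 => g g00 g01 g10 g11.
have du := detS Su; rewrite u11 u10 mulr0 subr0 in du.
have E : (u * g * u = g)%g.
  apply: GL2_inj; rewrite !GL2M ?g00 ?g01 ?g10 ?g11 ?u10 ?u11; try ring.
    by apply: (etrans (_ : _ = i * (c11 u * c11 u))); [ring | rewrite du mulr1].
  by apply: (etrans (_ : _ = - i * (c11 u * c11 u))); [ring | rewrite du mulr1].
by apply: (mulIg u); rewrite mulVg conjgE -!mulgA mulgA in E *; rewrite E mulVg.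
Qed.

(** For d = 1 the row lines of (1, 1) and (1, -1) are stable under the torus; they are the images of
    the line of (0, 1), which [Bset] stabilizes, under [lower] and its inverse. *)
Lemma Aset_conj_lower (t : gT) : t \in Aset 1 ->
  (t ^ lower^-1)%g \in Bset /\ (t ^ lower)%g \in Bset.
Proof.
have [l00 l01 l10 l11] := lowerE.
rewrite AsetE => /and3P[St /eqP t00]; rewrite mul1r => /eqP t01.
have SlV := @groupVr _ S lower lower_SL.
have SJ y : y \in S -> (t ^ y)%g \in S := @groupJ _ S t y St.
rewrite !BsetE (SJ _ SlV) (SJ _ lower_SL) !andTb; split; apply/eqP.
  have : (t ^ lower^-1 * lower = lower * t)%g by rewrite conjgE invgK -!mulgA mulVg mulg1.
  move: (t ^ lower^-1)%g => v E; have e10 := congr1 c10 E; have e11 := congr1 c11 E.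
  rewrite !GL2M l00 l01 l10 l11 t00 t01 in e10 e11.
  have {}e11 : c11 v = c10 t + c11 t by apply: (etrans _ (etrans e11 _)); ring.
  rewrite e11 in e10; apply: (addIr (c10 t + c11 t)); rewrite add0r.
  by apply: (etrans _ (etrans e10 _)); ring.
have := conjgC t lower; move: (t ^ lower)%g => v E.
have e00 := congr1 c00 E; have e10 := congr1 c10 E.
rewrite !GL2M l00 l01 l10 l11 t00 t01 in e00 e10.
have {}e00 : c00 v = c11 t + c10 t by apply: (etrans _ (etrans (esym e00) _)); ring.
apply: (addrI (c11 t + c10 t)); rewrite addr0 -[in LHS]e00.
by apply: (etrans _ (etrans (esym e10) _)); ring.
Qed.

(** The lower left entry is -4, nonzero in odd characteristic. This separates the two conjugates of
    the Borel subgroup that contain the split torus. *)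
Lemma upper_conj_lower : (upper ^ (lower * lower))%g \notin Bset.
Proof.
have [l00 l01 l10 l11] := lowerE; have [u00 u01 u10 u11] := upperE.
rewrite BsetE negb_and; apply/orP; right.
have := conjgC upper (lower * lower)%g; move: (upper ^ _)%g => v E.
apply/eqP=> v10; have e00 := congr1 c00 E; have e10 := congr1 c10 E.
rewrite !GL2M l00 l01 l10 l11 u00 u01 u10 u11 v10 in e00 e10.
have {}e00 : c00 v = 3 by apply: (etrans _ (etrans (esym e00) _)); ring.
have : 2 * 2 = 0 :> F.
  apply: (addrI 2); rewrite addr0; rewrite e00 in e10.
  by apply: (etrans _ (etrans (esym e10) _)); ring.
by move/eqP; rewrite mulf_eq0 (negPf nz2).
Qed.

(** * Passage to the quotient by the center *)

Lemma quotient_center_setD1P (H : {group gT}) (x : coset_of Z) : H \subset S ->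
  x \in (H / Z)^#%g -> exists g, [/\ g \in H, g \in S, g \notin Z & x = coset Z g].
Proof.
move=> sHS /setD1P[nt_x /(quotient_centerP sHS)[g Hg def_x]]; exists g.
split=> //; first exact: (subsetP sHS).
by apply: contra nt_x => Zg; rewrite def_x coset_id.
Qed.

Lemma quotient_center_TI (H L : {group gT}) :
    Z \subset H -> H \subset S -> Z \subset L -> L \subset S ->
    (forall h g, h \in H -> h \notin Z -> g \in S -> (h ^ g)%g \in H -> g \in L) ->
  forall x y : coset_of Z, x \in (H / Z)^#%g -> y \in (S / Z)%g ->
    (x ^ y)%g \in (H / Z)%g -> y \in (L / Z)%g.
Proof.
move=> sZH sHS sZL sLS ti x y /(quotient_center_setD1P sHS)[h [Hh Sh nZh ->{x}]].
case/PSL2P=> g Sg ->{y}; have Shg := groupJ Sh Sg.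
rewrite coset_centerJ // (mem_quotient_center sZH sHS Shg).
rewrite (mem_quotient_center sZL sLS) //; exact: ti.
Qed.

Lemma PSL2_torus d : d != 0 ->
  TI_torus (S / Z)%G (Agroup d / Z) (Ngroup d / Z).
Proof.
move=> nzd; have sAS := subset_trans (A_sub_N d) (N_sub_S d).
have sZN := subset_trans (center_sub_A d) (A_sub_N d).
split.
- exact: quotient_cyclic (Aset_cyclic nzd).
- by split; [exact: quotientS (A_sub_N d) | exact: quotientS (N_sub_S d)].
- apply/eqP; rewrite -(eqn_pmul2l (ltn0Sn 1)); apply/eqP.
  rewrite card_quotient_center ?N_sub_S // [X in _ = (2 * X)%N]card_quotient_center ?center_sub_A //.
  exact: card_Nset.
- apply: quotient_center_TI; rewrite ?center_sub_A ?N_sub_S //.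
  by move=> h g Ah nZh Sg; apply: TI_Aset.
move=> _ /(quotient_centerP (N_sub_S d))[w Nw ->].
have Sw := subsetP (N_sub_S d) w Nw; have NZw := subsetP nZS w Sw.
rewrite mem_quotient_center ?center_sub_A // => nAw.
have -> : (coset Z w * coset Z w = coset Z (w * w))%g by rewrite morphM.
by rewrite coset_id // (NsetD_sqr Nw nAw).
Qed.

Lemma PSL2_split_torus_Borel : exists x y : coset_of Z,
  [/\ x \in (S / Z)%g, y \in (S / Z)%g, (Agroup 1%R / Z \subset (Bgroup / Z) :^ x)%g,
      (Agroup 1%R / Z \subset (Bgroup / Z) :^ y)%g & (Bgroup / Z) :^ x != (Bgroup / Z) :^ y]%g.
Proof.
have sAS := subset_trans (A_sub_N 1) (N_sub_S 1).
have SlV := @groupVr _ S lower lower_SL.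
exists (coset Z lower), (coset Z lower^-1%g).
have NZl := subsetP nZS _ lower_SL.
have memB g : g \in S -> (coset Z g \in Bgroup / Z)%g = (g \in Bset).
  exact: (mem_quotient_center center_sub_B B_sub_S).
rewrite !mem_quotient //; split=> //.
- apply/subsetP=> _ /(quotient_centerP sAS)[t At ->].
  have St := subsetP sAS t At.
  rewrite mem_conjg -morphV // coset_centerJ // (memB _ (groupJ St _)) //.
  by case: (Aset_conj_lower At).
- apply/subsetP=> _ /(quotient_centerP sAS)[t At ->].
  have St := subsetP sAS t At.
  rewrite mem_conjg morphV // invgK coset_centerJ // (memB _ (groupJ St _)) //.
  by case: (Aset_conj_lower At).
apply: contra upper_conj_lower => /eqP eqB.
have Bu : upper \in Bset.
  by have [_ _ u10 _] := upperE; rewrite BsetE upper_SL u10 eqxx.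
have : (coset Z upper ^ coset Z lower)%g \in ((Bgroup / Z) :^ coset Z lower)%g.
  by rewrite memJ_conjg mem_quotient.
have Sul := groupJ upper_SL lower_SL; have Sull := groupJ Sul lower_SL.
by rewrite eqB mem_conjg morphV // invgK !coset_centerJ // memB // -conjgM.
Qed.

Lemma PSL2_cent_U (u g : coset_of Z) : u \in (Ugroup / Z)^#%g -> g \in (S / Z)%g -> commute u g ->
  g \in (Ugroup / Z)%g.
Proof.
case/(quotient_center_setD1P U_sub_S)=> v [Uv Sv nZv ->] /PSL2P[h Sh ->] cvh.
rewrite mem_quotient_center ?center_sub_U ?U_sub_S //.
apply: (cent_Uset Uv nZv Sh).
have Nv := subsetP nZS v Sv; have Nh := subsetP nZS h Sh.
apply: coset_idr; first by rewrite groupM ?groupV ?groupJ.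
rewrite morphM ?groupV ?groupJ // morphV // morphJ //.
by apply/eqP; rewrite -eq_mulgV1; apply/eqP/conjg_fixP/commgP.
Qed.

Lemma PSL2_inv_U (u : coset_of Z) : (q %% 4 = 1)%N -> u \in (Ugroup / Z)^#%g ->
  u^-1%g \in (u ^: (S / Z))%g.
Proof.
move=> q4 /(quotient_center_setD1P U_sub_S)[v [Uv Sv _ ->]].
have [g Sg vg] := invg_Uset q4 Uv.
have -> : ((coset Z v)^-1 = coset Z v^-1)%g by rewrite morphV ?(subsetP nZS).
rewrite -vg -coset_centerJ //.
by rewrite memJ_class // mem_quotient.
Qed.

Hypothesis q_gt2 : (2 < q)%N.
Hypothesis cardS : #|S| = (q.-1 * q * q.+1)%N.

Theorem SL2_simple_modules (b0 sq : bool) (m : nat) :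
    torus_order q b0 = (2 * m)%N -> (sq <-> (q %% 4 = 1)%N /\ is_square q) ->
  exists Mod : bool + bool * nat + bool -> QGmodule (S / Z)%G,
  [/\ forall l, psl2_label q sq l -> simple_mod (Mod l) /\ qdim (Mod l) = psl2_dim q b0 sq l,
      forall l l', psl2_label q sq l -> psl2_label q sq l' -> iso_mod (Mod l) (Mod l') -> l = l',
      forall M, simple_mod M -> exists2 l, psl2_label q sq l & iso_mod M (Mod l),
      trivial_mod (Mod (inl (inl true)))
    & steinberg_mod q (Mod (inl (inl false)))].
Proof.
move=> b0_even sqP; have [dlt nsq] := nonsquare_exists.
have nz_dlt : dlt != 0 by have := nsq 0; rewrite expr0n eq_sym.
(* The square 1 gives the split torus, a nonsquare the nonsplit one. *)
pose del (b : bool) := if b then 1 else dlt.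
have nz_del (b : bool) : del b != 0 by case: b => //; apply: oner_neq0.
pose A (b : bool) := (Agroup (del b) / Z)%G; pose N (b : bool) := (Ngroup (del b) / Z)%G.
have sAS (b : bool) := subset_trans (A_sub_N (del b)) (N_sub_S (del b)).
have cardA2 : forall b : bool, (2 * #|A b|)%N = if b then q.-1 else q.+1.
  move=> b; rewrite card_quotient_center ?center_sub_A ?sAS //.
  by case: b; [apply: card_Aset_split | apply: card_Aset_nonsplit].
have cardA : forall b : bool, #|A b| = torus_order q b.
  by move=> b; have := cardA2 b; rewrite /torus_order -fun_if => <-; rewrite mul2n doubleK.
have cardG2 : (2 * #|(S / Z)%G|)%N = (q.-1 * q * q.+1)%N.
  by rewrite card_quotient_center ?center_sub.
have cardU : #|(Ugroup / Z)%G| = q.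
  apply/eqP; rewrite -(eqn_pmul2l (ltn0Sn 1)) card_quotient_center ?center_sub_U ?U_sub_S //.
  by rewrite card_Uset.
have cardB : (2 * #|(Bgroup / Z)%G|)%N = (q * q.-1)%N.
  by rewrite card_quotient_center ?center_sub_B ?B_sub_S // card_Bset.
have torA (b : bool) : TI_torus (S / Z)%G (A b) (N b) by apply: PSL2_torus.
have [alpha lin_alpha alpha_eq] : exists2 alpha : forall b : bool, 'CF(A b),
    forall b : bool, alpha b \is a linear_char
  & forall (b : bool) j k, (alpha b ^+ j == alpha b ^+ k) = (j == k %[mod #|A b|])%N.
  have cyc (b : bool) : cyclic (A b) by case: (torA b).
  have [a1 lin1 eq1] := cyclic_lin_char (cyc true).
  have [a0 lin0 eq0] := cyclic_lin_char (cyc false).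
  by exists (fun b : bool => if b return 'CF(A b) then a1 else a0) => [] [].
have b0_even' : #|A b0| = (2 * m)%N by rewrite cardA.
have [|||||||Mod [ModP inj surj triv st]] := @simple_classification _ (S / Z)%G (Ugroup / Z)%G
   (Bgroup / Z)%G A N q q_odd q_gt2 cardG2 cardU cardB _ _ _ _ _ _ torA cardA2 _ alpha lin_alpha alpha_eq
   b0 m b0_even' sq sqP.
- exact: quotientS B_sub_S.
- exact: quotient_normal Uset_normal.
- exact: quotient_abelian Uset_abelian.
- apply: quotient_center_TI; rewrite ?center_sub_U ?center_sub_B ?B_sub_S ?U_sub_S //.
  by move=> h g Uh nZh Sg; apply: TI_Uset.
- exact: PSL2_cent_U.
- by move=> q4 u; apply: PSL2_inv_U.
- exact: PSL2_split_torus_Borel.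
have labE l : psl2_label q sq l = valid_label A sq l.
  by case: l => [[//|[b d]]|//] /=; rewrite cardA.
exists Mod; split=> // [l|l l'|M /surj[l]]; rewrite ?labE.
- by case/ModP=> simM ->; split=> //; case: l {simM} => [[[]//|[b d]]|b]; rewrite /= cardA.
- exact: inj.
by exists l; rewrite ?labE.
Qed.

End SpecialLinearGroup.

(** * The simple QG-modules *)

Local Open Scope nat_scope.

Lemma PSL2_simple_modules (F : finFieldType) (p k m : nat) (b0 sq : bool) :
    prime p -> odd p -> #|F| = (p ^ k)%N -> let q := #|F| in
    torus_order q b0 = (2 * m)%N -> (sq <-> q %% 4 = 1 /\ is_square q) ->
  exists Mod : bool + bool * nat + bool -> QGmodule [group of PSL2 F],
  [/\ forall l, psl2_label q sq l ->
        simple_mod (Mod l) /\ qdim (Mod l) = psl2_dim q b0 sq l,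
      forall l l', psl2_label q sq l -> psl2_label q sq l' ->
        iso_mod (Mod l) (Mod l') -> l = l',
      forall M, simple_mod M -> exists2 l, psl2_label q sq l & iso_mod M (Mod l),
      trivial_mod (Mod (inl (inl true)))
    & steinberg_mod q (Mod (inl (inl false)))].
Proof.
move=> p_pr p_odd cardF q b0_even sqP.
have odd_q : odd q by rewrite /q cardF oddX p_odd orbT.
have q_gt2 : 2 < q.
  have := finRing_gt1 F; rewrite leq_eqVlt => /orP[/eqP e|//].
  by move: odd_q; rewrite /q -e.
have nz2 : (2 != 0 :> F)%R.
  have charFp := card_finPcharP cardF p_pr.
  rewrite -(dvdn_pcharf charFp); apply/negP=> /(dvdn_leq (isT : 0 < 2)).
  by case: p p_pr p_odd {cardF charFp} => [|[|[|]]].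
exact: (@SL2_simple_modules F _ (SL2_group F) (@c00 F) (@c01 F) (@c10 F) (@c11 F) (@mk F)
  (@GL2_inj F) (@GL2M F) (@GL2_1 F) (@mkE F) (@SL2E F) nz2 odd_q q_gt2 (card_SL2 F) b0 sq m b0_even sqP).
Qed.

Lemma simple_mod_char_inj (gT : finGroupType) (G : {group gT}) (M N : QGmodule G) :
  simple_mod M -> simple_mod N -> mod_char M = mod_char N -> iso_mod M N.
Proof.
move=> simM simN eqMN; apply: simple_iso_cfdot => //; rewrite eqMN cfnorm_eq0.
apply/eqP=> /(congr1 (fun phi : 'CF(G) => phi 1%g)); rewrite mod_char1 cfunE.
move/eqP; rewrite Num.Theory.pnatr_eq0 => /eqP dN.
by have [+ _] := (mx_irrP _).1 simN; rewrite dN.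
Qed.

Lemma totient_lt d : 1 < d -> totient d < d.
Proof.
case: d => [|d] // d_gt1; rewrite totient_count_coprime big_ltn //.
rewrite /coprime gcdn0 gtn_eqF // add0n ltnS.
apply: leq_trans (_ : \sum_(1 <= i < d.+1) 1 <= d); last by rewrite sum_nat_const_nat muln1 subn1.
by apply: leq_sum => i _; apply: leq_b1.
Qed.

(** The divisors that index no orbit are 1 and, for even m, 2. *)
Lemma tau_gt2 m : 0 < m -> size [seq d <- divisors m | 2 < d] + 1 + ~~ odd m = tau m.
Proof.
move=> m_gt0; rewrite /tau size_filter -(count_predC (fun d => 2 < d)) -addnA; congr (_ + _).
have -> : count (predC (fun d => 2 < d)) (divisors m) =
          count_mem 1 (divisors m) + count_mem 2 (divisors m).
  rewrite -count_predUI (@eq_count _ (predI _ _) pred0) ?count_pred0 ?addn0; last by case=> [|[|[|]]].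
  apply: eq_in_count => d; rewrite -dvdn_divisors // => d_m.
  by have := dvdn_gt0 m_gt0 d_m; case: d {d_m} => [|[|[|]]].
by rewrite !count_uniq_mem ?divisors_uniq // -!dvdn_divisors // dvd1n dvdn2.
Qed.

Arguments torus_order : simpl never.

(** * Arithmetic separating the dimensions *)

Section TorusOrders.
Variable q : nat.
Hypotheses (q_odd : odd q) (q_gt2 : 2 < q).
Local Notation n := (torus_order q).

Lemma torus_order_true : q = (2 * n true).+1.
Proof.
rewrite /torus_order -{1}(odd_double_half q) q_odd -{2}(odd_double_half q) q_odd.
by rewrite add1n /= doubleK mul2n.
Qed.

Lemma torus_order_false : n false = (n true).+1.
Proof. by rewrite {1}/torus_order [in LHS]torus_order_true mul2n -doubleS doubleK. Qed.

Lemma torus_order_gt0 : 0 < n true.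
Proof. by have := q_gt2; have := torus_order_true; case: (n true) => // ->. Qed.

Lemma torus_orderN b : n (~~ b) = n b + 1 \/ n b = n (~~ b) + 1.
Proof. by case: b; rewrite /= torus_order_false !addn1; [left | right]. Qed.

Lemma coprime_torus_orders b : coprime (n b) (n (~~ b)).
Proof. by case: (torus_orderN b) => ->; rewrite addn1 ?coprimenS ?coprimeSn. Qed.

Lemma torus_order_q b : q = (2 * n b).+1 \/ q.+1 = 2 * n b.
Proof.
case: b; [left; exact: torus_order_true | right].
by rewrite torus_order_false {1}torus_order_true mulnS.
Qed.

Lemma divisor_totient_lt b d : 2 < d -> d %| n b -> 1 < totient d < n b.
Proof.
move=> d_gt2 d_n; rewrite totient_gt1 d_gt2 /=.
have n_gt0 : 0 < n b by case: b d_n; rewrite ?torus_order_false ?torus_order_gt0.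
by apply: leq_trans (dvdn_leq n_gt0 d_n); rewrite totient_lt // ltnW.
Qed.

Lemma torus_dim_neq1 b d : 2 < d -> d %| n b -> n (~~ b) * totient d <> 1.
Proof.
move=> d_gt2 d_n; have /andP[t_gt1 _] := divisor_totient_lt d_gt2 d_n.
by move=> /eqP; rewrite muln_eq1 => /andP[_ /eqP t1]; rewrite t1 in t_gt1.
Qed.

(** With l = n (~~ b), q is 2 l + 1 or 2 l - 1. The second is too small for totient d >= 2; the
    first makes l divide 1, so totient d = 3, which is not below n b <= 2. *)
Lemma torus_dim_neq_q b d : 2 < d -> d %| n b -> n (~~ b) * totient d <> q.
Proof.
move=> d_gt2 d_n; have /andP[] := divisor_totient_lt d_gt2 d_n.
have := torus_order_q (~~ b); have := torus_orderN b; move: q_gt2; clear.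
move: (totient d) (n b) (n (~~ b)) => t k l; clear => q_gt2 kl ql t_gt1 lt_tk e.
have {}ql : l * t = (2 * l).+1 \/ (l * t).+1 = 2 * l by rewrite e.
case: ql => [ql|ql]; last by nia.
have : l * (t - 2) == 1 by rewrite mulnBr ql; lia.
by rewrite muln_eq1 => /andP[/eqP l1 /eqP t1]; lia.
Qed.

(** The torus orders are coprime, so n b would divide the smaller positive number totient d. *)
Lemma torus_dims_neq b d d' : 2 < d -> d %| n b ->
  n (~~ b) * totient d <> n b * totient d'.
Proof.
move=> d_gt2 d_n e; have /andP[t_gt1 lt_t] := divisor_totient_lt d_gt2 d_n.
have : n b %| totient d.
  by rewrite -(Gauss_dvdr _ (coprime_torus_orders b)) e dvdn_mulr.
by move/(dvdn_leq (ltnW t_gt1)); rewrite leqNgt lt_t.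
Qed.
End TorusOrders.

Lemma iso_mod_refl (gT : finGroupType) (G : {group gT}) (M : QGmodule G) : iso_mod M M.
Proof. exact: mx_rsim_refl. Qed.

Lemma iso_mod_sym (gT : finGroupType) (G : {group gT}) (M N : QGmodule G) :
  iso_mod M N -> iso_mod N M.
Proof. exact: mx_rsim_sym. Qed.

Lemma iso_mod_trans (gT : finGroupType) (G : {group gT}) (M N P : QGmodule G) :
  iso_mod M N -> iso_mod N P -> iso_mod M P.
Proof. exact: mx_rsim_trans. Qed.

Lemma iso_qdim (gT : finGroupType) (G : {group gT}) (M N : QGmodule G) :
  iso_mod M N -> qdim M = qdim N.
Proof. by case. Qed.

Lemma iso_simple (gT : finGroupType) (G : {group gT}) (M N : QGmodule G) :
  iso_mod M N -> simple_mod M -> simple_mod N.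
Proof. by move=> iMN; apply/mx_rsim_irr. Qed.

(** * From labels to the parts of the theorem *)

Section Labels.
Variables (gT : finGroupType) (G : {group gT}) (q : nat) (b0 sq : bool).
Local Notation label := (bool + bool * nat + bool)%type.
Variable Mod : label -> QGmodule G.
Implicit Types (l : label) (M N : QGmodule G).
Local Notation valid := (psl2_label q sq).
Local Notation n := (torus_order q).

Hypotheses (q_odd : odd q) (q_gt2 : 2 < q).
Hypothesis ModP : forall l, valid l ->
  simple_mod (Mod l) /\ qdim (Mod l) = psl2_dim q b0 sq l.
Hypothesis Mod_inj : forall l l', valid l -> valid l' ->
  iso_mod (Mod l) (Mod l') -> l = l'.
Hypothesis Mod_surj : forall M, simple_mod M ->
  exists2 l, valid l & iso_mod M (Mod l).
Hypothesis trivT : trivial_mod (Mod (inl (inl true))).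
Hypothesis stS : steinberg_mod q (Mod (inl (inl false))).

Definition family (b : bool) (d : nat) : QGmodule G := Mod (inl (inr (b, d))).

Let T := Mod (inl (inl true)).
Let S := Mod (inl (inl false)).
Let rest := remaining q T S (family false) (family true).

Let qE : q = (2 * n true).+1. Proof. exact: torus_order_true. Qed.
Let n0E : n false = (n true).+1. Proof. exact: torus_order_false. Qed.
Let nT_gt0 : 0 < n true. Proof. exact: torus_order_gt0. Qed.

Let nF_gt0 : 0 < n false. Proof. by rewrite n0E. Qed.

Lemma setAE d : (d \in setA q) = (2 < d) && (d %| n false).
Proof.
have e : (q + 1) %/ 2 = n false.
  by rewrite addn1 {1}qE n0E -[X in X %/ _]addn2 -{2}[2]muln1 -mulnDr addn1 mulKn.
rewrite inE /= e; apply/andP/andP=> [[/andP[-> _] ->]|[-> dn]] //.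
by rewrite dvdn_leq // n0E.
Qed.

Lemma setBE d : (d \in setB q) = (2 < d) && (d %| n true).
Proof.
have e : (q - 1) %/ 2 = n true by rewrite {1}qE subn1 mulKn.
rewrite inE /= e; apply/andP/andP=> [[/andP[-> _] ->]|[-> dn]] //.
by rewrite dvdn_leq.
Qed.

Lemma remaining_half M :
  rest M <-> exists2 h, valid (inr h) & iso_mod M (Mod (inr h)).
Proof.
split=> [[simM nT nS nV nW]|[h vh iM]].
  have [[[[]|[[] d]]|h] vl iM] := Mod_surj simM; last by exists h.
  - by case: nT.
  - by case: nS.
  - by case: (nW d); rewrite ?setBE.
  by case: (nV d); rewrite ?setAE.
have niso l : valid l -> l <> inr h -> ~ iso_mod M (Mod l).
  move=> vl nel iMl; apply: nel; apply: Mod_inj => //.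
  by apply: iso_mod_trans iM; apply: iso_mod_sym.
split; [|exact: niso|exact: niso| |].
- by apply: (iso_simple (iso_mod_sym iM)); case: (ModP vh).
- by move=> d; rewrite setAE => vd; apply: niso.
by move=> d; rewrite setBE => vd; apply: niso.
Qed.

Lemma half_dim h : valid (inr h) -> qdim (Mod (inr h)) = (if sq then n (~~ b0) else 2 * n (~~ b0)).
Proof. by case/ModP. Qed.

(** Dimensions separate this family from the trivial and Steinberg modules and from the other
    family, and determine totient d within it. A module built from half characters can share a
    dimension with an orbit having totient d = 2, hence the exclusion of [rest]. *)
Lemma family_simple (D : pred nat) b :
    (forall d, (d \in D) = valid (inl (inr (b, d)))) ->
  simple_family D (n (~~ b)) (family b) rest.
Proof.
move=> DE; split=> [d|d d'|d].
- by rewrite DE => /ModP.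
- by rewrite !DE => vd vd' ne /(Mod_inj vd vd')[].
rewrite DE => vd M simM dimM nrest; have /= /andP[d_gt2 d_n] := vd.
have [l vl iM] := Mod_surj simM; have [_] := ModP vl; rewrite -(iso_qdim iM) dimM.
case: l vl iM => [[[]|[b' d']]|h] vl iM /=.
- by move/(torus_dim_neq1 q_odd q_gt2 d_gt2 d_n).
- by move/(torus_dim_neq_q q_odd q_gt2 d_gt2 d_n).
- have [eb|ne] := eqVneq b b'; last first.
    have -> : ~~ b' = b by case: b b' {vd vl iM d_n DE dimM} ne => [] [].
    by move/(torus_dims_neq q_odd q_gt2 d_gt2 d_n).
  have n_gt0 : 0 < n (~~ b) by case: (b); rewrite ?n0E.
  subst b'.
  move/eqP; rewrite eqn_pmul2l // => /eqP eqt; exists d'; split.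
    by rewrite DE eqt; split.
  move=> d2 []; rewrite DE => vd2 _ iM2.
  by case: (Mod_inj vl vd2 (iso_mod_trans (iso_mod_sym iM) iM2)).
by case: nrest; apply/remaining_half; exists h.
Qed.

Lemma trivial_family M : trivial_mod M -> qdim M = 1 -> iso_mod M T.
Proof.
move=> trM dM; have [simT dT] := ModP (isT : valid (inl (inl true))).
apply: simple_mod_char_inj => //; first exact: simple_dim1.
by rewrite !trivial_mod_char.
Qed.

Lemma half_dim_neq_q h : valid (inr h) -> qdim (Mod (inr h)) <> q.
Proof.
move/half_dim->; have := torus_order_q q_odd (~~ b0).
by case: (sq); move: (n (~~ b0)) q_gt2 => k; clear; lia.
Qed.

(** Dimension q is attained by no other label. *)
Lemma steinberg_unique M : steinberg_mod q M -> iso_mod M S.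
Proof.
case=> simM [_]; rewrite mod_char1 => /eqP; rewrite Num.Theory.eqr_nat => /eqP dM.
have [l vl iM] := Mod_surj simM; have [_] := ModP vl; rewrite -(iso_qdim iM) dM.
case: l vl iM => [[[]|[b d]]|h] vl iM //=.
- by move=> e; move: q_gt2; rewrite e.
- by case/andP: vl => d_gt2 d_n /esym/(torus_dim_neq_q q_odd q_gt2 d_gt2 d_n).
by move=> _; case: (half_dim_neq_q vl); rewrite -(iso_qdim iM).
Qed.

Definition labels : seq label :=
  [seq inl (inl t) | t <- [:: true; false]] ++
  [seq inl (inr (true, d)) | d <- [seq d <- divisors (n true) | 2 < d]] ++
  [seq inl (inr (false, d)) | d <- [seq d <- divisors (n false) | 2 < d]] ++
  [seq inr h | h <- if sq then [:: true; false] else [:: false]].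

Lemma mem_labels l : (l \in labels) = valid l.
Proof.
rewrite !mem_cat; apply/or4P/idP=> [[]/mapP[x xs ->] //|].
- by rewrite mem_filter -dvdn_divisors // in xs.
- by rewrite mem_filter -dvdn_divisors // in xs.
- by move: xs; rewrite /=; case: (sq); case: x.
case: l => [[t _|[b d] /= vd]|h vh].
- by constructor 1; apply: map_f; case: t.
- by case: b vd => vd; [constructor 2 | constructor 3]; apply: map_f;
    rewrite mem_filter -dvdn_divisors .
by constructor 4; apply: map_f; move: vh; rewrite /=; case: (sq); case: h.
Qed.

Lemma uniq_labels : uniq labels.
Proof.
have disj (A B : eqType) (f : A -> label) (g : B -> label) s t :
    (forall a b, f a <> g b) -> ~~ has (mem (map f s)) (map g t).
  by move=> fg; apply/hasPn=> _ /mapP[b _ ->]; apply/mapP=> [[a _ /esym/fg]].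
have inj_uniq (A : eqType) (f : A -> label) s : injective f -> uniq s -> uniq (map f s).
  by move=> /map_inj_uniq->.
rewrite /labels !cat_uniq !has_cat !negb_or !disj // !inj_uniq //;
  by [move=> x y [] | case: (sq) | rewrite filter_uniq ?divisors_uniq].
Qed.

(** Just one of the two consecutive torus orders is even, so three divisors index no orbit: 1 twice
    and 2 once. The trivial module, the Steinberg module and [inr false] replace them, and [sq] adds
    [inr true]. *)
Lemma size_labels : size labels = tau (n true) + tau (n false) + sq.
Proof.
rewrite !size_cat !size_map -!tau_gt2 //.
have -> : odd (n false) = ~~ odd (n true) by rewrite n0E.
by case: (sq); case: (odd _) => /=; clear; lia.
Qed.

Lemma card_irrQ_labels : card_irrQ G (tau (n true) + tau (n false) + sq).
Proof.
exists [seq mod_char (Mod l) | l <- labels]; split; last by rewrite size_map size_labels.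
  rewrite map_inj_in_uniq ?uniq_labels // => l l'; rewrite !mem_labels => vl vl' e.
  have [[simM _] [simM' _]] := (ModP vl, ModP vl').
  by apply: Mod_inj => //; apply: simple_mod_char_inj.
move=> phi; split=> [/mapP[l]|[M simM ->]].
  by rewrite mem_labels => /ModP[simM _] ->; exists (Mod l).
have [l vl iM] := Mod_surj simM; apply/mapP; exists l; rewrite ?mem_labels //.
exact: iso_mod_char.
Qed.

End Labels.

Section Arithmetic.
Variable q : nat.
Hypothesis q_odd : odd q.
Local Notation n := (torus_order q).

(** The split torus, of order (q - 1) / 2, is the even one exactly when 4 divides q - 1, so the
    boolean [q %% 4 == 1] can serve as [b0]. *)
Lemma torus_order_even : n (q %% 4 == 1) = 2 * (n (q %% 4 == 1))./2.
Proof.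
have qE := torus_order_true q_odd; have n0E := torus_order_false q_odd.
rewrite mul2n; apply/esym; rewrite even_halfK //.
case: eqP => [q4|q4]; rewrite ?n0E; move: (n true) qE q4 => k; clear; lia.
Qed.

Lemma half_divE : ((q - 1) %/ 2 = n true) * ((q + 1) %/ 2 = n false).
Proof.
have qE := torus_order_true q_odd; have n0E := torus_order_false q_odd.
by split; rewrite ?n0E; move: (n true) qE => k; clear; lia.
Qed.

End Arithmetic.

Theorem lemma3p4 (p k q : nat) (F : finFieldType)
  (p_prime : prime p) (p_odd : odd p) (k_gt0 : 0 < k) (q_def : q = (p ^ k)%N)
  (F_card : #|F| = q) :
  let G := [group of PSL2 F] in
  exists (T S : QGmodule G) (V W : nat -> QGmodule G),
  let rest := remaining q T S V W in
  [/\ (* (1) *)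
      [/\ trivial_mod T, qdim T = 1
        & forall M : QGmodule G, trivial_mod M -> qdim M = 1 -> iso_mod M T],
      (* (2) *)
      [/\ steinberg_mod q S, qdim S = q
        & forall M : QGmodule G, steinberg_mod q M -> iso_mod M S],
      (* (3) *)
      simple_family (setA q) ((q - 1) %/ 2) V rest,
      (* (4) *)
      simple_family (setB q) ((q + 1) %/ 2) W rest
    & (* (5) *)
      [/\ q %% 4 = 3 ->
            exists M : QGmodule G, [/\ rest M, qdim M = q - 1
              & forall N : QGmodule G, rest N -> iso_mod N M],
          q %% 4 = 1 -> ~ is_square q ->
            exists M : QGmodule G, [/\ rest M, qdim M = q + 1
              & forall N : QGmodule G, rest N -> iso_mod N M]
        & q %% 4 = 1 -> is_square q ->
            exists M1 M2 : QGmodule G,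
              [/\ rest M1 /\ rest M2, qdim M1 = (q + 1) %/ 2,
                  qdim M2 = (q + 1) %/ 2, ~ iso_mod M1 M2
                & forall N : QGmodule G, rest N -> iso_mod N M1 \/ iso_mod N M2]]]
  /\ (* (6) *)
     ((q %% 4 = 1 /\ is_square q ->
         card_irrQ G (tau ((q - 1) %/ 2) + tau ((q + 1) %/ 2) + 1))
      /\ (~ (q %% 4 = 1 /\ is_square q) ->
         card_irrQ G (tau ((q - 1) %/ 2) + tau ((q + 1) %/ 2)))).
Proof.
move=> G; have cardF : #|F| = (p ^ k)%N by rewrite F_card.
have q_odd : odd q by rewrite q_def oddX p_odd orbT.
have q_gt2 : 2 < q.
  have := finRing_gt1 F; rewrite F_card leq_eqVlt => /orP[/eqP e|//].
  by move: q_odd; rewrite -e.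
have [sq sqP] : exists sq : bool, sq <-> q %% 4 = 1 /\ is_square q.
  by case: (classic (q %% 4 = 1 /\ is_square q)); [exists true | exists false].
have b0_even := torus_order_even q_odd.
have [Mod] : exists Mod : bool + bool * nat + bool -> QGmodule G,
  [/\ forall l, psl2_label q sq l ->
        simple_mod (Mod l) /\ qdim (Mod l) = psl2_dim q (q %% 4 == 1) sq l,
      forall l l', psl2_label q sq l -> psl2_label q sq l' ->
        iso_mod (Mod l) (Mod l') -> l = l',
      forall M, simple_mod M -> exists2 l, psl2_label q sq l & iso_mod M (Mod l),
      trivial_mod (Mod (inl (inl true)))
    & steinberg_mod q (Mod (inl (inl false)))].
  move: b0_even sqP; rewrite -F_card.
  exact: (PSL2_simple_modules p_prime p_odd cardF).
case=> ModP Mod_inj Mod_surj trivT stS.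
have restP := remaining_half q_odd q_gt2 ModP Mod_inj Mod_surj.
have dim_half := half_dim ModP.
have nE := half_divE q_odd; have qE := torus_order_true q_odd.
have n0E := torus_order_false q_odd.
(* The nonsplit torus has order (q + 1) / 2, so its orbits are indexed by A and those of the split
   torus by B. *)
exists (Mod (inl (inl true))), (Mod (inl (inl false))), (family Mod false), (family Mod true).
have rest_half h : psl2_label q sq (inr h) -> remaining q (Mod (inl (inl true)))
    (Mod (inl (inl false))) (family Mod false) (family Mod true) (Mod (inr h)).
  by move=> vh; apply/restP; exists h => //; apply: iso_mod_refl.
move=> rest; split; last first.
  have := card_irrQ_labels q_odd q_gt2 ModP Mod_inj Mod_surj; rewrite !nE.
  case: (sq) sqP => sqP' cI; split=> [h|h].
  - by [].
  - by case: h; apply/sqP'.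
  - by case: sqP' => _ /(_ h).
  by rewrite addn0 in cI.
split.
- split=> //; first by case: (ModP (inl (inl true)) isT).
  exact: (trivial_family ModP trivT).
- split=> //; first by case: (ModP (inl (inl false)) isT).
  exact: (steinberg_unique q_odd q_gt2 ModP Mod_surj).
- rewrite nE; apply: (family_simple (b := false) q_odd q_gt2 ModP Mod_inj Mod_surj) => d.
  exact: setAE.
- rewrite nE; apply: (family_simple (b := true) q_odd q_gt2 ModP Mod_inj Mod_surj) => d.
  exact: setBE.
have [nsq|is_sq] : sq = false \/ sq = true by case: (sq); [right | left].
  have vF : psl2_label q sq (inr false) by rewrite nsq.
  have rest_iso M : rest M -> iso_mod M (Mod (inr false)).
    by case/restP=> h; rewrite /= nsq; case: h.
  split=> [q4|q4 _|q4 isq].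
  - exists (Mod (inr false)); split=> //; first exact: rest_half.
    by rewrite (dim_half _ vF) nsq q4 /= {2}qE subn1.
  - exists (Mod (inr false)); split=> //; first exact: rest_half.
    by rewrite (dim_half _ vF) nsq q4 /= n0E {2}qE addn1 mulnS.
  by move/sqP: (conj q4 isq); rewrite nsq.
have [q4 isq] : q %% 4 = 1 /\ is_square q by apply/sqP.
have vh h : psl2_label q sq (inr h) by rewrite /= is_sq.
split=> [e|_ /(_ isq)//|_ _]; first by rewrite e in q4.
exists (Mod (inr true)), (Mod (inr false)); split.
- by split; apply: rest_half.
- by rewrite (dim_half _ (vh _)) is_sq q4 nE.
- by rewrite (dim_half _ (vh _)) is_sq q4 nE.
- by move/(Mod_inj _ _ (vh _) (vh _)).
by move=> N /restP[[] _ iN]; [left | right].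
Qed.
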